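(* Let $\alpha,\beta\in\mathbb{R}_{>0}^n$ with $\alpha<\beta$, and let $P$ be a finite projective $K_{[\alpha,\beta],n}$-module. Then, for any $\rho\in\mathbb{R}^n$ with $\alpha<\rho<\beta$, there exist $\alpha',\beta'\in\mathbb{R}^n_{>0}$ with $\alpha<\alpha'<\rho<\beta'<\beta$ such that $P_{[\alpha',\beta']}:=K_{[\alpha',\beta'],n}\otimes_{K_{[\alpha,\beta],n}}P$ is free over $K_{[\alpha',\beta'],n}$.
   Context: Fix a prime $p$, a complete nonarchimedean field $K$ of mixed characteristic $(0,p)$ with norm $|\cdot|$, $|p|=p^{-1}$, and a positive integer $n$. For $\alpha,\beta\in\mathbb{R}^n$, $\alpha<\beta$ means $\alpha_i<\beta_i$ for all $1\le i\le n$, and $[\alpha,\beta]=\prod_{i=1}^n[\alpha_i,\beta_i]$. $K_{[\alpha,\beta],n}$ is the ring of Laurent series $\sum_{i\in\mathbb{Z}^n}f_it^i$ ($f_i\in K$, $t^i=t_1^{i_1}\cdots t_n^{i_n}$) with $\lim_{|i|\to\infty}|f_i|\rho^i=0$ for all $\rho\in[\alpha,\beta]$, where $\rho^i=\rho_1^{i_1}\cdots\rho_n^{i_n}$ and $|i|=|i_1|+\cdots+|i_n|$. *)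

(* Defs.v *)
From HB Require Import structures.
From mathcomp Require Import all_boot all_order all_algebra.
From mathcomp Require Import zify ring finmap.
From mathcomp Require Import boolp classical_sets reals.
Set Implicit Arguments.
Unset Strict Implicit.
Unset Printing Implicit Defensive.
Import Order.TTheory GRing.Theory Num.Theory.
Local Open Scope ring_scope.

HB.mixin Record Field_isCompleteNonarch (R : realType) K of GRing.Field K := {
  nnorm : K -> R ;
  nnorm_ge0 : forall x, 0 <= nnorm x ;
  nnorm0_eq0 : forall x, nnorm x = 0 -> x = 0 ;
  nnorm0 : nnorm 0 = 0 ;
  nnormM : forall x y, nnorm (x * y) = nnorm x * nnorm y ;
  nnormD_le_max : forall x y, nnorm (x + y) <= Num.max (nnorm x) (nnorm y) ;
  nnorm_complete : forall u : nat -> K,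
    (forall e, 0 < e -> exists N, forall i j : nat, (N <= i)%N -> (N <= j)%N ->
      nnorm (u i - u j) < e) ->
    exists l, forall e, 0 < e -> exists N, forall i : nat, (N <= i)%N ->
      nnorm (u i - l) < e
}.

#[short(type="completeNonarchFieldType")]
HB.structure Definition CompleteNonarchField (R : realType) :=
  { K of GRing.Field K & Field_isCompleteNonarch R K }.

Section NonarchTheory.
Variables (R : realType) (K : completeNonarchFieldType R).
Implicit Types x y : K.

Lemma nnorm1 : nnorm (1 : K) = 1.
Proof.
have /eqP : nnorm (1 : K) * nnorm (1 : K) = nnorm (1 : K) * 1.
  by rewrite -nnormM !mulr1.
rewrite -subr_eq0 -mulrBr mulf_eq0 subr_eq0 => /orP[/eqP/nnorm0_eq0/eqP|/eqP//].
by rewrite oner_eq0.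
Qed.

Lemma nnormN x : nnorm (- x) = nnorm x.
Proof.
have h : nnorm (-1 : K) = 1.
  apply/eqP; rewrite -(@eqrXn2 _ 2) ?nnorm_ge0 ?ler01 //.
  by rewrite expr1n expr2 -nnormM mulrNN mulr1 nnorm1.
by rewrite -mulN1r nnormM h mul1r.
Qed.

Lemma nnormD_lt x y e : nnorm x < e -> nnorm y < e -> nnorm (x + y) < e.
Proof. by move=> xe ye; apply: le_lt_trans (nnormD_le_max x y) _; rewrite gt_max xe. Qed.

Lemma nnormD_le x y e : nnorm x <= e -> nnorm y <= e -> nnorm (x + y) <= e.
Proof. by move=> xe ye; apply: le_trans (nnormD_le_max x y) _; rewrite ge_max xe. Qed.

Lemma nnorm_sum_le (I : Type) (s : seq I) (P : pred I) (u : I -> K) e :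
  0 <= e -> (forall i, P i -> nnorm (u i) <= e) ->
  nnorm (\sum_(i <- s | P i) u i) <= e.
Proof.
move=> e0 ue; elim/big_rec: _ => [|i x Pi xe]; first by rewrite nnorm0.
exact: nnormD_le (ue _ Pi) xe.
Qed.

End NonarchTheory.

(* Unconditional (order-free) sums of families indexed by an arbitrary set *)
Section Summation.
Local Open Scope fset_scope.
Local Open Scope ring_scope.
Variable R : realType.

(* w i -> 0 along the complements of finite sets *)
Definition tends0 (I : choiceType) (w : I -> R) : Prop :=
  forall e, 0 < e -> exists F : {fset I}, forall i, i \notin F -> `|w i| < e.

Lemma tends0_le (I : choiceType) (w w' : I -> R) :
  (forall i, `|w i| <= `|w' i|) -> tends0 w' -> tends0 w.
Proof.
move=> ww w0 e /w0[F FP]; exists F => i /FP.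
exact: le_lt_trans.
Qed.

Lemma tends0_bounded (I : choiceType) (w : I -> R) : tends0 w ->
  exists2 M, 0 < M & forall i, `|w i| <= M.
Proof.
move=> /(_ 1 ltr01)[F FP].
exists (1 + \sum_(i <- F) `|w i|).
  by rewrite ltr_pwDl ?ltr01 // sumr_ge0.
move=> i; have [iF|/FP/ltW h] := boolP (i \in F); last first.
  by apply: le_trans h _; rewrite lerDl sumr_ge0.
rewrite (big_fsetD1 i) //= addrCA lerDl addr_ge0 ?ler01 // sumr_ge0 //.
Qed.

Lemma tends0_mulb (I : choiceType) (w b : I -> R) M :
  (forall i, `|b i| <= M) -> tends0 w -> tends0 (fun i => w i * b i).
Proof.
move=> bM w0 e e0.
have M0 : 0 < `|M| + 1 by rewrite ltr_wpDl.
have [F FP] := w0 (e / (`|M| + 1)) (divr_gt0 e0 M0).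
exists F => i /FP; rewrite ltr_pdivlMr // normrM; apply: le_lt_trans.
rewrite ler_wpM2l // (le_trans (bM i)) // (le_trans (ler_norm M)) //.
by rewrite lerDl.
Qed.

Lemma tends0M (I J : choiceType) (w : I -> R) (w' : J -> R) :
  tends0 w -> tends0 w' -> tends0 (fun ij : I * J => w ij.1 * w' ij.2).
Proof.
move=> w0 w'0 e e0.
have [M M0 wM] := tends0_bounded w0; have [M' M'0 wM'] := tends0_bounded w'0.
have [F FP] := w0 (e / M') (divr_gt0 e0 M'0).
have [G GP] := w'0 (e / M) (divr_gt0 e0 M0).
exists (F `*` G) => -[i j]; rewrite in_fsetM negb_and normrM /= => /orP[/FP|/GP] h.
  by move: h; rewrite ltr_pdivlMr //; apply: le_lt_trans; rewrite ler_wpM2l.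
move: h; rewrite ltr_pdivlMr //; apply: le_lt_trans.
by rewrite mulrC ler_wpM2l.
Qed.

Lemma tends0_inj (I J : choiceType) (h : J -> I) (w : I -> R) :
  injective h -> tends0 w -> tends0 (w \o h).
Proof.
move=> hinj w0 e /w0[F FP].
pose G := [fset j | j in pmap (fun i => if pselect (exists j, h j = i) is left ex
   then Some (projT1 (cid ex)) else None) F].
exists G => j jG; apply: FP; apply: contra jG => hF.
rewrite /G; apply/imfsetP; exists j => //=.
rewrite mem_pmap; apply/mapP; exists (h j) => //.
case: pselect => [ex|[]]; last by exists j.
by case: cid => j' /= /hinj ->.
Qed.

Variable K : completeNonarchFieldType R.

Definition has_sum (I : choiceType) (u : I -> K) (s : K) : Prop :=
  forall e : R, 0 < e -> exists F0 : {fset I},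
    forall F : {fset I}, F0 `<=` F -> nnorm (\sum_(i <- F) u i - s) < e.

(* The sum of the family u, with junk value 0 if u is not summable *)
Definition isum (I : choiceType) (u : I -> K) : K := xget 0 (has_sum u).

Definition null_family (I : choiceType) (u : I -> K) : Prop :=
  tends0 (fun i => nnorm (u i)).

Lemma nnorm_small (x : K) : (forall e : R, 0 < e -> nnorm x < e) -> x = 0.
Proof.
move=> h; apply: nnorm0_eq0; apply/eqP; rewrite eq_le nnorm_ge0 andbT.
by apply/ler_addgt0Pr => e e0; rewrite add0r ltW // h.
Qed.

Lemma has_sum_uniq (I : choiceType) (u : I -> K) s t :
  has_sum u s -> has_sum u t -> s = t.
Proof.
move=> hs ht; apply/eqP; rewrite -subr_eq0; apply/eqP/nnorm_small => e e0.
have [F FP] := hs e e0; have [G GP] := ht e e0.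
have := FP (F `|` G) (fsubsetUl _ _); have := GP (F `|` G) (fsubsetUr _ _).
set S := \sum_(_ <- _) _ => h1 h2.
have -> : s - t = - (S - s) + (S - t) by rewrite opprB addrA subrK.
by apply: nnormD_lt; rewrite ?nnormN.
Qed.

Lemma has_sum_isum (I : choiceType) (u : I -> K) s : has_sum u s -> isum u = s.
Proof.
move=> hs; rewrite /isum; case: xgetP => [x _ hx|/(_ s)//].
exact: has_sum_uniq hx hs.
Qed.

Lemma nnorm_sumB (I : choiceType) (u : I -> K) (F G H : {fset I}) (e : R) :
  0 <= e -> (forall i, i \notin F -> nnorm (u i) <= e) ->
  F `<=` G -> F `<=` H ->
  nnorm (\sum_(i <- G) u i - \sum_(i <- H) u i) <= e.
Proof.
move=> e0 ue FG FH.
have key (L : {fset I}) : F `<=` L ->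
    exists2 r, \sum_(i <- L) u i = \sum_(i <- F) u i + r & nnorm r <= e.
  move=> FL; exists (\sum_(i <- L `\` F) u i).
    rewrite (big_fsetID _ (mem F)) /=; congr (_ + _); apply: eq_fbigl => i.
      rewrite !inE /= andbC; case: (boolP (i \in F)) => //= iF.
      by rewrite (fsubsetP FL).
    by rewrite !inE /= andbC.
  rewrite big_seq; apply: nnorm_sum_le => // i.
  by rewrite inE => /andP[/ue].
have [r -> re] := key _ FG; have [r' -> r'e] := key _ FH.
by rewrite opprD addrACA subrr add0r nnormD_le ?nnormN.
Qed.

Lemma null_has_sum (I : choiceType) (u : I -> K) :
  null_family u -> has_sum u (isum u).
Proof.
move=> u0; suff [s hs] : exists s, has_sum u s by rewrite (has_sum_isum hs).
have pk (k : nat) : 0 < k.+1%:R^-1 :> R by rewrite invr_gt0 ltr0n.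
have /choice[F FP] : forall k : nat, exists F : {fset I}, forall i, i \notin F ->
    nnorm (u i) < k.+1%:R^-1.
  move=> k; have [F FP] := u0 _ (pk k); exists F => i /FP.
  by rewrite ger0_norm // nnorm_ge0.
pose G k := \bigcup_(j <- iota 0 k.+1) F j.
have FG k j : (k <= j)%N -> F k `<=` G j.
  move=> kj; apply/fsubsetP => x xk; apply/bigfcupP; exists k => //.
  by rewrite mem_iota add0n ltnS kj.
have small (e : R) : 0 < e -> exists k : nat, k.+1%:R^-1 < e.
  move=> e0; exists (Num.truncn e^-1).
  rewrite invf_plt ?posrE ?ltr0n //.
  by apply: truncnS_gt.
have [l lP] : exists l, forall e : R, 0 < e -> exists N, forall k : nat, (N <= k)%N ->
    nnorm (\sum_(i <- G k) u i - l) < e.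
  apply: nnorm_complete => e /small[k ke]; exists k => i j ki kj.
  apply: le_lt_trans ke; apply: nnorm_sumB (FG _ _ ki) (FG _ _ kj).
    exact: ltW.
  by move=> x /FP/ltW.
exists l => e e0; have [k ke] := small e e0; have [N NP] := lP e e0.
exists (F k) => H FH.
rewrite -(subrK (\sum_(i <- G (maxn k N)) u i) (\sum_(i <- H) u i)) -addrA.
apply: nnormD_lt; last by apply: NP; rewrite leq_maxr.
apply: le_lt_trans ke; apply: nnorm_sumB FH (FG _ _ (leq_maxl _ _)).
  exact: ltW.
by move=> x /FP/ltW.
Qed.

Lemma has_sum_approx (I : choiceType) (u : I -> K) s (F G : {fset I}) (e : R) :
  has_sum u s -> 0 <= e -> (forall i, i \notin F -> nnorm (u i) <= e) ->
  F `<=` G -> nnorm (\sum_(i <- G) u i - s) <= e.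
Proof.
move=> hs e0 ue FG; apply/ler_addgt0Pr => d d0.
have [H HP] := hs d d0.
have /HP h : H `<=` F `|` H by rewrite fsubsetUr.
rewrite -(subrK (\sum_(i <- F `|` H) u i) (\sum_(i <- G) u i)) -addrA.
apply: nnormD_le.
  by apply: le_trans (nnorm_sumB e0 ue FG (fsubsetUl F H)) _; rewrite lerDl ltW.
by apply: le_trans (ltW h) _; rewrite lerDr.
Qed.

Lemma has_sum_le (I : choiceType) (u : I -> K) s (e : R) :
  has_sum u s -> 0 <= e -> (forall i, nnorm (u i) <= e) -> nnorm s <= e.
Proof.
move=> hs e0 ue.
have := @has_sum_approx _ u s fset0 fset0 e hs e0 (fun i _ => ue i) (fsubset_refl _).
by rewrite big_seq_fset0 sub0r nnormN.
Qed.

Lemma has_sumD (I : choiceType) (u v : I -> K) s t :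
  has_sum u s -> has_sum v t -> has_sum (fun i => u i + v i) (s + t).
Proof.
move=> hs ht e e0; have [F FP] := hs e e0; have [G GP] := ht e e0.
exists (F `|` G) => H; rewrite fsubUset => /andP[/FP h /GP h'].
by rewrite big_split opprD addrACA nnormD_lt.
Qed.

Lemma has_sumZ (I : choiceType) (u : I -> K) s c :
  has_sum u s -> has_sum (fun i => c * u i) (c * s).
Proof.
move=> hs e e0; have c0 : 0 < nnorm c + 1 by rewrite ltr_wpDl ?nnorm_ge0.
have [F FP] := hs (e / (nnorm c + 1)) (divr_gt0 e0 c0).
exists F => G /FP; rewrite ltr_pdivlMr // -mulr_sumr -mulrBr nnormM (mulrC (nnorm c)).
by apply: le_lt_trans; rewrite ler_wpM2l ?nnorm_ge0 // lerDl.
Qed.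

Lemma has_sum_reindex (I J : choiceType) (h : J -> I) (u : I -> K) s :
  bijective h -> has_sum u s -> has_sum (u \o h) s.
Proof.
move=> [g hg gh] hs e e0; have [F FP] := hs e e0.
exists [fset g i | i in F] => G FG.
have -> : \sum_(j <- G) (u \o h) j = \sum_(i <- [fset h j | j in G]) u i.
  by rewrite big_imfset //= => x y _ _; apply: can_inj hg _ _.
apply: FP; apply/fsubsetP => i iF; apply/imfsetP; exists (g i) => //=.
by apply: (fsubsetP FG); apply/imfsetP; exists i.
Qed.

Lemma has_sum1 (I : choiceType) (u : I -> K) i0 :
  (forall i, i != i0 -> u i = 0) -> has_sum u (u i0).
Proof.
move=> h e e0; exists [fset i0] => F; rewrite fsub1set => iF.
rewrite (big_fsetD1 i0) //= big_seq big1 ?addr0 ?subrr ?nnorm0 // => i.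
by rewrite !inE => /andP[/h].
Qed.

Lemma null_reindex (I J : choiceType) (h : J -> I) (u : I -> K) :
  injective h -> null_family u -> null_family (u \o h).
Proof. by move=> hinj; exact: (tends0_inj hinj). Qed.

Lemma isum_reindex (I J : choiceType) (h : J -> I) (u : I -> K) :
  bijective h -> null_family u -> isum (u \o h) = isum u.
Proof. by move=> hb /null_has_sum/(has_sum_reindex hb)/has_sum_isum. Qed.

Lemma isum_fubini (I J : choiceType) (u : I * J -> K) : null_family u ->
  isum u = isum (fun i => isum (fun j => u (i, j))).
Proof.
move=> u0; apply/esym/has_sum_isum => e e0.
have e2 : 0 < e / 2 by rewrite divr_gt0 ?ltr0n.
have [F FP] := u0 _ e2.
have FP' i j : (i, j) \notin F -> nnorm (u (i, j)) <= e / 2.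
  by move/FP; rewrite ger0_norm ?nnorm_ge0 //; apply: ltW.
exists [fset x.1 | x in F] => G FG; pose H := [fset x.2 | x in F].
apply: (@le_lt_trans _ _ (e / 2)); last first.
  by rewrite ltr_pdivrMr ?ltr0n // ltr_pMr // ltr1n.
rewrite -(subrK (\sum_(x <- G `*` H) u x) (\sum_(i <- G) _)) -addrA.
apply: nnormD_le; last first.
  apply: (has_sum_approx (F := F) (null_has_sum u0) (ltW e2)).
    by move=> [i j]; exact: FP'.
  apply/fsubsetP => x xF; rewrite in_fsetM; apply/andP; split.
    by apply: (fsubsetP FG); apply/imfsetP; exists x.
  by apply/imfsetP; exists x.
have -> : \sum_(x <- G `*` H) u x = \sum_(i <- G) \sum_(j <- H) u (i, j).
  rewrite [RHS](_ : _ = \sum_(x <- [seq (i, j) | i <- G, j <- H]) u x); last first.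
    by rewrite big_allpairs.
  apply: perm_big; apply: uniq_perm => //=.
    by apply: allpairs_uniq => // -[? ?] [? ?] _ _ /= [-> ->].
  move=> [i j]; rewrite in_fsetM /=.
  by apply/idP/allpairsP => [/andP[iG jH]|[[? ?] [/= ? ? [-> ->]]]]; [exists (i, j)|apply/andP].
rewrite -sumrB; apply: nnorm_sum_le; first exact: ltW.
move=> i _; rewrite -nnormN opprB.
apply: (has_sum_approx (F := H)) => //; last 1 first.
- move=> j jH; apply: FP'; apply: contra jH => ijF.
  by apply/imfsetP; exists (i, j).
- apply: null_has_sum; apply: (null_reindex (h := fun j => (i, j))) => //.
  by move=> ? ? [].
- exact: ltW.
Qed.

End Summation.

Definition ltv (R : realType) n (a b : 'rV[R]_n) : Prop := forall i, a 0 i < b 0 i.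
Definition lev (R : realType) n (a b : 'rV[R]_n) : Prop := forall i, a 0 i <= b 0 i.

Lemma ltvW (R : realType) n (a b : 'rV[R]_n) : ltv a b -> lev a b.
Proof. by move=> h i; apply: ltW. Qed.

Lemma ltv_trans (R : realType) n (a b c : 'rV[R]_n) : ltv a b -> ltv b c -> ltv a c.
Proof. by move=> h h' i; apply: lt_trans (h i) (h' i). Qed.

Section MultiExponents.
Variables (R : realType) (n : nat).
Implicit Types (i : 'rV[int]_n) (rho : 'rV[R]_n).

Definition mabs i : nat := (\sum_(j < n) `|i 0%R j|%N)%N.

Definition monom rho i : R := \prod_(j < n) rho 0 j ^ i 0 j.

Lemma monom_gt0 rho i : ltv 0 rho -> 0 < monom rho i.
Proof. by move=> h; apply: prodr_gt0 => j _; apply: exprz_gt0; have := h j; rewrite mxE. Qed.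

Lemma monomD rho i i' : ltv 0 rho -> monom rho (i + i') = monom rho i * monom rho i'.
Proof.
move=> h; rewrite /monom -big_split /=; apply: eq_bigr => j _.
by rewrite mxE expfzDr // gt_eqF //; have := h j; rewrite mxE.
Qed.

Lemma monom0 rho : monom rho 0 = 1.
Proof. by rewrite /monom big1 // => j _; rewrite mxE. Qed.

Lemma mabs_bound (F : {fset 'rV[int]_n}) :
  exists N, forall i, (N <= mabs i)%N -> i \notin F.
Proof.
exists (\sum_(i <- F) mabs i).+1 => i; apply: contraL => iF.
by rewrite -ltnNge ltnS (big_fsetD1 i) //= leq_addr.
Qed.

Lemma mabs_finite (N : nat) :
  exists F : {fset 'rV[int]_n}, forall i, i \notin F -> (N <= mabs i)%N.
Proof.
pose h (x : 'M['I_(N + N).+1]_(1, n)) : 'rV[int]_n :=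
  map_mx (fun y : 'I_(N + N).+1 => (y : nat)%:Z - N%:Z) x.
exists [fset h x | x in predT]%fset => i; apply: contraR; rewrite -ltnNge => iN.
have ij j : (`|i 0%R j| < N)%N.
  by apply: leq_ltn_trans iN; rewrite /mabs (bigD1 j) //= leq_addr.
apply/imfsetP; exists (map_mx (fun y => inord (absz (y + N%:Z)%R)) i) => //.
apply/rowP => j; rewrite !mxE; have := ij j; move: (i 0 j) => y yN.
by rewrite inordK; lia.
Qed.

End MultiExponents.

Section Laurent.
Variables (R : realType) (K : completeNonarchFieldType R) (n : nat).
Implicit Types (f g h : 'rV[int]_n -> K) (a b rho : 'rV[R]_n).

(* |f_i| rho^i -> 0 as |i| -> oo, for every rho in [a, b] *)
Definition convergent_on a b f : Prop :=
  forall rho, lev a rho -> lev rho b ->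
  forall e : R, 0 < e -> exists N : nat, forall i, (N <= mabs i)%N ->
    nnorm (f i) * monom rho i < e.

Lemma convergent_onP a b f : ltv 0 a ->
  convergent_on a b f <-> (forall rho, lev a rho -> lev rho b ->
    tends0 (fun i => nnorm (f i) * monom rho i)).
Proof.
move=> a0; split=> fab rho arho rhob e e0.
  have [N NP] := fab rho arho rhob e e0; have [F FP] := @mabs_finite n N.
  exists F => i /FP/NP; rewrite ger0_norm // mulr_ge0 ?nnorm_ge0 //.
  by rewrite ltW // monom_gt0 // => j; apply: lt_le_trans (a0 j) (arho j).
have [F FP] := fab rho arho rhob e e0; have [N NP] := mabs_bound F.
by exists N => i /NP/FP; apply: le_lt_trans; apply: ler_norm.
Qed.

(* The ring K_{[a,b],n}; the two proofs are only used by the ring structure *)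
Record laurent a b (a0 : ltv 0 a) (ab : lev a b) : Type := Laurent {
  coef :> 'rV[int]_n -> K ;
  coefP : convergent_on a b coef }.

Lemma laurentP a b (a0 : ltv 0 a) (ab : lev a b) (f g : laurent a0 ab) :
  (forall i, f i = g i) -> f = g.
Proof.
case: f g => f fP [g gP] /= /funext fg; case: g / fg gP => gP.
by rewrite (Prop_irrelevance fP gP).
Qed.

Section LaurentRing.
Variables (a b : 'rV[R]_n) (a0 : ltv 0 a) (ab : lev a b).
Local Notation L := (laurent a0 ab).

HB.instance Definition _ := gen_eqMixin L.
HB.instance Definition _ := gen_choiceMixin L.

Let pos rho : lev a rho -> ltv 0 rho.
Proof. by move=> h j; apply: lt_le_trans (a0 j) (h j). Qed.

Lemma convergent_add f g : convergent_on a b f -> convergent_on a b g ->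
  convergent_on a b (fun i => f i + g i).
Proof.
move=> fP gP rho arho rhob e e0.
have [N NP] := fP _ arho rhob e e0; have [M MP] := gP _ arho rhob e e0.
exists (maxn N M) => i; rewrite geq_max => /andP[/NP h1 /MP h2].
have r0 := monom_gt0 i (pos arho).
by move: h1 h2; rewrite -!ltr_pdivlMr //; apply: nnormD_lt.
Qed.

Lemma convergent_opp f : convergent_on a b f -> convergent_on a b (fun i => - f i).
Proof.
move=> fP rho arho rhob e e0; have [N NP] := fP _ arho rhob e e0.
by exists N => i /NP; rewrite nnormN.
Qed.

Lemma convergent_const (c : K) :
  convergent_on a b (fun i => if i == 0 then c else 0).
Proof.
move=> rho arho rhob e e0; exists 1%N => i; case: eqP => [->|_ _].
  by rewrite /mabs big1 // => j _; rewrite mxE.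
by rewrite nnorm0 mul0r.
Qed.

Definition laurent_const c : L := Laurent a0 ab (convergent_const c).
Definition laurent_add (f g : L) : L := Laurent a0 ab (convergent_add (coefP f) (coefP g)).
Definition laurent_opp (f : L) : L := Laurent a0 ab (convergent_opp (coefP f)).

Lemma laurent_addA : associative laurent_add.
Proof. by move=> f g h; apply: laurentP => i /=; rewrite addrA. Qed.
Lemma laurent_addC : commutative laurent_add.
Proof. by move=> f g; apply: laurentP => i /=; rewrite addrC. Qed.
Lemma laurent_add0 : left_id (laurent_const 0) laurent_add.
Proof. by move=> f; apply: laurentP => i /=; rewrite if_same add0r. Qed.
Lemma laurent_addN : left_inverse (laurent_const 0) laurent_opp laurent_add.
Proof. by move=> f; apply: laurentP => i /=; rewrite if_same addNr. Qed.

HB.instance Definition _ := GRing.isZmodule.Build L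
  laurent_addA laurent_addC laurent_add0 laurent_addN.

(* (fg)_k = \sum_i f_i g_(k-i), an infinite sum in K *)
Definition conv f g (k : 'rV[int]_n) : K := isum (fun i => f i * g (k - i)).

Let rab : lev a a. Proof. by []. Qed.

Lemma tends0_coef f rho : convergent_on a b f -> lev a rho -> lev rho b ->
  tends0 (fun i => nnorm (f i) * monom rho i).
Proof. by move=> /(convergent_onP _ _ a0); apply. Qed.

Lemma null_weight (I : choiceType) (u : I -> K) (w : I -> R) (c : R) :
  0 < c -> (forall x, nnorm (u x) * c = w x) -> tends0 w -> null_family u.
Proof.
move=> c0 uw w0 e e0; have [F FP] := w0 (e * c) (mulr_gt0 e0 c0).
exists F => x /FP; rewrite -uw !ger0_norm ?nnorm_ge0 //; last first.
  by rewrite mulr_ge0 ?nnorm_ge0 // ltW.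
by rewrite ltr_pM2r.
Qed.

Lemma null_conv f g k : convergent_on a b f -> convergent_on a b g ->
  null_family (fun i => f i * g (k - i)).
Proof.
move=> fP gP.
have gk : tends0 (fun i => nnorm (g (k - i)) * monom a (k - i)).
  by apply: (tends0_inj (h := fun i => k - i) _ (tends0_coef gP rab ab)) => x y /addrI/oppr_inj.
have [M _ MP] := tends0_bounded gk.
apply: null_weight (monom_gt0 k a0) _ (tends0_mulb MP (tends0_coef fP rab ab)) => i.
rewrite nnormM mulrACA -monomD //; congr (_ * monom _ _).
by rewrite addrC subrK.
Qed.

Lemma convergent_conv f g : convergent_on a b f -> convergent_on a b g ->
  convergent_on a b (conv f g).
Proof.
move=> fP gP; apply/(convergent_onP _ _ a0) => rho arho rhob e e0.
have e2 : 0 < e / 2 by rewrite divr_gt0 ?ltr0n.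
have [F FP] := tends0M (tends0_coef fP arho rhob) (tends0_coef gP arho rhob) e2.
exists [fset (x.1 + x.2)%R | x in F]%fset => k kF.
have rk := monom_gt0 k (pos arho).
rewrite ger0_norm; last by rewrite mulr_ge0 ?nnorm_ge0 // ltW.
apply: (@le_lt_trans _ _ (e / 2)); last first.
  by rewrite ltr_pdivrMr ?ltr0n // ltr_pMr // ltr1n.
rewrite -ler_pdivlMr //; apply: has_sum_le (null_has_sum (null_conv k fP gP)) _ _.
  by rewrite ltW // divr_gt0.
move=> i; rewrite ler_pdivlMr //.
have /FP : (i, k - i) \notin F.
  apply: contra kF => iF; apply/imfsetP; exists (i, k - i) => //=.
  by rewrite addrC subrK.
move=> /ltW; apply: le_trans; apply: le_trans (ler_norm _).
rewrite nnormM mulrACA -monomD /=; last exact: pos.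
by rewrite (addrC i) subrK.
Qed.

Definition laurent_mul (f g : L) : L :=
  Laurent a0 ab (convergent_conv (coefP f) (coefP g)).

Lemma laurent_mulC : commutative laurent_mul.
Proof.
move=> f g; apply: laurentP => k /=; rewrite /conv.
rewrite -(@isum_reindex _ _ _ _ (fun i => k - i) (fun i => g i * f (k - i))).
- by congr isum; apply: funext => i /=; rewrite mulrC subKr.
- by exists (fun i => k - i) => i; rewrite subKr.
- exact: null_conv (coefP g) (coefP f).
Qed.

Lemma laurent_mul1 : left_id (laurent_const 1) laurent_mul.
Proof.
move=> f; apply: laurentP => k /=; rewrite /conv.
rewrite (has_sum_isum (s := 1 * f (k - 0))) ?subr0 ?mul1r //.
have := @has_sum1 _ K _ (fun i => (if i == 0 then 1 else 0) * f (k - i)) 0.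
by rewrite eqxx subr0 mul1r; apply => i /negPf ->; rewrite mul0r.
Qed.

Lemma laurent_mulDl : left_distributive laurent_mul laurent_add.
Proof.
move=> f g h; apply: laurentP => k /=; rewrite /conv.
under [X in isum X]funext do rewrite mulrDl.
by apply/has_sum_isum/has_sumD; apply/null_has_sum/null_conv; apply: coefP.
Qed.

Lemma laurent_mulA : associative laurent_mul.
Proof.
move=> f g h; apply: laurentP => k /=; rewrite /conv.
pose u (x : 'rV[int]_n * 'rV[int]_n) := f x.1 * (g x.2 * h (k - x.1 - x.2)).
have u0 : null_family u.
  have [M _ MP] := tends0_bounded (tends0_coef (coefP h) rab ab).
  apply: null_weight (monom_gt0 k a0) _
    (tends0_mulb (b := fun x => nnorm (h (k - x.1 - x.2)) * monom a (k - x.1 - x.2)) _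
      (tends0M (tends0_coef (coefP f) rab ab) (tends0_coef (coefP g) rab ab))).
    move=> x /=; rewrite !nnormM.
    rewrite (_ : monom a k = monom a x.1 * monom a x.2 * monom a (k - x.1 - x.2)).
      by ring.
    by rewrite -!monomD //; congr monom; rewrite -(addrA k) -opprD subrKC.
  by move=> x; apply: MP.
pose sw (y : 'rV[int]_n * 'rV[int]_n) := (y.2, y.1 - y.2).
have sw_bij : bijective sw.
  exists (fun x => (x.1 + x.2, x.1)) => -[x y]; rewrite /sw /=.
    by rewrite addrC subrK.
  by rewrite addrC addKr.
transitivity (isum u).
  rewrite isum_fubini //; congr isum; apply: funext => i /=.
  apply/esym/has_sum_isum.
  exact: has_sumZ (f i) (null_has_sum (null_conv (k - i) (coefP g) (coefP h))).
rewrite -(isum_reindex sw_bij u0) isum_fubini; last first.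
  by apply: null_reindex u0; exact: bij_inj.
congr isum; apply: funext => l /=; rewrite mulrC.
rewrite (_ : (fun j => _) = (fun j => h (k - l) * (f j * g (l - j)))); last first.
  apply: funext => j; rewrite /u /= mulrA mulrC; congr (h _ * _).
  by rewrite opprB addrA subrK.
apply/has_sum_isum.
exact: has_sumZ (h (k - l)) (null_has_sum (null_conv l (coefP f) (coefP g))).
Qed.

Lemma laurent_1_neq0 : laurent_const 1 != 0.
Proof.
apply/eqP => /(congr1 (fun f : L => f 0)) /=; rewrite eqxx => /eqP.
by rewrite oner_eq0.
Qed.

HB.instance Definition _ := GRing.Zmodule_isComNzRing.Build L
  laurent_mulA laurent_mulC laurent_mul1 laurent_mulDl laurent_1_neq0.

End LaurentRing.

Section Restriction.
Variables (a b a' b' : 'rV[R]_n).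
Variables (a0 : ltv 0 a) (ab : lev a b) (a'0 : ltv 0 a') (a'b' : lev a' b').
Variables (aa' : lev a a') (b'b : lev b' b).

Lemma convergent_sub f : convergent_on a b f -> convergent_on a' b' f.
Proof.
by move=> fP rho h h'; apply: fP => i; [apply: le_trans (h i)|apply: le_trans (h' i) _].
Qed.

(* The canonical map K_{[a,b],n} -> K_{[a',b'],n} for [a',b'] in [a,b] *)
Definition laurent_restr (f : laurent a0 ab) : laurent a'0 a'b' :=
  Laurent a'0 a'b' (convergent_sub (coefP f)).

Lemma laurent_restr_is_zmod_morphism : zmod_morphism laurent_restr.
Proof. by move=> f g; apply: laurentP. Qed.

Lemma laurent_restr_is_monoid_morphism : monoid_morphism laurent_restr.
Proof. by split=> [|f g]; apply: laurentP. Qed.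

HB.instance Definition _ := GRing.isZmodMorphism.Build _ _ laurent_restr
  laurent_restr_is_zmod_morphism.
HB.instance Definition _ := GRing.isMonoidMorphism.Build _ _ laurent_restr
  laurent_restr_is_monoid_morphism.

End Restriction.
End Laurent.

Section Modules.
Variable A : pzRingType.
Implicit Type M : lmodType A.

Definition finitely_generated M : Prop :=
  exists (m : nat) (g : 'I_m -> M),
    forall x, exists c : 'I_m -> A, x = \sum_(i < m) c i *: g i.

Definition projective M : Prop :=
  forall (N N' : lmodType A) (q : {linear N -> N'}) (h : {linear M -> N'}),
    (forall y, exists x, q x = y) ->
    exists h' : {linear M -> N}, forall x, q (h' x) = h x.

Definition is_basis M (I : choiceType) (e : I -> M) : Prop :=
  (forall x, exists (s : {fset I}) (c : I -> A), x = \sum_(i <- s) c i *: e i) /\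
  (forall (s : {fset I}) (c : I -> A), \sum_(i <- s) c i *: e i = 0 ->
     forall i, i \in s -> c i = 0).

Definition is_free M : Prop := exists (I : choiceType) (e : I -> M), is_basis e.

End Modules.

(* The tensor product B (x)_A M along phi : A -> B, as formal finite sums of pure
   tensors (b, m) modulo the smallest congruence making (b, m) |-> b (x) m
   A-balanced *)
Section BaseChange.
Variables (A B : pzRingType) (phi : {rmorphism A -> B}) (M : lmodType A).
Implicit Types s t : seq (B * M).

Inductive tens_rel : seq (B * M) -> seq (B * M) -> Prop :=
| tens_refl s : tens_rel s s
| tens_sym s t : tens_rel s t -> tens_rel t s
| tens_trans s t u : tens_rel s t -> tens_rel t u -> tens_rel s u
| tens_cat s s' t t' : tens_rel s s' -> tens_rel t t' -> tens_rel (s ++ t) (s' ++ t')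
| tens_catC s t : tens_rel (s ++ t) (t ++ s)
| tens_zero m : tens_rel [:: (0, m)] [::]
| tens_addl b b' m : tens_rel [:: (b + b', m)] [:: (b, m); (b', m)]
| tens_addr b m m' : tens_rel [:: (b, m + m')] [:: (b, m); (b, m')]
| tens_balanced b a m : tens_rel [:: (b * phi a, m)] [:: (b, a *: m)].

Definition tens_relb s t : bool := `[< tens_rel s t >].

Lemma tens_relb_refl : reflexive tens_relb.
Proof. by move=> s; apply/asboolP/tens_refl. Qed.
Lemma tens_relb_sym : symmetric tens_relb.
Proof. by move=> s t; apply/asboolP/asboolP => /tens_sym. Qed.
Lemma tens_relb_trans : transitive tens_relb.
Proof. by move=> t s u /asboolP st /asboolP tu; apply/asboolP/(tens_trans st tu). Qed.

Definition tens_equiv : equiv_rel (seq (B * M)) :=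
  EquivRel tens_relb tens_relb_refl tens_relb_sym tens_relb_trans.

Definition base_change : Type := {eq_quot tens_equiv}%qT.

HB.instance Definition _ := Choice.on base_change.
HB.instance Definition _ := EqQuotient.on base_change.

Definition tens_class s : base_change := (\pi_base_change s)%qT.

Definition tens (b : B) (m : M) : base_change := tens_class [:: (b, m)].

Lemma tens_classP s t : tens_class s = tens_class t <-> tens_rel s t.
Proof. by split => [/eqmodP/asboolP|h]; last by apply/eqmodP/asboolP. Qed.

Lemma tens_class_ind (P : base_change -> Prop) :
  (forall s, P (tens_class s)) -> forall x, P x.
Proof. by move=> h x; rewrite -[x]reprK; apply: h. Qed.

Lemma tens_repr s : tens_rel (repr (tens_class s)) s.
Proof. by apply/tens_classP; rewrite /tens_class reprK. Qed.

Definition bc_add (x y : base_change) := tens_class (repr x ++ repr y).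
Definition bc_scale (c : B) (x : base_change) :=
  tens_class [seq (c * z.1, z.2) | z <- repr x].
Definition bc_opp (x : base_change) := bc_scale (-1) x.

Lemma tens_rel_scale c s t : tens_rel s t ->
  tens_rel [seq (c * z.1, z.2) | z <- s] [seq (c * z.1, z.2) | z <- t].
Proof.
elim=> {s t}.
- by move=> s; apply: tens_refl.
- by move=> s t _; apply: tens_sym.
- by move=> s t u _ h _; apply: tens_trans.
- by move=> s s' t t' _ h _ h'; rewrite !map_cat; apply: tens_cat.
- by move=> s t; rewrite !map_cat; apply: tens_catC.
- by move=> m; rewrite /= mulr0; apply: tens_zero.
- by move=> b b' m; rewrite /= mulrDr; apply: tens_addl.
- by move=> b m m'; apply: tens_addr.
- by move=> b a m; rewrite /= mulrA; apply: tens_balanced.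
Qed.

Lemma bc_addE s t : bc_add (tens_class s) (tens_class t) = tens_class (s ++ t).
Proof. by apply/tens_classP/tens_cat; apply: tens_repr. Qed.

Lemma bc_scaleE c s :
  bc_scale c (tens_class s) = tens_class [seq (c * z.1, z.2) | z <- s].
Proof. exact/tens_classP/tens_rel_scale/tens_repr. Qed.

Lemma bc_addA : associative bc_add.
Proof.
elim/tens_class_ind=> s; elim/tens_class_ind=> t; elim/tens_class_ind=> u.
by rewrite !bc_addE catA.
Qed.

Lemma bc_addC : commutative bc_add.
Proof.
elim/tens_class_ind=> s; elim/tens_class_ind=> t.
by rewrite !bc_addE; apply/tens_classP/tens_catC.
Qed.

Lemma bc_add0 : left_id (tens_class [::]) bc_add.
Proof. by elim/tens_class_ind=> s; rewrite bc_addE. Qed.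

Lemma bc_addN : left_inverse (tens_class [::]) bc_opp bc_add.
Proof.
elim/tens_class_ind=> s; rewrite /bc_opp bc_scaleE bc_addE; apply/tens_classP.
elim: s => [|[b m] s IHs] /=; first exact: tens_refl.
apply: tens_trans (tens_cat (tens_refl [:: (-1 * b, m)]) (tens_catC _ ((b, m) :: s))) _.
apply: (@tens_trans _ ([:: (-1 * b, m); (b, m)] ++ [::])); last first.
  rewrite cats0; apply: tens_trans (tens_sym (tens_addl _ _ _)) _.
  by rewrite mulN1r addNr; apply: tens_zero.
apply: (@tens_cat [:: (-1 * b, m); (b, m)] _ (s ++ _)); first exact: tens_refl.
exact: tens_trans (tens_catC _ _) IHs.
Qed.

HB.instance Definition _ := GRing.isZmodule.Build base_change
  bc_addA bc_addC bc_add0 bc_addN.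

Lemma tens_classD s t : tens_class (s ++ t) = tens_class s + tens_class t.
Proof. by rewrite -bc_addE. Qed.

Lemma bc_scaleA c d x : bc_scale c (bc_scale d x) = bc_scale (c * d) x.
Proof.
elim/tens_class_ind: x => s; rewrite !bc_scaleE -map_comp.
by congr tens_class; apply: eq_map => z /=; rewrite mulrA.
Qed.

Lemma bc_scale1 : left_id 1 bc_scale.
Proof.
elim/tens_class_ind=> s; rewrite bc_scaleE; congr tens_class.
by rewrite -[RHS]map_id; apply: eq_map => -[b m]; rewrite /= mul1r.
Qed.

Lemma bc_scaleDr : right_distributive bc_scale +%R.
Proof.
move=> c; elim/tens_class_ind=> s; elim/tens_class_ind=> t.
by rewrite -tens_classD !bc_scaleE map_cat tens_classD.
Qed.

Lemma bc_scaleDl x : {morph bc_scale^~ x : c d / c + d}.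
Proof.
move=> c d; elim/tens_class_ind: x => s; rewrite !bc_scaleE.
elim: s => [|[b m] s IHs] /=; first by rewrite -tens_classD.
rewrite -!(cat1s (_, _) [seq _ | _ <- _]) !tens_classD IHs addrACA; congr (_ + _).
by rewrite -tens_classD mulrDl; apply/tens_classP/tens_addl.
Qed.

HB.instance Definition _ := GRing.Zmodule_isLmodule.Build B base_change
  bc_scaleA bc_scale1 bc_scaleDr bc_scaleDl.

Lemma tensDl b b' m : tens (b + b') m = tens b m + tens b' m.
Proof. by rewrite -tens_classD; apply/tens_classP/tens_addl. Qed.

Lemma tensDr b m m' : tens b (m + m') = tens b m + tens b m'.
Proof. by rewrite -tens_classD; apply/tens_classP/tens_addr. Qed.

Lemma tens_bal b a m : tens (b * phi a) m = tens b (a *: m).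
Proof. exact/tens_classP/tens_balanced. Qed.

Lemma tensZ c b m : c *: tens b m = tens (c * b) m.
Proof. exact: bc_scaleE. Qed.

Lemma tens_span (x : base_change) :
  exists s : seq (B * M), x = \sum_(z <- s) tens z.1 z.2.
Proof.
elim/tens_class_ind: x => s; exists s; elim: s => [|[b m] s IHs].
  by rewrite big_nil.
by rewrite big_cons -IHs -cat1s tens_classD.
Qed.

(* Universal property *)
Lemma base_change_lift (N : lmodType B) (g : M -> N) :
  (forall m m', g (m + m') = g m + g m') ->
  (forall a m, g (a *: m) = phi a *: g m) ->
  exists h : {linear base_change -> N}, forall b m, h (tens b m) = b *: g m.
Proof.
move=> gD gZ; pose G s := \sum_(z <- s) z.1 *: g z.2.
have GP s t : tens_rel s t -> G s = G t.
  elim=> {s t} //.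
  - by move=> s t u _ -> _ ->.
  - by move=> s s' t t' _ h _ h'; rewrite /G !big_cat /= -!/(G _) h h'.
  - by move=> s t; rewrite /G !big_cat /= addrC.
  - by move=> m; rewrite /G big_seq1 big_nil scale0r.
  - by move=> b b' m; rewrite /G big_seq1 big_cons big_seq1 scalerDl.
  - by move=> b m m'; rewrite /G big_seq1 big_cons big_seq1 gD scalerDr.
  - by move=> b a m; rewrite /G !big_seq1 gZ scalerA.
pose h (x : base_change) := G (repr x).
have hE s : h (tens_class s) = G s by apply/GP/tens_repr.
have hl : linear h.
  move=> c; elim/tens_class_ind=> s; elim/tens_class_ind=> t.
  have -> : c *: tens_class s = bc_scale c (tens_class s) by [].
  rewrite bc_scaleE -tens_classD !hE /G big_cat big_map /=; congr (_ + _).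
  by rewrite scaler_sumr; apply: eq_bigr => z _; rewrite scalerA.
pose hL := GRing.isLinear.Build B base_change N *:%R h hl.
pose H : {linear base_change -> N} := HB.pack h hL.
by exists H => b m; rewrite [LHS]hE /G big_seq1.
Qed.

End BaseChange.

(* P_[a',b'] := K_{[a',b'],n} (x) P over K_{[a,b],n} *)
Definition module_restr (R : realType) (K : completeNonarchFieldType R) (n : nat)
    (a b a' b' : 'rV[R]_n) (a0 : ltv 0 a) (ab : lev a b)
    (a'0 : ltv 0 a') (a'b' : lev a' b') (aa' : lev a a') (b'b : lev b' b)
    (P : lmodType (laurent K a0 ab)) : lmodType (laurent K a'0 a'b') :=
  base_change (@laurent_restr R K n a b a' b' a0 ab a'0 a'b' aa' b'b) P.
Arguments module_restr {R K n a b a' b' a0 ab} a'0 a'b' aa' b'b P.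

(* Main.v *)
Require Import Defs.
From HB Require Import structures.
From mathcomp Require Import all_boot all_order all_algebra perm.
From mathcomp Require Import ring zify finmap.
From mathcomp Require Import boolp classical_sets reals.
Set Implicit Arguments.
Unset Strict Implicit.
Unset Printing Implicit Defensive.
Import Order.TTheory GRing.Theory Num.Theory.
Local Open Scope ring_scope.

(** A finite projective module over K_{[alpha,beta],n} is the image of an idempotent matrix e, and it is
free after base change as soon as e factors as X Y with Y X = 1. The proof finds such a
factorisation at the single radius rho, and then spreads it to a neighbourhood of rho.

The ring A = K_{[rho,rho],n} of series at a single radius has a multiplicative norm, the Gauss norm, and a
nonzero f in A has finitely many dominant terms. A monomial change of coordinates
t_j = s_j t^(N^j), t_0 = t with N large gives these terms distinct degrees in t, so that the dominant
terms of highest and lowest degree in t are single monomials, hence units of the coefficient ring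
R = K_{[sigma,sigma],n-1} in the variables s_j. Then Weierstrass preparation and division hold
([weierstrass_preparation], [weierstrass_division]): up to a unit, f is a monic polynomial F in t over
R, and A is the direct sum of F A and of the R-span of the powers of t below deg F. This allows an
induction on the number of variables ([gauss_proj_free]), whose step is the algebraic theorem
[division_proj_free]. Its proof has two parts.

First, a projective A-module P is stably free. After inverting some nonzero f it becomes free
([generic_splitting]), so P embeds in some A^r with a cokernel T killed by f, that is by F. Division by F
provides an R-linear retraction of this embedding, so T is a direct summand of the finite free
R-module (A / F)^r, and T = R^k by induction ([cokernel_free]). As an A-module, T is also the cokernel
of t - tau on A^k, where tau is the action of t on T. Schanuel's lemma for these two
resolutions gives P + A^k = A^r + A^k ([schanuel_stably_free]).

Second, stably free modules are free, because the kernel of every unimodular row over A is free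
([unimodular_kernel_splits]). Prepare one nonzero entry as a monic polynomial F and reduce the other entries
modulo F to polynomials in t over R. By a theorem of Suslin ([suslin_monic]) a unimodular row over R[t]
with a monic entry is equivalent to its value at t = 0, a row over R, to which the induction
hypothesis applies.

To leave the radius rho, approximate X and Y by matrices X0 and Y0 of Laurent polynomials. The
determinant of Y0 e X0 is close to 1 at rho, hence still a unit on a small box around rho, and there
e = (e X0) (Y0 e X0)^-1 (Y0 e), an identity that can be checked at rho ([splitting_spreads]). *)

(** * Rows up to invertible column operations *)
Section RowEquiv.
Variable R : comUnitRingType.

Definition row_equiv s (v w : 'rV[R]_s) : Prop :=
  exists2 G : 'M[R]_s, G \in unitmx & v *m G = w.

Lemma row_equiv_refl s (v : 'rV[R]_s) : row_equiv v v.
Proof. by exists 1%:M; rewrite ?unitmx1 ?mulmx1. Qed.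

Lemma row_equiv_sym s (v w : 'rV[R]_s) : row_equiv v w -> row_equiv w v.
Proof.
by case=> G Gu <-; exists (invmx G); rewrite ?unitmx_inv // mulmxK.
Qed.

Lemma row_equiv_trans s (u v w : 'rV[R]_s) :
  row_equiv u v -> row_equiv v w -> row_equiv u w.
Proof.
by case=> G Gu <- [H Hu <-]; exists (G *m H); rewrite ?unitmx_mul ?Gu ?mulmxA.
Qed.

Lemma unitmx_left s (G H : 'M[R]_s) : G *m H = 1%:M -> G \in unitmx.
Proof. by move=> GH; case: (mulmx1_unit GH). Qed.

(** The matrix 1 + u c is invertible with inverse 1 - u c because c u = 0. All
elementary column operations used below, including those that add a combination of several
entries to several others at once, are of this form. *)
Lemma row_equiv_transvection s (v : 'rV[R]_s) (u : 'cV[R]_s) (c : 'rV[R]_s) :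
  c *m u = 0 -> row_equiv v (v + (v *m u) *m c).
Proof.
move=> cu; exists (1%:M + u *m c); last by rewrite mulmxDr mulmx1 mulmxA.
apply: (@unitmx_left _ _ (1%:M - u *m c)).
rewrite mulmxDl mul1mx mulmxBr mulmx1 mulmxA -(mulmxA u c u) cu mulmx0 mul0mx.
by rewrite subr0 subrK.
Qed.

Lemma row_equiv_block s1 s2 (B : 'M[R]_s1) (v : 'rV[R]_s1) (w : 'rV[R]_s2) :
  B \in unitmx -> row_equiv (row_mx v w) (row_mx (v *m B) w).
Proof.
move=> Bu; exists (block_mx B 0 0 1%:M).
  by rewrite unitmxE det_ublock det1 mulr1 -unitmxE.
by rewrite mul_row_block !mulmx0 addr0 add0r mulmx1.
Qed.

Lemma row_equiv_unimodular s (v w : 'rV[R]_s) (b : 'cV[R]_s) :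
  row_equiv v w -> v *m b = 1%:M -> exists b' : 'cV[R]_s, w *m b' = 1%:M.
Proof.
by case=> G Gu <- vb; exists (invmx G *m b); rewrite mulmxA mulmxK.
Qed.

End RowEquiv.

(** * Suslin's theorem on unimodular rows over a polynomial ring *)
Lemma sum2E (V : nmodType) (F : 'I_2 -> V) : \sum_i F i = F 0 + F 1.
Proof. by rewrite !big_ord_recl big_ord0 addr0; congr (_ + F _); apply: val_inj. Qed.

Lemma det_mx2 (R : comNzRingType) (M : 'M[R]_2) :
  \det M = M 0 0 * M 1 1 - M 0 1 * M 1 0.
Proof.
rewrite (expand_det_row M 0) sum2E /cofactor !det_mx11 !mxE /= expr0 expr1 mul1r.
rewrite mulN1r mulrN; congr (_ * M _ _ - _ * M _ _); exact: val_inj.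
Qed.

Section CompPoly.
Variable R : idomainType.
Implicit Types p q a b : {poly R}.

Local Notation compm a M := (map_mx (fun p => p \Po a) M).

(** Taylor expansion to first order. *)
Lemma comp_poly_congr p a b (c : R) :
  exists n, p \Po (a + c *: b) = p \Po a + c *: n.
Proof.
elim/poly_ind: p => [|p d [n IH]].
  by exists 0; rewrite !comp_poly0 scaler0 addr0.
exists (n * (a + c *: b) + (p \Po a) * b).
rewrite !comp_polyD !comp_polyM !comp_polyX !comp_polyC IH.
by rewrite -!mul_polyC; ring.
Qed.

Lemma compm_congr m n (M : 'M[{poly R}]_(m, n)) a b (c : R) :
  exists N, compm (a + c *: b) M = compm a M + c%:P *: N.
Proof.
have /choice[N NP] (ij : 'I_m * 'I_n) : exists x, 
   M ij.1 ij.2 \Po (a + c *: b) = M ij.1 ij.2 \Po a + c *: x.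
  exact: comp_poly_congr.
exists (\matrix_(i, j) N (i, j)); apply/matrixP => i j; rewrite !mxE.
by rewrite (NP (i, j)) mul_polyC.
Qed.

Lemma compmM a m n k (M : 'M[{poly R}]_(m, n)) (N : 'M[{poly R}]_(n, k)) :
  compm a (M *m N) = compm a M *m compm a N.
Proof. exact: (map_mxM (comp_poly a)). Qed.

Lemma compm_unit a n (M : 'M[{poly R}]_n) : M \in unitmx -> compm a M \in unitmx.
Proof.
by rewrite !unitmxE => ?; rewrite (det_map_mx (comp_poly a)) rmorph_unit.
Qed.

(** If M is the matrix with columns u and (- v_1, v_0), then det M = c and v M = (c, 0), which
does not depend on the variable. Hence v(a) M(a) = v(a') M(a') and
M(a) adj(M(a')) / c carries v(a) to v(a'); this matrix has polynomial entries because M(a) and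
M(a') agree modulo c. *)
Lemma sl2_congr (v : 'rV[{poly R}]_2) (u : 'cV[{poly R}]_2) (c : R) a b :
  v *m u = c%:P%:M -> c != 0 ->
  exists2 B : 'M[{poly R}]_2, B \in unitmx & compm a v *m B = compm (a + c *: b) v.
Proof.
move=> vu c0; have c0' : c%:P != 0 :> {poly R} by rewrite polyC_eq0.
pose M : 'M[{poly R}]_2 := \matrix_(i, j)
  if j == 0 then u i 0 else if i == 0 then - v 0 1 else v 0 0.
have vuE : v 0 0 * u 0 0 + v 0 1 * u 1 0 = c%:P.
  move/matrixP: vu => /(_ 0 0); rewrite !mxE sum2E /= => ->.
  by rewrite mulr1n.
have vM : v *m M = \row_j (if j == 0 then c%:P else 0).
  apply/rowP => j; rewrite !mxE sum2E !mxE /=; case: ifP => _ //.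
  by rewrite mulrN mulrC addNr.
have detM : \det M = c%:P by rewrite det_mx2 !mxE /= -vuE; ring.
have cst a' : compm a' v *m compm a' M = v *m M.
  rewrite -compmM vM; apply/rowP => j; rewrite !mxE.
  by case: ifP => _; rewrite ?comp_polyC // comp_poly0.
have det_c a' : \det (compm a' M) = c%:P.
  by rewrite (det_map_mx (comp_poly a')) detM /= comp_polyC.
pose a' := a + c *: b; have [N NP] := compm_congr M a b c.
(* B is M(a) adj(M(a')) / c, written without the division *)
pose B := 1%:M - N *m \adj (compm a' M).
have cB : compm a M *m \adj (compm a' M) = c%:P *: B.
  have -> : compm a M = compm a' M - c%:P *: N by rewrite NP addrK.
  rewrite mulmxBl mul_mx_adj det_c -scalemxAl scalerBr; congr (_ - _).
  by rewrite scalemx1.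
exists B.
  have : \det (c%:P *: B) = c%:P ^+ 2.
    rewrite -cB det_mulmx det_c expr2; congr (_ * _).
    have := congr1 determinant (mul_mx_adj (compm a' M)).
    rewrite det_mulmx det_c det_scalar expr2; exact: mulfI.
  rewrite detZ -[RHS]mulr1 => /(mulfI (expf_neq0 2 c0')) detB.
  by rewrite unitmxE detB unitr1.
apply/rowP => j; apply: (mulfI c0').
have : c%:P *: (compm a v *m B) = c%:P *: compm a' v.
  by rewrite scalemxAr -cB mulmxA cst -(cst a') -mulmxA mul_mx_adj det_c mul_mx_scalar.
by move/rowP=> /(_ j); rewrite !mxE.
Qed.

(** When c lies in the ideal of the first two entries, those two entries are moved by
[sl2_congr]; the remaining ones change by multiples of c only, and such changes are
transvections since c is a combination of the first two entries. *)
Lemma row_equiv_congr s (v : 'rV[{poly R}]_2) (w : 'rV[{poly R}]_s)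
    (u : 'cV[{poly R}]_2) (c : R) a b :
  v *m u = c%:P%:M ->
  row_equiv (compm a (row_mx v w)) (compm (a + c *: b) (row_mx v w)).
Proof.
move=> vu; have [->|c0] := eqVneq c 0.
  by rewrite scale0r addr0; apply: row_equiv_refl.
have [B Bu vB] := sl2_congr a b vu c0; rewrite !map_row_mx -vB.
apply: row_equiv_trans (row_equiv_block _ _ Bu) _; rewrite vB.
have [N ->] := compm_congr w a b c.
set v' := map_mx _ v; set w' := map_mx _ w.
have -> : row_mx v' (w' + c%:P *: N) = row_mx v' w' +
   (row_mx v' w' *m col_mx (compm (a + c *: b) u) 0) *m row_mx 0 N.
  rewrite mul_row_col mulmx0 addr0 -compmM vu.
  have -> : compm (a + c *: b) (c%:P%:M : 'M_1) = c%:P%:M.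
    by apply/matrixP => i j; rewrite !mxE !ord1 eqxx !mulr1n comp_polyC.
  by rewrite mul_scalar_mx scale_row_mx scaler0 add_row_mx addr0.
by apply: row_equiv_transvection; rewrite mul_row_col mul0mx mulmx0 addr0.
Qed.
End CompPoly.

(** Local arguments over R are made modulo a maximal ideal, so the residue field at a maximal
ideal containing a given proper ideal is needed. *)
Section MaximalQuotient.
Variables (R : comNzRingType) (m : R -> bool).
Hypothesis m_ideal : idealr_closed m.
Hypothesis m_max : forall x, ~~ m x -> exists y, m (y * x - 1).

Let I : idealr R := HB.pack m (isIdealr.Build R m m_ideal).

Let pi : {rmorphism R -> {ideal_quot I}} := (\pi_({ideal_quot I}))%qT.

Lemma maximal_quotient_inv (z : {ideal_quot I}) :
  exists y : {ideal_quot I}, z != 0 -> y * z = 1.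
Proof.
elim/quotP: z => x _; have [mx|/m_max[y my]] := boolP (m x).
  exists 0 => /negP[]; apply/eqP; rewrite -(rmorph0 pi).
  by apply/eqP; rewrite -Quotient.idealrBE subr0.
exists (pi y) => _; rewrite -(rmorphM pi) -(rmorph1 pi).
by apply/eqP; rewrite -Quotient.idealrBE.
Qed.

Lemma maximal_ideal_residue_field :
  exists (k : fieldType) (phi : {rmorphism R -> k}),
    (forall y, exists x, phi x = y) /\ forall x, (phi x == 0) = m x.
Proof.
have /choice[inv invP] := maximal_quotient_inv.
pose inv' z := if z == 0 then 0 else inv z.
have h1 z : z != 0 -> inv' z * z = 1.
  by move=> z0; rewrite /inv' (negPf z0) invP.
have h0 : inv' 0 = 0 by rewrite /inv' eqxx.
pose F := GRing.ComNzRing_isField.Build {ideal_quot I} h1 h0.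
pose k : fieldType := HB.pack {ideal_quot I} F.
exists k, pi; split.
  by move=> y; exists (repr y); rewrite /pi /= reprK.
by move=> x; rewrite -(rmorph0 pi) -Quotient.idealrBE subr0.
Qed.
End MaximalQuotient.

Record is_ideal (R : comNzRingType) (J : R -> Prop) : Prop := IsIdeal {
  ideal0 : J 0;
  idealD : forall x y, J x -> J y -> J (x + y);
  idealM : forall a x, J x -> J (a * x) }.

Lemma exists_maximal_ideal (R : comNzRingType) (J : R -> Prop) :
  is_ideal J -> ~ J 1 ->
  exists M : R -> Prop, [/\ is_ideal M, ~ M 1, forall x, J x -> M x &
    forall x, ~ M x -> exists y, M (y * x - 1)].
Proof.
move=> Jid J1; pose P (I : set R) := is_ideal (J `|` I)%classic /\ ~ (J `|` I)%classic 1.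
have [F FP Ftot|I [[Iid I1] Imax]] := @Zorn_bigcup R P.
  split; last by case=> // -[X FX X1]; case: (FP _ FX) => _; apply; right.
  split; first by left; apply: ideal0.
  - have key X x y : F X -> (J `|` X)%classic x -> (J `|` X)%classic y ->
        (J `|` \bigcup_(X in F) X)%classic (x + y).
      move=> FX hx hy; have [Xid _] := FP _ FX.
      by case: (idealD Xid hx hy); [left|right; exists X].
    move=> x y [Jx|[X FX Xx]] [Jy|[Y FY Yy]].
    + by left; apply: idealD.
    + by apply: (key Y) => //; [left|right].
    + by apply: (key X) => //; [right|left].
    + have [XY|YX] := Ftot _ _ FX FY.
        by apply: (key Y) => //; right => //; apply: XY.
      by apply: (key X) => //; right => //; apply: YX.
  - move=> a x [Jx|[X FX Xx]]; first by left; apply: idealM.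
    have [Xid _] := FP _ FX; have := idealM Xid a (or_intror Xx).
    by case; [left|right; exists X].
exists (J `|` I)%classic; split=> //; first by move=> x; left.
move=> x Mx; set M := (J `|` I)%classic in Iid I1 Mx *.
pose B : set R := fun z => exists y a, M a /\ z = a + y * x.
have MB z : M z -> B z by move=> Mz; exists 0, z; rewrite mul0r addr0.
have Bid : is_ideal B.
  split; first by apply: MB; apply: ideal0.
  - move=> _ _ [y [a [Ma ->]]] [y' [a' [Ma' ->]]]; exists (y + y'), (a + a').
    by split; [apply: idealD|ring].
  - move=> c _ [y [a [Ma ->]]]; exists (c * y), (c * a).
    by split; [apply: idealM|ring].
have JB : (J `|` B)%classic = B.
  by apply/seteqP; split=> [z [Jz|]|z] //; [apply: MB; left|right].
have [[y [a [Ma Ey]]]|B1] := pselect (B 1).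
  exists y; have := idealM Iid (-1) Ma; congr M.
  by rewrite {2}Ey; ring.
case: (Imax B); last by split; rewrite JB.
split=> [z Iz|BI]; first by apply: MB; right.
apply: Mx; right; apply: BI; exists 1, 0; split; first exact: ideal0.
by rewrite add0r mul1r.
Qed.

Lemma proper_ideal_residue_field (R : comNzRingType) (J : R -> Prop) :
  is_ideal J -> ~ J 1 -> exists (k : fieldType) (phi : {rmorphism R -> k}),
    (forall y, exists x, phi x = y) /\ forall x, J x -> phi x = 0.
Proof.
move=> Jid J1; have [M [Mid M1 JM Mmax]] := exists_maximal_ideal Jid J1.
have [||k [phi [phi_surj phiM]]] := @maximal_ideal_residue_field R (fun x => `[< M x >]).
- split=> [||a u v]; rewrite ?unfold_in; do ?[by apply/asboolP; apply: ideal0]; first exact/asboolP.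
  by move=> /asboolP Mu /asboolP Mv; apply/asboolP; apply: idealD => //; apply: idealM.
- by move=> x /asboolP/Mmax[y My]; exists y; apply/asboolP.
by exists k, phi; split=> // x /JM Mx; apply/eqP; rewrite phiM; apply/asboolP.
Qed.

(** A finite k-algebra k[x]/(f) has stable rank one. The witness is the largest factor of f coprime
to g: a factor of f dividing g + h s is coprime to g by the Bezout relation, so it
divides h, and therefore g. *)
Lemma coprimep_shift (k : fieldType) (f g s u1 u2 : {poly k}) :
  f != 0 -> u1 * f + u2 * g + s = 1 -> exists h, coprimep f (g + h * s).
Proof.
move=> f0 bez; exists (gdcop g f); set h := gdcop g f.
have hg : coprimep h g by apply: coprimep_gdco.
apply/coprimepP => d df dgs.
have dg : coprimep d g.
  apply/coprimepP => e ed eg.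
  have ehs : e %| h * s by rewrite -(dvdp_addr _ eg) (dvdp_trans ed).
  have eh : coprimep e h by rewrite coprimep_sym (coprimep_dvdl eg).
  have es : e %| s by rewrite Gauss_dvdpr in ehs.
  rewrite -size_poly_eq1 -dvdp1 -bez; apply: dvdp_add => //.
  by apply: dvdp_add; apply: dvdp_mull => //; apply: dvdp_trans ed df.
have dh : d %| h by rewrite /h; case: gdcopP => r _ _; apply.
have {}dgs : d %| g by move: dgs; rewrite dvdp_addl // dvdp_mulr.
by move/coprimepP: dg => /(_ d (dvdpp d) dgs).
Qed.

(** If f is monic and the ideal (f, g) is the unit ideal modulo the kernel of phi, then
(f, g) contains a constant that phi does not kill. This is Nakayama's lemma for the finite
R-module R[x]/(f, g): the constant is the determinant of 1 - M, where M, with entries in the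
kernel of phi, expresses multiplication of the basis 1, x, .., x^(d-1) by mu. *)
Lemma det_bezout_congr (R : idomainType) (k : fieldType) (phi : {rmorphism R -> k})
    (f g a b : {poly R}) :
  f \is monic -> map_poly phi (a * f + b * g) = 1 ->
  exists c a' b', phi c != 0 /\ a' * f + b' * g = c%:P.
Proof.
move=> fmon ab1; pose mu := 1 - (a * f + b * g).
have mu0 : map_poly phi mu = 0 by rewrite rmorphB /= ab1 rmorph1 subrr.
pose d := (size f).-1.
have sf : size f = d.+1 by rewrite prednK // lt0n size_poly_eq0 monic_neq0.
pose rem i := Pdiv.Ring.rmodp ('X^i * mu) f.
pose quo i := Pdiv.Ring.rdivp ('X^i * mu) f.
have remE i : 'X^i * mu = quo i * f + rem i by apply: Pdiv.RingMonic.rdivp_eq.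
have srem i : (size (rem i) <= d)%N.
  by rewrite -ltnS -sf Pdiv.Ring.ltn_rmodpN0 // monic_neq0.
have rem0 i : map_poly phi (rem i) = 0.
  have fp : size (map_poly phi f) = d.+1.
    by rewrite size_map_poly_id0 // (monicP fmon) rmorph1 oner_eq0.
  have : map_poly phi f %| map_poly phi (rem i).
    have := congr1 (map_poly phi) (remE i).
    rewrite rmorphM /= mu0 mulr0 rmorphD rmorphM /= => /esym/eqP.
    by rewrite addrC addr_eq0 => /eqP ->; rewrite dvdpNr dvdp_mulIr.
  move/modp_eq0P; rewrite modp_small // fp ltnS.
  exact: leq_trans (size_poly _ _) (srem i).
pose M : 'M[R]_d := \matrix_(i, j) (rem i)`_j.
pose x : 'cV[{poly R}]_d := \col_i 'X^i.
pose u : 'cV[{poly R}]_d := \col_i ('X^i * a + quo i).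
pose v : 'cV[{poly R}]_d := \col_i ('X^i * b).
have key : map_mx polyC (1%:M - M) *m x = f *: u + g *: v.
  rewrite map_mxB map_mx1 mulmxBl mul1mx.
  apply/matrixP => i j; rewrite !mxE.
  have -> : \sum_l map_mx polyC M i l * x l j = rem i.
    rewrite -[RHS]coefK poly_def (big_ord_widen d (fun l => (rem i)`_l *: 'X^l)) //.
    rewrite [RHS]big_mkcond; apply: eq_bigr => l _; rewrite !mxE mul_polyC; case: ltnP => // le.
    by rewrite nth_default // scale0r.
  have := remE i; rewrite /mu mulrBr mulr1 => /eqP.
  rewrite subr_eq => /eqP {1}->; ring.
have phidet : phi (\det (1%:M - M)) = 1.
  rewrite -det_map_mx map_mxB map_mx1 (_ : map_mx phi M = 0) ?subr0 ?det1 //.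
  by apply/matrixP => i j; rewrite !mxE -coef_map rem0 coef0.
have [d0|d0] := posnP d.
  exists 1, 1, 0; rewrite rmorph1 oner_neq0 mul0r addr0 mul1r; split=> //.
  by rewrite (size1_polyC (p := f)) ?sf ?d0 //; have := monicP fmon; rewrite /lead_coef sf d0 => ->.
exists (\det (1%:M - M)).
set A := 1%:M - M in key phidet *.
pose i0 := Ordinal d0; pose Aa := map_mx polyC (\adj A).
exists ((Aa *m u) i0 0), ((Aa *m v) i0 0); rewrite phidet oner_neq0; split=> //.
have : Aa *m (map_mx polyC A *m x) = (\det A)%:P *: x.
  by rewrite mulmxA -map_mxM mul_adj_mx map_scalar_mx mul_scalar_mx.
rewrite key mulmxDr -!scalemxAr => /matrixP/(_ i0 0); rewrite !mxE /= expr0 mulr1 => <-.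
by rewrite mulrC [X in _ + X]mulrC.
Qed.

Section Suslin.
Variable R : idomainType.
Local Notation compm a M := (map_mx (fun p => p \Po a) M).

(** The ideal of all c such that specialisations of v which agree modulo c are
equivalent. If it contains 1, then all specialisations of v are equivalent. *)
Definition congr_ideal s (v : 'rV[{poly R}]_s) (c : R) : Prop :=
  forall a b, row_equiv (compm a v) (compm (a + c *: b) v).

Lemma congr_ideal_is_ideal s (v : 'rV[{poly R}]_s) : is_ideal (congr_ideal v).
Proof.
split=> [a b|x y hx hy a b|c x hx a b].
- by rewrite scale0r addr0; apply: row_equiv_refl.
- by rewrite scalerDl addrA; apply: row_equiv_trans (hx _ _) (hy _ _).
- by rewrite mulrC -scalerA; apply: hx.
Qed.

Lemma congr_ideal_equiv s (v w : 'rV[{poly R}]_s) c :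
  row_equiv v w -> congr_ideal w c -> congr_ideal v c.
Proof.
move=> [G Gu vG] hw a b.
have E a' : row_equiv (compm a' v) (compm a' w).
  by exists (compm a' G); [apply: compm_unit|rewrite -compmM vG].
exact: row_equiv_trans (E _) (row_equiv_trans (hw a b) (row_equiv_sym (E _))).
Qed.

(** If the ideal [congr_ideal v] is proper, choose a residue field k at a maximal ideal containing
it. Over k the stable range property makes the first entry, which stays monic, coprime to the
second one after an elementary operation that lifts to R[x]. By [det_bezout_congr] the ideal of
these two entries then contains a constant c outside the maximal ideal, whereas
[row_equiv_congr] puts c in [congr_ideal v]. *)
Lemma suslin_monic s (v : 'rV[{poly R}]_(1 + (1 + s))) (w : 'cV[{poly R}]_(1 + (1 + s))) :
  v 0 0 \is monic -> v *m w = 1%:M ->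
  row_equiv v (map_mx (fun p => (p.[0])%:P) v).
Proof.
move=> vmon vw.
suff J1 : congr_ideal v 1.
  have := J1 0 'X; rewrite scale1r add0r.
  have -> : compm 'X v = v by apply/matrixP => i j; rewrite mxE comp_polyXr.
  have -> : compm 0 v = map_mx (fun p => (p.[0])%:P) v.
    by apply/matrixP => i j; rewrite !mxE -polyC0 comp_polyCr.
  exact: row_equiv_sym.
apply: contrapT => J1.
have [k [phi [phi_surj phiJ]]] := proper_ideal_residue_field (congr_ideal_is_ideal v) J1.
set f := v 0 0 in vmon.
pose g := (lsubmx (rsubmx v)) 0 0; pose v' := rsubmx (rsubmx v).
pose w' := dsubmx (dsubmx w); pose sigma := (v' *m w') 0 0.
have vE : v = row_mx f%:M (row_mx g%:M v').
  rewrite -[v]hsubmxK -[rsubmx v]hsubmxK; congr (row_mx _ (row_mx _ _)).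
    by rewrite [LHS]mx11_scalar mxE /f; congr (v _ _)%:M; apply: val_inj.
  by rewrite [LHS]mx11_scalar.
pose w1 := usubmx w 0 0; pose w2 := usubmx (dsubmx w) 0 0.
have wE : w = col_mx w1%:M (col_mx w2%:M w').
  rewrite -[w]vsubmxK -[dsubmx w]vsubmxK; congr (col_mx _ (col_mx _ _)).
    by rewrite [LHS]mx11_scalar.
  by rewrite [LHS]mx11_scalar.
have bez : w1 * f + w2 * g + sigma = 1.
  move: vw; rewrite {1}vE {1}wE !mul_row_col => /matrixP/(_ 0 0).
  rewrite !mul_scalar_mx !scale_scalar_mx mulrC (mulrC g) mxE [X in _ + X]mxE -/sigma.
  by rewrite !mxE eqxx !mulr1n addrA.
have fbar0 : map_poly phi f != 0.
  by rewrite monic_neq0 // monic_map.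
have [|h] := @coprimep_shift k (map_poly phi f) (map_poly phi g) (map_poly phi sigma)
  (map_poly phi w1) (map_poly phi w2) fbar0.
  by rewrite -!rmorphM -!rmorphD bez rmorph1.
have poly_surj (p : {poly k}) : exists q : {poly R}, map_poly phi q = p.
  have /choice[sec secP] := phi_surj.
  exists (\poly_(i < size p) sec p`_i); apply/polyP => i.
  rewrite coef_map coef_poly; case: ltnP => ip; first exact: secP.
  by rewrite [RHS]nth_default //; apply: rmorph0.
have [H <-] := poly_surj h; rewrite -rmorphM -rmorphD /=.
move=> /Bezout_eq1_coprimepP[[a0 b0] /= ab].
have [a Ea] := poly_surj a0; have [b Eb] := poly_surj b0.
move: ab; rewrite -Ea -Eb -!rmorphM -rmorphD => ab.
have [c [a' [b' [phic abc]]]] := det_bezout_congr vmon ab.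
case/negP: phic; apply/eqP/phiJ.
pose v1 := row_mx f%:M (row_mx (g + H * sigma)%:M v').
apply: (@congr_ideal_equiv _ _ v1).
  pose u : 'cV[{poly R}]_(1 + (1 + s)) := col_mx 0 (col_mx 0 w').
  pose cc : 'rV[{poly R}]_(1 + (1 + s)) := row_mx 0 (row_mx H%:M 0).
  have -> : v1 = v + (v *m u) *m cc.
    rewrite /u /cc {2}vE !mul_row_col !mulmx0 !add0r vE [v' *m w']mx11_scalar -/sigma.
    rewrite mul_scalar_mx !scale_row_mx !scaler0 !add_row_mx !addr0 /v1.
    by rewrite scale_scalar_mx raddfD /= [H * _]mulrC.
  apply: row_equiv_transvection.
  by rewrite /cc /u !mul_row_col !(mulmx0, mul0mx) !addr0.
pose v12 : 'rV[{poly R}]_(1 + 1) := row_mx f%:M (g + H * sigma)%:M.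
have -> : v1 = row_mx v12 v'.
  by rewrite /v1 row_mxA castmx_id.
pose u12 : 'cV[{poly R}]_(1 + 1) := col_mx a'%:M b'%:M.
move=> x y; apply: (@row_equiv_congr _ s v12 v' u12 c x y).
rewrite [LHS](@mul_row_col _ 1 1 1 1) -!scalar_mxM -raddfD /= -abc.
by congr (_%:M); rewrite mulrC [X in _ + X]mulrC.
Qed.
End Suslin.

(** * Idempotent matrices with free image *)
Section Splitting.
Variable R : comNzRingType.

(** Murray - von Neumann equivalence: for idempotent e and e', this is an isomorphism between the
projective modules that they define as images. *)
Definition mvn m n (e : 'M[R]_m) (e' : 'M[R]_n) : Prop :=
  exists (X : 'M[R]_(m, n)) (Y : 'M[R]_(n, m)), X *m Y = e /\ Y *m X = e'.

Definition splits m (e : 'M[R]_m) : Prop := exists r, mvn e (1%:M : 'M[R]_r).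

(** In terms of idempotents: finitely generated projective modules are free. *)
Definition proj_free : Prop :=
  forall m (e : 'M[R]_m), e *m e = e -> splits e.

Lemma splits_mvn m n (e : 'M[R]_m) (e' : 'M[R]_n) :
  e *m e = e -> mvn e e' -> splits e' -> splits e.
Proof.
move=> ee [X [Y [XY YX]]] [r [X' [Y' [XY' YX']]]].
exists r, (X *m X'), (Y' *m Y); split.
  by rewrite mulmxA -(mulmxA X) XY' -YX mulmxA -mulmxA XY ee.
by rewrite mulmxA -(mulmxA Y') YX -XY' mulmxA -mulmxA YX' mulmx1.
Qed.

Lemma idem_compl m n (f : 'M[R]_(m, n)) (b : 'M[R]_(n, m)) : f *m b = 1%:M ->
  (1%:M - b *m f) *m (1%:M - b *m f) = 1%:M - b *m f.
Proof.
move=> fb; rewrite mulmxBr mulmx1 mulmxBl mul1mx mulmxA -(mulmxA b f b) fb mulmx1.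
by rewrite subrr subr0.
Qed.

(** The kernel of a split surjection f does not depend, up to isomorphism, on the section. *)
Lemma mvn_compl m n (f : 'M[R]_(m, n)) (b b' : 'M[R]_(n, m)) :
  f *m b = 1%:M -> f *m b' = 1%:M -> mvn (1%:M - b *m f) (1%:M - b' *m f).
Proof.
have key c c' : f *m c' = 1%:M -> (1%:M - c *m f) *m (1%:M - c' *m f) = 1%:M - c' *m f.
  move=> fc; rewrite mulmxBr mulmx1 mulmxBl mul1mx mulmxA -(mulmxA c f c') fc mulmx1.
  by rewrite opprB addrA subrK.
by move=> fb fb'; exists (1%:M - b' *m f), (1%:M - b *m f); split; apply: key.
Qed.

End Splitting.

Section Fraction.
Variable A : idomainType.
Local Notation frac M := (map_mx (@tofrac A) M).

Local Notation "x %:F" := (@tofrac A x).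

Lemma frac_repr (x : {fraction A}) : exists nd : A * A, nd.2 != 0 /\ x = nd.1%:F / nd.2%:F.
Proof.
elim/quotW: x => r; exists (\n_r, \d_r); split; first exact: denom_ratioP.
have d0 : (\d_r)%:F != 0 by rewrite tofrac_eq0 denom_ratioP.
apply: (mulIf d0); rewrite divfK //; unlock tofrac; rewrite -[LHS]FracField.pi_mul.
apply/eqmodP; rewrite /= FracField.equivfE /FracField.mulf !numden_Ratio ?oner_eq0 ?mulr1 ?denom_ratioP //.
by rewrite mulrC.
Qed.

Lemma frac_inj m n (M N : 'M[A]_(m, n)) : frac M = frac N -> M = N.
Proof.
move=> MN; apply/matrixP => i j; apply/eqP; rewrite -tofrac_eq; apply/eqP.
by move/matrixP: MN => /(_ i j); rewrite !mxE.
Qed.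

Lemma clear_denom (I : finType) (x : I -> {fraction A}) :
  exists2 c, c != 0 & exists y : I -> A, forall i, c%:F * x i = (y i)%:F.
Proof.
have /choice[nd ndP] i : exists nd : A * A, nd.2 != 0 /\ x i = nd.1%:F / nd.2%:F.
  exact: frac_repr.
exists (\prod_i (nd i).2).
  by apply/prodf_neq0 => i _; case: (ndP i).
exists (fun i => (nd i).1 * \prod_(j | j != i) (nd j).2) => i.
have [d0 ->] := ndP i; rewrite (bigD1 i) //= !rmorphM /=.
have d0' : (nd i).2%:F != 0 by rewrite tofrac_eq0.
by field.
Qed.

Lemma clear_denom_mx m n (M : 'M[{fraction A}]_(m, n)) :
  exists2 c, c != 0 & exists N, frac N = c%:F *: M.
Proof.
have [c c0 [y yP]] := clear_denom (fun ij : 'I_m * 'I_n => M ij.1 ij.2).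
exists c => //; exists (\matrix_(i, j) y (i, j)); apply/matrixP => i j.
by rewrite !mxE -yP.
Qed.

(** A projective module over a domain becomes free after inverting one element f: factor the
idempotent over the fraction field through a column and a row basis, and clear denominators. *)
Lemma generic_splitting m (e : 'M[A]_m) : e *m e = e ->
  exists (r : nat) (X : 'M[A]_(r, m)) (Y : 'M[A]_(m, r)) (f : A),
   [/\ f != 0, X *m e = X, e *m Y = Y, Y *m X = f *: e & X *m Y = f%:M].
Proof.
move=> ee; pose E := frac e.
have EE : E *m E = E by rewrite -map_mxM ee.
pose Y0 := col_base E; pose X0 := row_base E.
have YX0 : Y0 *m X0 = E by rewrite mulmx_base.
have XY0 : X0 *m Y0 = 1%:M.
  have injX (p : nat) (M N : 'M_(p, _)) : M *m X0 = N *m X0 -> M = N.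
    exact: (row_free_inj (row_base_free E)).
  have injY (p : nat) (M N : 'M_(_, p)) : Y0 *m M = Y0 *m N -> M = N.
    have Yfree : row_free Y0^T by rewrite /row_free mxrank_tr -/(row_full _) col_base_full.
    move=> YMN; apply: trmx_inj; apply: (row_free_inj Yfree).
    by rewrite -!trmx_mul YMN.
  apply: injY; apply: injX.
  by rewrite mulmx1 (mulmxA Y0) YX0 -(mulmxA E) YX0 EE.
have X0E : X0 *m (Y0 *m X0) = X0 by rewrite mulmxA XY0 mul1mx.
have Y0E : (Y0 *m X0) *m Y0 = Y0 by rewrite -mulmxA XY0 mulmx1.
rewrite YX0 in X0E Y0E.
have [c c0 [X XE]] := clear_denom_mx X0; have [d d0 [Y YE]] := clear_denom_mx Y0.
exists (\rank E), X, Y, (c * d); split.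
- by rewrite mulf_neq0.
- apply: frac_inj; rewrite map_mxM XE -scalemxAl; congr (_ *: _).
  exact: X0E.
- apply: frac_inj; rewrite map_mxM YE -scalemxAr; congr (_ *: _).
  exact: Y0E.
- apply: frac_inj; rewrite map_mxM YE XE map_mxZ /= -scalemxAl -scalemxAr YX0 scalerA.
  by rewrite rmorphM mulrC.
- apply: frac_inj; rewrite map_mxM YE XE -scalemxAl -scalemxAr XY0 scalerA -rmorphM /=.
  by rewrite scalemx1 map_scalar_mx.
Qed.

Lemma idem_full_rank n (N : 'M[A]_n) : N *m N = N -> \rank (frac N) = n -> N = 1%:M.
Proof.
move=> NN rN; apply: frac_inj; rewrite map_mx1.
have Nu : frac N \in unitmx by rewrite -row_free_unit /row_free rN.
by rewrite -[LHS](mulKmx Nu) -map_mxM NN mulVmx.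
Qed.

(** F and B are mutually inverse isomorphisms up to the idempotent B F; both sides have the
same rank over the fraction field, so B F has full rank and must be the identity. The rank
of e is at least r because X Y is an invertible scalar there. *)
Lemma square_inverse m (e : 'M[A]_m) r k (X : 'M[A]_(r, m)) (Y : 'M[A]_(m, r)) f
    (F : 'M[A]_(m + k, r + k)) (B : 'M[A]_(r + k, m + k)) :
  e *m e = e ->
  f != 0 -> X *m e = X -> X *m Y = f%:M ->
  F *m B = block_mx e 0 0 1%:M -> F *m B *m F = F -> B *m F = 1%:M.
Proof.
move=> ee f0 Xe XY FB FBF; apply: idem_full_rank; first by rewrite -mulmxA (mulmxA F) FBF.
apply/eqP; rewrite eqn_leq rank_leq_row /=.
have re : (r <= \rank (frac e))%N.
  have := mxrankM_maxr (frac X) (frac e *m frac Y); rewrite -!map_mxM mulmxA Xe XY.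
  rewrite map_scalar_mx /= -scalemx1 mxrank_scale_nz ?tofrac_eq0 // mxrank1.
  move=> /leq_trans; apply; rewrite map_mxM; exact: mxrankM_maxl.
have FB2 : F *m B = F *m (B *m F) *m B by rewrite mulmxA FBF.
apply: (@leq_trans (\rank (frac (F *m B)))).
  rewrite FB map_block_mx !map_mx0 map_mx1 rank_diag_block_mx mxrank1.
  by rewrite leq_add2r.
rewrite FB2 map_mxM; apply: leq_trans (mxrankM_maxl _ _) _.
by rewrite map_mxM; apply: mxrankM_maxr.
Qed.

End Fraction.

(** * Stable freeness by division *)
Section Division.
Variables (A R : idomainType) (iota : {rmorphism R -> A}) (t : A).

(** Evaluation at t, along iota, of polynomials over R. *)
Definition poly_at : {poly R} -> A := horner_eval t \o map_poly iota.
HB.instance Definition _ := GRing.RMorphism.on poly_at.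

Lemma poly_atC c : poly_at c%:P = iota c.
Proof. by rewrite /poly_at /= map_polyC /= horner_evalE hornerC. Qed.

Lemma poly_atX : poly_at 'X = t.
Proof. by rewrite /poly_at /= map_polyX /= horner_evalE hornerX. Qed.

Lemma poly_at_sum d (p : {poly R}) : (size p <= d)%N ->
  poly_at p = \sum_(i < d) t ^+ i * iota p`_i.
Proof.
move=> pd; rewrite /poly_at /= horner_evalE (@horner_coef_wide _ d); last first.
  by apply: leq_trans (size_poly _ _) pd.
by apply: eq_bigr => i _; rewrite coef_map mulrC.
Qed.

(** Weierstrass division: A is the direct sum of the ideal of F(t) and of the R-span of
the powers of t below deg F. In particular A / F(t) is a finite free R-module. *)
Record division (F : {poly R}) : Prop := Division {
  div_monic : F \is monic;
  div_exists : forall g, exists (q : A) (r : {poly R}),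
    (size r < size F)%N /\ g = q * poly_at F + poly_at r;
  div_uniq : forall (q : A) (r : {poly R}), (size r < size F)%N ->
    q * poly_at F + poly_at r = 0 -> r = 0 }.

Variable F : {poly R}.
Hypothesis divF : division F.
Local Notation d := (size F).-1.
Local Notation phi := (poly_at F).
Local Notation im M := (map_mx iota M).
Hypothesis phi0 : phi != 0.

Let sF : size F = d.+1.
Proof. by rewrite prednK // lt0n size_poly_eq0 monic_neq0 // (div_monic divF). Qed.

Let T : 'rV[A]_d := \row_i t ^+ i.

Lemma div_mx r (v : 'rV[A]_r) : exists qM : 'rV[A]_r * 'M[R]_(d, r),
  v = phi *: qM.1 + T *m im qM.2.
Proof.
have /choice[q /choice[p qpP]] := fun j => div_exists divF (v 0 j).
exists (\row_j q j, \matrix_(i, j) (p j)`_i); apply/rowP => j /=; rewrite !mxE.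
have [sp ->] := qpP j; rewrite mulrC; congr (_ + _).
rewrite (@poly_at_sum d); last by rewrite -ltnS -sF.
by apply: eq_bigr => i _; rewrite !mxE.
Qed.

Lemma div_mx_uniq r (q : 'rV[A]_r) (M : 'M[R]_(d, r)) :
  phi *: q + T *m im M = 0 -> M = 0.
Proof.
move=> E; apply/matrixP => i j; rewrite mxE.
pose p := \poly_(i < d) (if insub i is Some k then M k j else 0).
have sp : (size p <= d)%N by apply: size_poly.
have : p = 0.
  apply: (div_uniq divF (q := q 0 j)); first by rewrite sF ltnS.
  rewrite (poly_at_sum sp).
  move/rowP: E => /(_ j); rewrite !mxE => E0; apply: etrans E0; rewrite mulrC; congr (_ + _).
  by apply: eq_bigr => l _; rewrite !mxE coef_poly ltn_ord valK.
by move/polyP => /(_ i); rewrite coef_poly ltn_ord valK coef0.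
Qed.

Section Cokernel.
Variables (m r : nat) (e : 'M[A]_m) (X : 'M[A]_(r, m)) (Y : 'M[A]_(m, r)).
Hypothesis (eY : e *m Y = Y).
Hypotheses (YX : Y *m X = phi *: e) (XY : X *m Y = phi%:M).

(** Let P be the image of e, embedded in A^r by Y, and T = A^r / P. The R-linear quotient map
Q of the division by F gives an R-linear retraction v |-> Q(v X) e of Y, because
Y X = F e. Hence T is a direct summand, over R, of A^r, and also, since F kills T, of
the finite free R-module (A / F)^r. So T is finitely generated projective over R, and therefore free.
The map p is the projection of A^r onto T = R^k, and the rows of U lift the basis of T. *)
Lemma cokernel_free : proj_free R ->
  exists k (p : 'rV[A]_r -> 'rV[R]_k) (U : 'M[A]_(k, r)),
  [/\ forall c v w, p (iota c *: v + w) = c *: p v + p w,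
      forall w, p (w *m Y) = 0,
      forall v, p v = 0 -> exists w, v = w *m Y &
      forall z, p (im z *m U) = z].
Proof.
move=> Rfree.
have divc n : exists f : 'rV[A]_n -> 'rV[A]_n * 'M[R]_(d, n), forall v,
    v = phi *: (f v).1 + T *m im (f v).2.
  by have /choice[f fP] := @div_mx n; exists f.
have [dm dmP] := divc m; have [dr drP] := divc r.
pose Q v := (dm v).1; pose rem v := (dr v).2.
have phiI n (x y : 'rV[A]_n) : phi *: x = phi *: y -> x = y.
  by move=> /rowP h; apply/rowP => j; have := h j; rewrite !mxE; apply: mulfI.
have uniq n (q q' : 'rV[A]_n) M M' : phi *: q + T *m im M = phi *: q' + T *m im M' ->
    q = q' /\ M = M'.
  move=> E; have MM' : M = M'.
    apply/eqP; rewrite -subr_eq0; apply/eqP; apply: (@div_mx_uniq _ (q - q')).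
    by rewrite scalerBr map_mxB mulmxBr addrACA E -opprD subrr.
  by split=> //; apply: phiI; move: E; rewrite MM' => /addIr.
have lin n c (v w q q' : 'rV[A]_n) M M' : v = phi *: q + T *m im M ->
    w = phi *: q' + T *m im M' ->
    iota c *: v + w = phi *: (iota c *: q + q') + T *m im (c *: M + M').
  move=> -> ->; rewrite map_mxD map_mxZ mulmxDr -scalemxAr !scalerDr scalerA.
  by rewrite [_ * phi]mulrC -scalerA addrACA.
have Qlin c v w : Q (iota c *: v + w) = iota c *: Q v + Q w.
  by have [] := uniq _ _ _ _ _ (etrans (esym (dmP _)) (lin _ c _ _ _ _ _ _ (dmP v) (dmP w))).
have remlin c v w : rem (iota c *: v + w) = c *: rem v + rem w.
  by have [] := uniq _ _ _ _ _ (etrans (esym (drP _)) (lin _ c _ _ _ _ _ _ (drP v) (drP w))).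
have Qphi v : Q (phi *: v) = v.
  have E : phi *: v = phi *: v + T *m im 0 by rewrite map_mx0 mulmx0 addr0.
  by have [] := uniq _ _ _ _ _ (etrans (esym (dmP _)) E).
(* s is the projector of A^r along P; it identifies T with an R-submodule of A^r *)
pose s v := v - Q (v *m X) *m Y.
have slin c v w : s (iota c *: v + w) = iota c *: s v + s w.
  by rewrite /s mulmxDl -scalemxAl Qlin mulmxDl -scalemxAl scalerBr opprD addrACA.
have sY w : s (w *m Y) = 0.
  by rewrite /s -mulmxA YX -scalemxAr Qphi -mulmxA eY subrr.
have s0 : s 0 = 0 by have := sY 0; rewrite mul0mx.
have sD v w : s (v + w) = s v + s w.
  by have := slin 1 v w; rewrite rmorph1 !scale1r.
have ss v : s (s v) = s v.
  have := sD (s v) (Q (v *m X) *m Y); rewrite sY addr0 => <-.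
  by congr s; rewrite /s subrK.
have sphi q : s (phi *: q) = 0.
  by rewrite (_ : phi *: q = (q *m X) *m Y) ?sY // -mulmxA XY mul_mx_scalar.
have rem0 : rem 0 = 0.
  have := remlin 1 0 0; rewrite rmorph1 !scale1r addr0 => /eqP.
  by rewrite -subr_eq0 opprD addrA subrr sub0r oppr_eq0 => /eqP.
have srem v : s (T *m im (rem v)) = s v.
  by rewrite [in RHS](drP v) sD sphi add0r.
(* the projector of the remainders, i.e. of (A / F)^r, onto T *)
pose E (M : 'M[R]_(d, r)) := rem (s (T *m im M)).
have Elin : linear E.
  move=> c M N; rewrite /E -remlin -slin; congr (rem (s _)).
  by rewrite map_mxD map_mxZ mulmxDr -scalemxAr.
pose EL : {linear 'M[R]_(d, r) -> 'M[R]_(d, r)} :=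
  HB.pack E (GRing.isLinear.Build R 'M[R]_(d, r) 'M[R]_(d, r) *:%R E Elin).
have EE M : E (E M) = E M by rewrite /E srem ss.
have LE v : v *m lin_mx EL = mxvec (E (vec_mx v)).
  by rewrite -{1}[v]vec_mxK mul_vec_lin.
have [|k [X1 [Y1 [XY1 YX1]]]] := Rfree _ (lin_mx EL).
  by apply/row_matrixP => i; rewrite !rowE mulmxA !LE mxvecK EE.
pose p v := mxvec (rem (s v)) *m X1.
pose U : 'M[A]_(k, r) := \matrix_i (T *m im (vec_mx (row i Y1))).
have UE z : im z *m U = T *m im (vec_mx (z *m Y1)).
  rewrite [in LHS]mulmx_sum_row (mulmx_sum_row z) linear_sum /=.
  rewrite (big_morph (map_mx iota) (@map_mxD _ _ iota _ _) (map_mx0 iota _ _)) mulmx_sumr.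
  by apply: eq_bigr => i _; rewrite rowK linearZ /= map_mxZ -scalemxAr mxE.
exists k, p, U; split.
- by move=> c v w; rewrite /p slin remlin linearP mulmxDl -scalemxAl.
- by move=> w; rewrite /p sY rem0 linear0 mul0mx.
- move=> v pv0; have : mxvec (rem (s v)) = 0.
    have := congr1 (mulmx^~ Y1) pv0.
    by rewrite /p /= -mulmxA XY1 mul0mx LE mxvecK /E srem ss.
  move/(congr1 vec_mx); rewrite mxvecK linear0 => r0.
  have := srem (s v); rewrite r0 map_mx0 mulmx0 s0 ss => /esym/eqP.
  by rewrite subr_eq0 => /eqP vE; exists (Q (v *m X)).
- by move=> z; rewrite /p UE -/(E _) -LE -XY1 mulmxA -mulmxA YX1 mulmx1 -mulmxA YX1 mulmx1.
Qed.
End Cokernel.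
End Division.

Lemma row_space_choice (A : nzRingType) k m r (M : 'M[A]_(k, r)) (Y : 'M[A]_(m, r)) :
  (forall i, exists w : 'rV_m, row i M = w *m Y) -> exists W : 'M_(k, m), M = W *m Y.
Proof.
move=> /choice[w wP]; exists (\matrix_i w i); apply/row_matrixP => i.
by rewrite row_mul rowK wP.
Qed.

(** The cokernel T = R^k of P -> A^r has a second resolution
0 -> A^k -> A^k -> T -> 0, whose first map is D = t - tau for the matrix tau of
multiplication by t on T. Comparing it with 0 -> P -> A^r -> T -> 0 as in Schanuel's lemma
yields an isomorphism of P + A^k with A^r + A^k. *)
Section Schanuel.
Variables (A R : idomainType) (iota : {rmorphism R -> A}) (t : A) (F : {poly R}).
Hypothesis divF : division iota t F.
Local Notation phi := (poly_at iota t F).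
Local Notation im M := (map_mx iota M).
Hypothesis phi0 : phi != 0.
Variables (m r k : nat) (e : 'M[A]_m) (X : 'M[A]_(r, m)) (Y : 'M[A]_(m, r)).
Hypotheses (ee : e *m e = e) (Xe : X *m e = X) (eY : e *m Y = Y).
Hypotheses (YX : Y *m X = phi *: e) (XY : X *m Y = phi%:M).
Variables (p : 'rV[A]_r -> 'rV[R]_k) (U : 'M[A]_(k, r)).
Hypotheses (p_lin : forall c v w, p (iota c *: v + w) = c *: p v + p w)
  (pY : forall w, p (w *m Y) = 0)
  (p_ker : forall v, p v = 0 -> exists w, v = w *m Y)
  (pU : forall z, p (im z *m U) = z).

Let pD v w : p (v + w) = p v + p w.
Proof. by have := p_lin 1 v w; rewrite rmorph1 !scale1r. Qed.

Let pB v w : p (v - w) = p v - p w.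
Proof. by apply/eqP; rewrite eq_sym subr_eq -pD subrK. Qed.

Let tau : 'M[R]_k := \matrix_i p (t *: row i U).
Let D : 'M[A]_k := t%:M - im tau.
(** A lift of the projection A^r -> T to the free module A^k. *)
Let Lambda : 'M[A]_(r, k) := im (\matrix_i p (row i 1%:M)).

Lemma cokernel_actions : exists (H : 'M_(k, m)) (G : 'M_(r, m)),
  D *m U = H *m Y /\ 1%:M - Lambda *m U = G *m Y.
Proof.
have [|H HE] := @row_space_choice _ _ _ _ (D *m U) Y.
  move=> i; apply: p_ker; rewrite row_mul /D raddfB /= rowE mul_mx_scalar.
  by rewrite mulmxBl -scalemxAl -rowE pB -map_row pU rowK subrr.
have [|G GE] := @row_space_choice _ _ _ _ (1%:M - Lambda *m U) Y.
  move=> i; apply: p_ker; rewrite raddfB /= row_mul -map_row pB pU rowK subrr //.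
by exists H, G.
Qed.

(** Exactness of the second resolution in the middle. Modulo the image of D, multiplication
by t on a constant vector is tau, so every vector t^i z is congruent to a constant one; the
division by F extends this to all of A^k, once F itself is seen to act by zero. A constant
vector in the kernel of p vanishes because p is the identity on R^k. *)
Lemma companion_kernel u : p (u *m U) = 0 -> exists w : 'rV_k, u = w *m D.
Proof.
have [H [_ [HE _]]] := cokernel_actions.
have pDU w : p (w *m D *m U) = 0 by rewrite -mulmxA HE mulmxA pY.
pose good (u : 'rV[A]_k) := exists w z, u = w *m D + im z.
have goodD u1 u2 : good u1 -> good u2 -> good (u1 + u2).
  move=> [w [z ->]] [w' [z' ->]]; exists (w + w'), (z + z').
  by rewrite mulmxDl map_mxD addrACA.
have good0 : good 0 by exists 0, 0; rewrite mul0mx map_mx0 addr0.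
have goodT i z : good (t ^+ i *: im z).
  elim: i => [|i [w [z' E]]]; first by exists 0, z; rewrite mul0mx add0r expr0 scale1r.
  exists (t *: w + im z'), (z' *m tau).
  rewrite exprS -scalerA E scalerDr mulmxDl -scalemxAl -addrA; congr (_ + _).
  by rewrite /D mulmxBr mul_mx_scalar map_mxM subrK.
have goodS d (M : 'M_(d, k)) : good ((\row_i t ^+ i) *m im M).
  rewrite mulmx_sum_row; elim/big_ind: _ => // i _.
  by rewrite mxE -map_row.
have goodK (q : 'rV_k) : good q -> p (q *m U) = 0 -> exists w : 'rV_k, q = w *m D.
  move=> [w [z ->]]; rewrite mulmxDl pD pDU pU add0r => ->.
  by exists w; rewrite map_mx0 addr0.
have [W WE] : exists W : 'M_k, phi *: 1%:M = W *m D.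
  apply: row_space_choice => i; apply: goodK.
    rewrite (@poly_at_sum _ _ _ _ (size F)) // scaler_suml raddf_sum /=.
    elim/big_ind: _ => // j _.
    have -> : row i ((t ^+ j * iota F`_j) *: 1%:M) = t ^+ j *: im (F`_j *: row i 1%:M) :> 'rV_k.
      by apply/rowP => l; rewrite !mxE rmorphM rmorph_nat mulrA.
    exact: goodT.
  by rewrite -row_mul -scalemxAl mul1mx -mul_mx_scalar -XY mulmxA row_mul pY.
have [[q M] /= uE] := div_mx divF u.
have goodu : good u.
  rewrite uE; apply: goodD (goodS _ _); exists (q *m W), 0.
  by rewrite map_mx0 addr0 -mulmxA -WE -scalemxAr mulmx1.
exact: goodK.
Qed.

Lemma companion_factor n (M : 'M[A]_(n, k)) :
  (forall i, p (row i M *m U) = 0) -> exists W, M = W *m D.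
Proof. by move=> h; apply: row_space_choice => i; apply: companion_kernel. Qed.

(** The isomorphism sends (y, z) to (v, w) with v = y Y + z U and z = v Lambda + w D; its inverse
recovers y from v - z U, which lies in P. The matrices M1 and M2 give w, the matrices
G and H give y. The conclusion presents P as the kernel of a split surjection f of a
free module onto A^k, that is, of the projection onto the A^k summand. *)
Lemma schanuel_stably_free : exists (n : nat) (f : 'M[A]_(k, n)) (b : 'M[A]_(n, k)),
  f *m b = 1%:M /\ mvn e (1%:M - b *m f).
Proof.
have [H [G [HE GE]]] := cokernel_actions.
have [M0 M0E] : exists W, Y *m Lambda = W *m D.
  apply: companion_factor => i; rewrite -row_mul -mulmxA.
  have -> : Lambda *m U = 1%:M - G *m Y by rewrite -GE subKr.
  rewrite mulmxBr mulmx1 mulmxA raddfB /= [row i (_ *m Y)]row_mul [row i Y]rowE.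
  by rewrite pB !pY subrr.
(* composing with e makes M1 a map out of P, i.e. e M1 = M1 *)
pose M1 := e *m M0.
have M1E : Y *m Lambda = M1 *m D by rewrite -mulmxA -M0E mulmxA eY.
have [M2 M2E] : exists W, 1%:M - U *m Lambda = W *m D.
  apply: companion_factor => i; rewrite -row_mul mulmxBl mul1mx -mulmxA.
  have -> : Lambda *m U = 1%:M - G *m Y by rewrite -GE subKr.
  by rewrite mulmxBr mulmx1 subKr mulmxA row_mul pY.
have cancelY n (V W : 'M_(n, m)) : V *m Y = W *m Y -> V *m e = W *m e.
  move=> /(congr1 (mulmx^~ X)) /=; rewrite -!mulmxA YX -!scalemxAr => /matrixP E.
  by apply/matrixP => i j; have := E i j; rewrite !mxE; apply: mulfI.
pose F1 := row_mx Y (- M1); pose f := row_mx U M2.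
pose B1 := col_mx (G *m e) (- (H *m e)); pose b := col_mx Lambda D.
have FB : col_mx F1 f *m row_mx B1 b = block_mx e 0 0 1%:M.
  rewrite mul_col_row; congr block_mx.
  - rewrite mul_row_col mulmxN mulNmx opprK !mulmxA -mulmxDl -[RHS]ee.
    apply: cancelY; rewrite mulmxDl -!mulmxA -GE -HE eY mulmxBr mulmx1 !mulmxA M1E.
    by rewrite subrK.
  - by rewrite mul_row_col mulNmx M1E subrr.
  - rewrite mul_row_col mulmxN !mulmxA -mulmxBl -[RHS](mul0mx _ e).
    apply: cancelY; rewrite mulmxBl -!mulmxA -GE -HE mul0mx mulmxBr mulmx1 !mulmxA.
    by rewrite -M2E mulmxBl mul1mx subrr.
  - by rewrite mul_row_col -M2E subrKC.
have BF : row_mx B1 b *m col_mx F1 f = 1%:M.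
  apply: (square_inverse ee phi0 Xe XY FB).
  rewrite FB mul_block_col !mul0mx mul1mx addr0 add0r; congr col_mx.
  by rewrite mul_mx_row eY mulmxN mulmxA ee.
move: FB; rewrite mul_col_row => /eq_block_mx[FB1 _ _ fb].
exists (r + k)%N, f, b; split=> //; exists F1, B1; split=> //.
by rewrite -BF mul_row_col addrK.
Qed.
End Schanuel.

(** Weierstrass preparation and division for f, over a coefficient ring R on which the
question of freeness is already settled. *)
Definition has_division (A : idomainType) (f : A) : Prop :=
  exists (R : idomainType) (iota : {rmorphism R -> A}) (t : A) (F : {poly R}),
  [/\ proj_free R, division iota t F &
      exists2 u, u \is a GRing.unit & poly_at iota t F = u * f].

(** * Cancellation and freeness *)
Section Unimodular.
Variable A : idomainType.

(** The kernel of a unimodular row v is free. By [mvn_compl] this does not depend on the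
right inverse b. *)
Definition kernel_splits s (v : 'rV[A]_s) : Prop :=
  forall b : 'cV[A]_s, v *m b = 1%:M -> splits (1%:M - b *m v).

Lemma kernel_splits_equiv s (v w : 'rV[A]_s) : row_equiv v w -> kernel_splits w -> kernel_splits v.
Proof.
move=> [G Gu vG] hw b vb.
apply: splits_mvn (hw (invmx G *m b) _); first exact: idem_compl.
  exists G, (invmx G *m (1%:M - b *m v)); split.
    by rewrite mulKVmx.
  by rewrite mulmxBr mulmx1 mulmxBl mulVmx // -vG !mulmxA.
by rewrite -vG -mulmxA mulKVmx.
Qed.

(** Division by the first entry replaces the other entries by polynomials in t over R. The
polynomial row V is still unimodular over R[x], because A / F(t) = R[x] / F. By
Suslin's theorem V is equivalent to the row V(0) of constants, and kernels of unimodular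
rows over R are free. *)
Lemma kernel_splits_monic s (R : idomainType) (iota : {rmorphism R -> A}) t F (v : 'rV[A]_(1 + (1 + s))) :
  proj_free R -> division iota t F -> v 0 0 = poly_at iota t F -> kernel_splits v.
Proof.
move=> Rfree divF v0.
have /choice[q' /choice[r' qrP]] := fun j => div_exists divF (v 0 j).
pose phi := poly_at iota t F.
pose V : 'rV[{poly R}]_(1 + (1 + s)) := \row_j (if j == 0 then F else r' j).
pose V' := map_mx (poly_at iota t) V.
have vV : row_equiv v V'.
  pose u : 'cV[A]_(1 + (1 + s)) := delta_mx 0 0.
  pose cc : 'rV[A]_(1 + (1 + s)) := \row_j (if j == 0 then 0 else - q' j).
  have -> : V' = v + (v *m u) *m cc.
    have vu : v *m u = phi%:M.
      by rewrite /u -colE [LHS]mx11_scalar mxE v0.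
    rewrite vu mul_scalar_mx; apply/rowP => j; rewrite !mxE.
    case: eqP => [->|_]; first by rewrite v0 mulr0 addr0.
    by have [_ ->] := qrP j; rewrite mulrN mulrC addrAC subrr add0r.
  apply: row_equiv_transvection.
  by rewrite /u -colE; apply/matrixP => i j; rewrite !mxE.
apply: (kernel_splits_equiv vV) => b Vb.
have /choice[q /choice[c qcP]] := fun j => div_exists divF (b j 0).
have Fmon := div_monic divF.
pose S := (V *m \col_j c j) 0 0 - 1.
pose q0 := Pdiv.Ring.rdivp S F; pose r0 := Pdiv.Ring.rmodp S F.
have SE : S = q0 * F + r0 by apply: Pdiv.RingMonic.rdivp_eq.
have r00 : r0 = 0.
  apply: (div_uniq divF (q := poly_at iota t q0 + \sum_j (V' 0 j * q j))).
    by rewrite Pdiv.Ring.ltn_rmodpN0 // monic_neq0.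
  have := congr1 (poly_at iota t) SE; rewrite !rmorphD !rmorphM !rmorphN rmorph1 /= => E.
  rewrite mulrDl addrAC -E mxE rmorph_sum mulr_suml addrAC -big_split /=.
  move/matrixP: Vb => /(_ 0 0); rewrite !mxE mulr1n => Vb.
  apply/eqP; rewrite subr_eq0 -Vb; apply/eqP.
  apply: eq_bigr => j _; rewrite [(\col__ _) _ _]mxE rmorphM /=; have [_ ->] := qcP j.
  by rewrite mulrDr addrC mulrA [V' 0 j]mxE.
pose cc : 'cV[{poly R}]_(1 + (1 + s)) := \col_j (if j == 0 then c 0 - q0 else c j).
have Vcc : V *m cc = 1%:M.
  apply/matrixP => i j; rewrite !ord1 [RHS]mxE mulr1n.
  transitivity (1 + S - q0 * F); last by rewrite SE r00 addr0 addrK.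
  rewrite /S [1 + _]addrC subrK !mxE !big_ord_recl !mxE /= mulrBr.
  by rewrite [F * q0]mulrC addrAC; congr (_ + (_ + _) - _); apply: eq_bigr => l _; rewrite !mxE.
have Vmon : V 0 0 \is monic by rewrite mxE.
have VV0 := suslin_monic Vmon Vcc.
set V0 := map_mx _ V in VV0.
pose W : 'rV[R]_(1 + (1 + s)) := map_mx (fun p : {poly R} => p.[0]) V.
have V0W : map_mx (poly_at iota t) V0 = map_mx iota W.
  by apply/rowP => j; rewrite !mxE poly_atC.
apply: (@kernel_splits_equiv _ _ (map_mx iota W)) Vb.
  case: VV0 => G Gu VG; exists (map_mx (poly_at iota t) G).
    by move: Gu; rewrite !unitmxE det_map_mx; apply: rmorph_unit.
  by rewrite -V0W -VG map_mxM.
have [b0 Wb0] : exists b0 : 'cV_(1 + (1 + s)), W *m b0 = 1%:M.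
  have [b1 Vb1] := row_equiv_unimodular VV0 Vcc.
  exists (map_mx (horner_eval 0) b1).
  have := congr1 (map_mx (horner_eval 0)) Vb1; rewrite map_mxM map_mx1 => <-.
  by congr (_ *m _); apply/rowP => j; rewrite !mxE /= horner_evalE hornerC.
move=> {b q c qcP S q0 r0 SE r00 cc Vcc} b Wb.
apply: splits_mvn (mvn_compl Wb (_ : map_mx iota W *m map_mx iota b0 = 1%:M)) _.
- exact: idem_compl.
- by rewrite -map_mxM Wb0 map_mx1.
have [r [X [Y [XY YX]]]] := Rfree _ _ (idem_compl Wb0).
exists r, (map_mx iota X), (map_mx iota Y); rewrite -!map_mxM XY YX.
by rewrite map_mx1 map_mxB map_mx1 map_mxM.
Qed.

Hypothesis divA : forall f : A, f != 0 -> has_division f.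

(** For rows of length at least two, a permutation and a unit bring a nonzero entry of v into
first position as a monic polynomial in t; a unimodular row of length one has kernel zero. *)
Lemma unimodular_kernel_splits s (v : 'rV[A]_s) : kernel_splits v.
Proof.
move=> b vb.
have [j vj] : exists j, v 0 j != 0.
  apply: contrapT => /forallNP v0; have : v *m b = 0.
    apply/matrixP => i j; rewrite !mxE big1 // => l _.
    by have /negP := v0 l; rewrite negbK ord1 => /eqP ->; rewrite mul0r.
  by rewrite vb => /matrixP/(_ 0 0); rewrite !mxE => /eqP; rewrite oner_eq0.
case: s v b vb j vj => [|[|s]] v b vb j vj; first by case: j vj.
  exists 0%N, 0, 0; rewrite mul0mx; split; last by apply/matrixP => -[].
  apply/esym/eqP; rewrite subr_eq0; apply/eqP.
  rewrite -[1%:M]vb [v]mx11_scalar [b]mx11_scalar -!scalar_mxM mulrC //.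
have [R [iota [t [F [Rfree divF [u uu uF]]]]]] := divA vj.
pose G : 'M[A]_(s.+2) := perm_mx (tperm 0 j).
pose w : 'rV[A]_(1 + (1 + s)) := v *m G.
have w0 : w 0 0 = v 0 j.
  by rewrite /w /G -tpermV -col_permE mxE tpermL.
have vw : row_equiv v w by exists G => //; apply: unitmx_perm.
pose d : 'rV[A]_(1 + (1 + s)) := \row_j (if j == 0 then u else 1).
have ww : row_equiv w (w *m diag_mx d).
  exists (diag_mx d) => //; rewrite unitmxE det_diag unitr_prod // => i _.
  by rewrite mxE; case: ifP => // _; rewrite unitr1.
apply: (kernel_splits_equiv (row_equiv_trans vw ww)) vb.
apply: kernel_splits_monic Rfree divF _.
by rewrite mul_mx_diag mxE w0 mxE eqxx mulrC uF.
Qed.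

(** Induction on the number of rows: on the kernel of the first row, free by
[unimodular_kernel_splits], the other rows still form a split surjection. *)
Lemma unimodular_splits k s (f : 'M[A]_(k, s)) (b : 'M[A]_(s, k)) :
  f *m b = 1%:M -> splits (1%:M - b *m f).
Proof.
elim: k s f b => [|k IHk] s f b fb.
  by exists s, 1%:M, 1%:M; rewrite mulmx1 thinmx0 mul0mx subr0.
rewrite -[k.+1]/(1 + k)%N in f b fb *.
pose f1 := usubmx f; pose f2 := dsubmx f; pose b1 := lsubmx b; pose b2 := rsubmx b.
have fE : f = col_mx f1 f2 by rewrite vsubmxK.
have bE : b = row_mx b1 b2 by rewrite hsubmxK.
move: (fb); rewrite {1}fE {1}bE mul_col_row scalar_mx_block => /eq_block_mx[fb11 fb12 fb21 fb22].
have bfE : b *m f = b1 *m f1 + b2 *m f2 by rewrite fE bE mul_row_col.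
have [s' [X [Y [XY YX]]]] := unimodular_kernel_splits fb11.
have Yb1 : Y *m b1 = 0.
  rewrite -[Y]mul1mx -YX -!mulmxA (mulmxA X) XY mulmxBl mul1mx -mulmxA fb11 mulmx1.
  by rewrite subrr !mulmx0.
have f1X : f1 *m X = 0.
  rewrite -[X]mulmx1 -YX !mulmxA -(mulmxA _ X) XY mulmxBr mulmx1 mulmxA fb11 mul1mx.
  by rewrite subrr !mul0mx.
have fb2 : (f2 *m X) *m (Y *m b2) = 1%:M.
  rewrite mulmxA -(mulmxA f2) XY mulmxBr mulmx1 mulmxBl mulmxA fb21 !mul0mx subr0 //.
apply: splits_mvn (IHk _ _ _ fb2); first exact: idem_compl.
pose N := 1%:M - b *m f.
have Nb : N *m b = 0 by rewrite mulmxBl mul1mx -mulmxA fb mulmx1 subrr.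
have Nb1 : N *m b1 = 0.
  by move: Nb; rewrite bE mul_mx_row -[0]row_mx0 => /eq_row_mx[].
have NN : N *m N = N by apply: idem_compl.
have NP : N *m (1%:M - b1 *m f1) = N.
  by rewrite [LHS]mulmxBr mulmx1 mulmxA Nb1 mul0mx subr0.
exists (N *m X), (Y *m N); split; first by rewrite mulmxA -(mulmxA N) XY NP NN.
rewrite [LHS]mulmxA -[Y *m N *m N]mulmxA NN /N bfE mulmxBr mulmx1 mulmxDr !mulmxA Yb1 mul0mx add0r.
by rewrite mulmxBl YX.
Qed.

Theorem division_proj_free : proj_free A.
Proof.
move=> m e ee.
have [r [X0 [Y [f [f0 Xe0 eY YX0 XY0]]]]] := generic_splitting ee.
have [R [iota [t [F [Rfree divF [u uu uF]]]]]] := divA f0.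
have phi0 : poly_at iota t F != 0.
  by rewrite uF mulf_neq0 //; apply: contraTneq uu => ->; rewrite unitr0.
pose X := u *: X0.
have Xe : X *m e = X by rewrite -scalemxAl Xe0.
have YX : Y *m X = poly_at iota t F *: e by rewrite -scalemxAr YX0 scalerA uF.
have XY : X *m Y = (poly_at iota t F)%:M by rewrite -scalemxAl XY0 scale_scalar_mx uF.
have [k [p [U [p_lin pY p_ker pU]]]] := cokernel_free divF phi0 eY YX XY Rfree.
have [n [g [b [gb eg]]]] := schanuel_stably_free divF phi0 ee Xe eY YX XY p_lin pY p_ker pU.
exact: splits_mvn ee eg (unimodular_splits gb).
Qed.

End Unimodular.

Lemma field_proj_free (k : fieldType) : proj_free k.
Proof.
move=> m e ee; have [r [X [Y [f [f0 _ _ YX XY]]]]] := generic_splitting ee.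
exists r, (f^-1 *: Y), X; rewrite -scalemxAl -scalemxAr YX XY.
by rewrite scalerA mulVf // scale1r scale_scalar_mx mulVf.
Qed.

(** * Uniform bounds on an annulus and successive approximation *)
(** Bernoulli's inequality for the inverse of eps. *)
Lemma geometric_small (R : realType) (c eps e : R) :
  0 <= c -> 0 <= eps -> eps < 1 -> 0 < e -> exists N, c * eps ^+ N < e.
Proof.
move=> c0 eps0 eps1 e0; have [->|epsn0] := eqVneq eps 0.
  by exists 1%N; rewrite expr1 mulr0.
have {epsn0 eps0} eps0 : 0 < eps by rewrite lt_def epsn0.
pose h := eps^-1 - 1; have h0 : 0 < h by rewrite subr_gt0 invf_gt1.
have bern N : N%:R * h <= eps^-1 ^+ N.
  rewrite (_ : eps^-1 = 1 + h); last by rewrite /h subrKC.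
  suff : 1 + N%:R * h <= (1 + h) ^+ N by apply: le_trans; rewrite lerDr.
  elim: N => [|N IH]; first by rewrite mul0r addr0 expr0.
  rewrite exprS; apply: le_trans (_ : (1 + h) * (1 + N%:R * h) <= _); last first.
    by rewrite ler_wpM2l // addr_ge0 // ltW.
  rewrite -subr_ge0 -natr1 (_ : _ - _ = N%:R * (h * h)); last by ring.
  by rewrite mulr_ge0 // mulr_ge0 // ltW.
pose N := Num.truncn (c / e / h); exists N.+1.
have hN : c / e / h < N.+1%:R by apply: truncnS_gt.
rewrite -ltr_pdivlMr ?exprn_gt0 // -exprVn.
rewrite ltr_pdivrMr // in hN.
have := lt_le_trans hN (bern N.+1).
by rewrite ltr_pdivrMr // mulrC.
Qed.

Section LaurentBound.
Variables (R : realType) (K : completeNonarchFieldType R) (n : nat).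
Variables (a b : 'rV[R]_n) (a0 : ltv 0 a) (ab : lev a b).
Local Notation L := (laurent K a0 ab).
Implicit Types (f g h q r : L) (c d e : R).

Let pos sigma : lev a sigma -> ltv 0 sigma.
Proof. by move=> h j; apply: lt_le_trans (a0 j) (h j). Qed.

(** An upper bound for the norm of f on [a, b], i.e. for the sup of |f_i| sigma^i. Working with
bounds rather than with the norm itself avoids suprema altogether. *)
Definition bnd f c : Prop :=
  forall sigma, lev a sigma -> lev sigma b -> forall i, nnorm (f i) * monom sigma i <= c.

Lemma bnd_le f c d : c <= d -> bnd f c -> bnd f d.
Proof. by move=> cd fc s as_ sb i; apply: le_trans (fc s as_ sb i) cd. Qed.

Lemma bnd0 c : 0 <= c -> bnd 0 c.
Proof. by move=> c0 s _ _ i; rewrite /= if_same nnorm0 mul0r. Qed.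

Lemma bndD f g c : bnd f c -> bnd g c -> bnd (f + g) c.
Proof.
move=> fc gc s as_ sb i; have s0 := monom_gt0 i (pos as_).
rewrite -ler_pdivlMr //; apply: nnormD_le; rewrite ler_pdivlMr //; [exact: fc|exact: gc].
Qed.

Lemma bndN f c : bnd f c -> bnd (- f) c.
Proof. by move=> fc s as_ sb i; rewrite /= nnormN; apply: fc. Qed.

Lemma bndB f g c : bnd f c -> bnd g c -> bnd (f - g) c.
Proof. by move=> fc gc; apply: bndD => //; apply: bndN. Qed.

Lemma bnd_sum (I : Type) (s : seq I) (P : pred I) (F : I -> L) c : 0 <= c ->
  (forall i, P i -> bnd (F i) c) -> bnd (\sum_(i <- s | P i) F i) c.
Proof.
by move=> c0 FP; elim/big_ind: _ => //; [apply: bnd0|move=> x y; apply: bndD].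
Qed.

Lemma bndM f g c d : 0 <= c -> 0 <= d -> bnd f c -> bnd g d -> bnd (f * g) (c * d).
Proof.
move=> c0 d0 fc gd s as_ sb k; have s0 i := monom_gt0 i (pos as_).
rewrite -ler_pdivlMr //.
apply: has_sum_le (null_has_sum (null_conv a0 ab k (coefP f) (coefP g))) _ _.
  by rewrite divr_ge0 ?mulr_ge0 // ltW.
move=> i; rewrite ler_pdivlMr // (_ : monom s k = monom s i * monom s (k - i)).
  have nn0 x l : 0 <= nnorm (x : K) * monom s l by rewrite mulr_ge0 ?nnorm_ge0 // ltW.
  by rewrite nnormM mulrACA ler_pM //; [exact: fc|exact: gd].
by rewrite -monomD ?subrKC //; apply: pos.
Qed.

Lemma bnd_eq0 f : (forall e, 0 < e -> bnd f e) -> f = 0.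
Proof.
move=> fe; apply: laurentP => i /=; rewrite if_same; apply: nnorm_small => e e0.
have a_i := monom_gt0 i a0.
have e2 : 0 < e / 2 by rewrite divr_gt0 ?ltr0n.
have := fe _ (mulr_gt0 e2 a_i) a (fun _ => lexx _) ab i.
rewrite ler_pM2r // => /le_lt_trans; apply.
by rewrite ltr_pdivrMr ?ltr0n // ltr_pMr // ltr1n.
Qed.

(** Completeness, in the only form needed: geometrically bounded series converge. *)
Lemma bnd_series (q : nat -> L) c eps : 0 <= c -> 0 <= eps -> eps < 1 ->
  (forall k, bnd (q k) (c * eps ^+ k)) ->
  exists s, forall N, bnd (s - \sum_(k < N) q k) (c * eps ^+ N).
Proof.
move=> c0 eps0 eps1 qP.
pose S N := \sum_(k < N) q k.
have ceps N : 0 <= c * eps ^+ N by rewrite mulr_ge0 ?exprn_ge0.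
have Sdiff N m : (N <= m)%N -> bnd (S m - S N) (c * eps ^+ N).
  elim: m => [|m IH]; first by rewrite leqn0 => /eqP ->; rewrite subrr; apply: bnd0.
  rewrite leq_eqVlt ltnS => /orP[/eqP <-|Nm]; first by rewrite subrr; apply: bnd0.
  rewrite /S big_ord_recr /= addrAC; apply: bndD; first exact: IH.
  apply: bnd_le (qP m); rewrite ler_wpM2l // ler_wiXn2l // ltW //.
have /choice[s sP] i : exists s, forall e, 0 < e -> exists N, forall m, (N <= m)%N ->
    nnorm (S m i - s) < e.
  apply: nnorm_complete => e e0; have a_i := monom_gt0 i a0.
  have [N Ne] := geometric_small c0 eps0 eps1 (mulr_gt0 e0 a_i).
  have key m : (N <= m)%N -> nnorm (S m i - S N i) < e.
    move=> Nm; have := Sdiff N m Nm a (fun _ => lexx _) ab i => /=.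
    by rewrite -ler_pdivlMr // => /le_lt_trans; apply; rewrite ltr_pdivrMr.
  exists N => m l Nm Nl; rewrite -(subrK (S N i) (S m i)) -addrA.
  apply: nnormD_lt; first exact: key.
  by rewrite -nnormN opprB key.
have sS N sigma i : lev a sigma -> lev sigma b ->
    nnorm (s i - S N i) * monom sigma i <= c * eps ^+ N.
  move=> as_ sb; have s_i := monom_gt0 i (pos as_).
  rewrite -ler_pdivlMr //; apply/ler_addgt0Pr => e e0.
  have [M MP] := sP i e e0; pose m := maxn N M.
  rewrite -(subrK (S m i) (s i)) -addrA; apply: nnormD_le.
    rewrite -nnormN opprB; apply: le_trans (ltW (MP m (leq_maxr _ _))) _.
    by rewrite lerDr divr_ge0 // ltW.
  apply: (@le_trans _ _ (c * eps ^+ N / monom sigma i)); last by rewrite lerDl ltW.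
  by rewrite ler_pdivlMr //; apply: Sdiff (leq_maxl _ _) _ as_ sb i.
have sconv : convergent_on a b s.
  move=> sigma as_ sb e e0.
  have [N Ne] := geometric_small c0 eps0 eps1 e0.
  have [M MP] := coefP (S N) as_ sb e0.
  exists M => i /MP SNe; have s_i := monom_gt0 i (pos as_).
  rewrite -ltr_pdivlMr // -(subrK (S N i) (s i)); apply: nnormD_lt.
    by rewrite ltr_pdivlMr //; apply: le_lt_trans (sS _ _ _ as_ sb) Ne.
  by rewrite ltr_pdivlMr.
by exists (Laurent a0 ab sconv) => N sigma as_ sb i; apply: sS.
Qed.

Definition supported (D : 'rV[int]_n -> Prop) f : Prop := forall i, ~ D i -> f i = 0.

Lemma supported0 D : supported D 0.
Proof. by move=> i _ /=; rewrite if_same. Qed.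

Lemma supportedD D f g : supported D f -> supported D g -> supported D (f + g).
Proof. by move=> fD gD i Di /=; rewrite fD ?gD ?addr0. Qed.

Lemma supportedN D f : supported D f -> supported D (- f).
Proof. by move=> fD i Di /=; rewrite fD ?oppr0. Qed.

Lemma supported_sum D (I : Type) (s : seq I) (P : pred I) (F : I -> L) :
  (forall i, P i -> supported D (F i)) -> supported D (\sum_(i <- s | P i) F i).
Proof.
by move=> FP; elim/big_ind: _ => //; [apply: supported0|move=> x y; apply: supportedD].
Qed.

(** Successive approximation: approximate division by f with an error smaller by a fixed factor
eps < 1, iterated on the error, converges to an exact division. The support condition D on the
remainder survives because it is a closed condition on coefficients. *)
Lemma approx_division f (D : 'rV[int]_n -> Prop) eps C :
  0 <= eps -> eps < 1 -> 0 <= C -> bnd f C ->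
  (forall g c, 0 <= c -> bnd g c -> exists q r, [/\ supported D r, bnd q c, bnd r c &
     bnd (g - (q * f + r)) (eps * c)]) ->
  forall g c, 0 <= c -> bnd g c ->
    exists q r, [/\ supported D r, bnd q c & g = q * f + r].
Proof.
move=> eps0 eps1 C0 fC step g c c0 gc.
have ceps N : 0 <= c * eps ^+ N by rewrite mulr_ge0 ?exprn_ge0.
have /choice[st stP] (x : nat * L) : exists qr : L * L, bnd x.2 (c * eps ^+ x.1) ->
   [/\ supported D qr.2, bnd qr.1 (c * eps ^+ x.1), bnd qr.2 (c * eps ^+ x.1) &
     bnd (x.2 - (qr.1 * f + qr.2)) (c * eps ^+ x.1.+1)].
  have [xc|xc] := pselect (bnd x.2 (c * eps ^+ x.1)); last by exists (0, 0).
  have [q [r [rD qc rc h]]] := step _ _ (ceps _) xc.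
  by exists (q, r); split => //; rewrite exprS mulrCA.
pose fix G k := if k is k'.+1 then
  G k' - ((st (k', G k')).1 * f + (st (k', G k')).2) else g.
have GP k : bnd (G k) (c * eps ^+ k).
  elim: k => [|k IH]; first by rewrite expr0 mulr1.
  by have [_ _ _ h] := stP (k, G k) IH.
pose q k := (st (k, G k)).1; pose r k := (st (k, G k)).2.
have qP k : bnd (q k) (c * eps ^+ k) by have [] := stP (k, G k) (GP k).
have rP k : bnd (r k) (c * eps ^+ k) by have [] := stP (k, G k) (GP k).
have rD k : supported D (r k) by have [] := stP (k, G k) (GP k).
have GE N : g = (\sum_(k < N) q k) * f + \sum_(k < N) r k + G N.
  elim: N => [|N IH]; first by rewrite !big_ord0 mul0r !add0r.
  rewrite !big_ord_recr /= -/(q N) -/(r N) mulrDl {1}IH; ring.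
have [q' q'P] := bnd_series c0 eps0 eps1 qP.
have [r' r'P] := bnd_series c0 eps0 eps1 rP.
exists q', r'; split.
- move=> i Di; apply/nnorm_small => e e0; have a_i := monom_gt0 i a0.
  have [N Ne] := geometric_small c0 eps0 eps1 (mulr_gt0 e0 a_i).
  have := r'P N a (fun _ => lexx _) ab i.
  have -> : (r' - \sum_(k < N) r k) i = r' i.
    rewrite /= (_ : (\sum_(k < N) r k) i = 0) ?subr0 //.
    by apply: (@supported_sum D).
  by rewrite -ler_pdivlMr // => /le_lt_trans; apply; rewrite ltr_pdivrMr.
- by have := q'P 0%N; rewrite big_ord0 subr0 expr0 mulr1.
apply/eqP; rewrite -subr_eq0; apply/eqP/bnd_eq0 => e e0.
have C1 : 1 <= 1 + C by rewrite lerDl.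
have c1 : 0 <= c * (1 + C) by rewrite mulr_ge0 // (le_trans ler01).
have [N /ltW Ne] := geometric_small c1 eps0 eps1 e0.
apply: bnd_le Ne _; rewrite {1}(GE N).
have -> : (\sum_(k < N) q k) * f + \sum_(k < N) r k + G N - (q' * f + r') =
   G N - ((q' - \sum_(k < N) q k) * f + (r' - \sum_(k < N) r k)) by ring.
have cN x : 0 <= x -> x <= 1 + C -> x * (c * eps ^+ N) <= c * (1 + C) * eps ^+ N.
  by move=> x0 xC; rewrite mulrAC [X in _ <= X]mulrC ler_wpM2r.
have cN1 := cN 1 ler01 C1; rewrite mul1r in cN1.
apply: bndB; first exact: bnd_le (GP N).
apply: bndD; last exact: bnd_le (r'P N).
apply: bnd_le (bndM (ceps N) C0 (q'P N) fC).
by rewrite mulrC cN // lerDr ler01.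
Qed.

(** The geometric series, as division by 1 + h with quotient g itself and no remainder. *)
Lemma unit_near1 h eps : 0 <= eps -> eps < 1 -> bnd h eps ->
  exists y, y * (1 + h) = 1.
Proof.
move=> eps0 eps1 heps.
have one1 : bnd 1 1.
  move=> s as_ sb i /=; case: eqP => [->|_]; last by rewrite nnorm0 mul0r ler01.
  by rewrite nnorm1 monom0 mulr1.
have [||q [r [rD _ E]]] := @approx_division (1 + h) (fun=> False) eps 1 eps0 eps1 ler01 _ _ 1 1 ler01 one1.
- by apply: bndD => //; apply: bnd_le heps; apply: ltW.
- move=> g c c0 gc; exists g, 0; split=> //; [exact: supported0|exact: bnd0|].
  rewrite (_ : _ - _ = - (g * h)); last by ring.
  by rewrite mulrC; apply: bndN; apply: bndM.
have r0 : r = 0 by apply: laurentP => i; rewrite /= if_same; apply: rD.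
by exists q; rewrite [RHS]E r0 addr0.
Qed.
End LaurentBound.

(** * The Gauss norm at a single radius *)
Lemma seq_max_exists (T : eqType) d (D : orderType d) (l : T -> D) (s : seq T) x :
  x \in s -> exists2 i, i \in s & forall j, j \in s -> (l j <= l i)%O.
Proof.
elim: s x => // y [|z s] IH x xs.
  by exists y; rewrite ?mem_head // => j; rewrite inE => /eqP ->.
have [i iS iP] := IH z (mem_head _ _); have [yi|iy] := leP (l y) (l i).
  exists i; first by rewrite inE iS orbT.
  by move=> j; rewrite inE => /orP[/eqP ->|/iP].
exists y; first exact: mem_head.
move=> j; rewrite inE => /orP[/eqP -> //|/iP ji]; exact: le_trans ji (ltW iy).
Qed.

Section NullMax.
Variables (R : realType) (I : choiceType) (w : I -> R).
Hypotheses (w_ge0 : forall i, 0 <= w i) (w0 : tends0 w).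

Lemma null_max_attained i1 : 0 < w i1 -> exists i0, forall i, w i <= w i0.
Proof.
move=> wi1; have [F FP] := w0 wi1.
have i1F : i1 \in F by apply: contraT => /FP; rewrite ger0_norm // ltxx.
have [i0 _ i0P] := seq_max_exists w i1F; exists i0 => i.
have [/i0P //|/FP] := boolP (i \in F); rewrite ger0_norm // => /ltW wi.
exact: le_trans wi (i0P _ i1F).
Qed.

Lemma null_level_finite M : 0 < M -> exists S : {fset I}, forall i, (i \in S) = (w i == M).
Proof.
move=> M0; have [F FP] := w0 M0; exists [fset i in F | w i == M]%fset => i.
rewrite !inE /=; case: eqP => [wM|_]; rewrite ?andbF // andbT.
by apply: contraT => /FP; rewrite ger0_norm // wM ltxx.
Qed.
End NullMax.

Lemma null_strict_sup (R : realType) (I : choiceType) (w : I -> R) (P : pred I) M :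
  (forall i, 0 <= w i) -> tends0 w -> 0 < M -> (forall i, P i -> w i < M) ->
  exists c, [/\ 0 <= c, c < M & forall i, P i -> w i <= c].
Proof.
move=> w_ge0 w0 M0 wM; pose w' i := if P i then w i else 0.
have w'_ge0 i : 0 <= w' i by rewrite /w'; case: ifP.
have w'0 : tends0 w'.
  apply: tends0_le w0 => i; rewrite /w'; case: ifP => // _.
  by rewrite normr0.
have [[i1 wi1]|wn] := pselect (exists i, 0 < w' i).
  have [i0 i0P] := null_max_attained w'_ge0 w'0 wi1.
  exists (w' i0); split=> //; first by rewrite /w'; case: ifP => // /wM.
  by move=> i Pi; have := i0P i; rewrite {1}/w' Pi.
exists 0; split=> // i Pi; rewrite leNgt; apply/negP => wi; apply: wn; exists i.
by rewrite /w' Pi.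
Qed.

Section Monomials.
Variables (R : realType) (K : completeNonarchFieldType R) (n : nat).
Variables (a b : 'rV[R]_n) (a0 : ltv 0 a) (ab : lev a b).
Local Notation L := (laurent K a0 ab).
Implicit Types (f g : L) (c : K) (k i : 'rV[int]_n).

Lemma convergent_finsupp (G : {fset 'rV[int]_n}) (u : 'rV[int]_n -> K) :
  (forall i, i \notin G -> u i = 0) -> convergent_on a b u.
Proof.
move=> uG sigma _ _ e e0; have [N NP] := mabs_bound G.
by exists N => i /NP/uG ->; rewrite nnorm0 mul0r.
Qed.

Lemma convergent_mono c k : convergent_on a b (fun i => if i == k then c else 0).
Proof.
by apply: (@convergent_finsupp [fset k]%fset) => i; rewrite inE => /negPf ->.
Qed.

Definition mono c k : L := Laurent a0 ab (@convergent_mono c k).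

Lemma convergent_trunc f (G : {fset 'rV[int]_n}) :
  convergent_on a b (fun i => if i \in G then f i else 0).
Proof. by apply: (@convergent_finsupp G) => i /negPf ->. Qed.

Definition trunc f G : L := Laurent a0 ab (@convergent_trunc f G).

Lemma laurentD_coef f g i : (f + g) i = f i + g i. Proof. by []. Qed.
Lemma laurentB_coef f g i : (f - g) i = f i - g i. Proof. by []. Qed.
Lemma laurent0_coef i : (0 : L) i = 0. Proof. by rewrite /= if_same. Qed.
Lemma laurent_sum_coef (I : Type) (s : seq I) (P : pred I) (F : I -> L) i :
  (\sum_(j <- s | P j) F j) i = \sum_(j <- s | P j) F j i.
Proof.
by elim/big_rec2: _ => [|j x y _ E]; rewrite ?laurent0_coef // -E.
Qed.

Lemma mono1 : mono 1 0 = 1. Proof. exact: laurentP. Qed.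

Lemma mono_mul_coef c k g i : (mono c k * g) i = c * g (i - k).
Proof.
rewrite /= /conv; apply: has_sum_isum.
have := @has_sum1 _ K _ (fun j => (if j == k then c else 0) * g (i - j)) k.
by rewrite eqxx; apply => j /negPf ->; rewrite mul0r.
Qed.

Lemma monoM c k c' k' : mono c k * mono c' k' = mono (c * c') (k + k').
Proof.
apply: laurentP => i; rewrite mono_mul_coef /= subr_eq [k' + k]addrC.
by case: eqP; rewrite ?mulr0.
Qed.

Lemma truncE f G : trunc f G = \sum_(k <- G) mono (f k) k.
Proof.
apply: laurentP => i; rewrite laurent_sum_coef /=; case: ifP => iG.
  rewrite (big_fsetD1 i) //= eqxx big_seq big1 ?addr0 // => j.
  by rewrite !inE eq_sym => /andP[/negPf ->].
rewrite big_seq big1 // => j jG; case: eqP => // ij.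
by rewrite ij jG in iG.
Qed.

Lemma mono_supported (D : 'rV[int]_n -> Prop) c k : D k -> supported D (mono c k).
Proof. by move=> Dk i Di /=; case: eqP => // ik; case: Di; rewrite ik. Qed.

End Monomials.

Lemma levxx (R : realType) n (rho : 'rV[R]_n) : lev rho rho. Proof. by []. Qed.

Section SingleRadius.
Variables (R : realType) (K : completeNonarchFieldType R) (n : nat).
Variables (rho : 'rV[R]_n) (rho0 : ltv 0 rho).
Local Notation L := (laurent K rho0 (levxx rho)).
Implicit Types (f g q r : L) (c d : R) (i j k s : 'rV[int]_n).

Definition wnorm f i : R := nnorm (f i) * monom rho i.

Lemma wnorm_ge0 f i : 0 <= wnorm f i.
Proof. by rewrite mulr_ge0 ?nnorm_ge0 // ltW // monom_gt0. Qed.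

Lemma bndP f c : bnd f c <-> forall i, wnorm f i <= c.
Proof.
split=> [fc i|fc s rs sr i]; first exact: fc.
have -> : s = rho by apply/rowP => j; apply/le_anti; rewrite rs sr.
exact: fc.
Qed.

Lemma wnorm_tends0 f : tends0 (wnorm f).
Proof. by apply: (tends0_coef rho0 (coefP f)). Qed.

Lemma wnorm_max f : f != 0 ->
  exists i0, 0 < wnorm f i0 /\ forall i, wnorm f i <= wnorm f i0.
Proof.
move=> f0; have [i1 fi1] : exists i, f i != 0.
  apply: contrapT => /forallNP h; case/eqP: f0; apply: laurentP => i.
  by rewrite laurent0_coef; apply/eqP/negPn/negP/h.
have wi1 : 0 < wnorm f i1.
  rewrite mulr_gt0 ?monom_gt0 // lt_def nnorm_ge0 andbT.
  by apply: contra_neq fi1; apply: nnorm0_eq0.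
have [i0 i0P] := null_max_attained (wnorm_ge0 f) (wnorm_tends0 f) wi1.
by exists i0; split=> //; apply: lt_le_trans wi1 (i0P _).
Qed.

Lemma wnorm_bnd f : exists2 c, 0 <= c & bnd f c.
Proof.
have [->|/wnorm_max[i0 [_ i0P]]] := eqVneq f 0; first by exists 0; [|apply: bnd0].
by exists (wnorm f i0); [apply: wnorm_ge0|apply/bndP].
Qed.

(** In an ultrametric sum, a term that is strictly larger than all others determines the
norm. The strict inequality is uniform over the infinitely many other terms by [null_strict_sup]. *)
Lemma wnorm_mul_dominant q f Mq Mf i0 s : 0 < Mq -> 0 < Mf ->
  (forall i, wnorm q i <= Mq) -> (forall i, wnorm f i <= Mf) ->
  wnorm q i0 = Mq -> wnorm f s = Mf ->
  (forall i, wnorm q i = Mq -> wnorm f (i0 + s - i) = Mf -> i = i0) ->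
  wnorm (q * f) (i0 + s) = Mq * Mf.
Proof.
move=> Mq0 Mf0 qM fM qi0 fs uniq; pose k := i0 + s.
have mk : 0 < monom rho k by apply: monom_gt0.
pose u i := q i * f (k - i).
have u0 : null_family u := null_conv rho0 (levxx rho) k (coefP q) (coefP f).
have uE i : nnorm (u i) * monom rho k = wnorm q i * wnorm f (k - i).
  by rewrite /u nnormM /wnorm mulrACA -monomD // subrKC.
have uM i : i != i0 -> nnorm (u i) < Mq * Mf / monom rho k.
  move=> ii0; rewrite ltr_pdivlMr // uE lt_neqAle ler_pM ?wnorm_ge0 // andbT.
  apply: contra_neq ii0 => E.
  have qi : wnorm q i = Mq.
    apply/le_anti; rewrite qM /= leNgt; apply/negP => lt.
    have : wnorm q i * wnorm f (k - i) < Mq * Mf.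
      by apply: le_lt_trans (_ : wnorm q i * Mf < _); rewrite ?ler_wpM2l ?ltr_pM2r ?wnorm_ge0.
    by rewrite E ltxx.
  by apply: uniq => //; apply: (mulfI (lt0r_neq0 Mq0)); rewrite -E qi.
have MM0 : 0 < Mq * Mf / monom rho k by rewrite divr_gt0 ?mulr_gt0.
have [c [c0 cM cP]] := @null_strict_sup R _ (fun i => nnorm (u i)) (fun i => i != i0) _
  (fun i => nnorm_ge0 (u i)) u0 MM0 uM.
pose v i := u i + -1 * (if i == i0 then u i0 else 0).
have hv : has_sum v (isum u + -1 * u i0).
  apply: has_sumD (null_has_sum u0) (has_sumZ (-1) _).
  have := @has_sum1 _ K _ (fun i => if i == i0 then u i0 else 0) i0.
  by rewrite eqxx; apply => i /negPf ->.
have vc : nnorm (isum u - u i0) <= c.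
  rewrite -mulN1r; apply: (has_sum_le hv c0) => i; rewrite /v.
  case: eqP => [->|/eqP ii0]; first by rewrite mulN1r subrr nnorm0.
  by rewrite mulr0 addr0 cP.
have ui0 : nnorm (u i0) = Mq * Mf / monom rho k.
  by apply: (mulIf (lt0r_neq0 mk)); rewrite uE qi0 /k addrC addKr fs divfK // lt0r_neq0.
have -> : wnorm (q * f) k = nnorm (isum u) * monom rho k by [].
suff -> : nnorm (isum u) = Mq * Mf / monom rho k by rewrite divfK // lt0r_neq0.
have le1 : nnorm (isum u) <= Mq * Mf / monom rho k.
  rewrite -[isum u](subrK (u i0)); apply: nnormD_le; last by rewrite ui0.
  exact: le_trans vc (ltW cM).
apply/le_anti; rewrite le1 /= leNgt; apply/negP => lt.
have : nnorm (u i0) < Mq * Mf / monom rho k.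
  rewrite (_ : u i0 = isum u - (isum u - u i0)); last by rewrite subKr.
  by apply: nnormD_lt => //; rewrite nnormN; apply: le_lt_trans cM.
by rewrite ui0 ltxx.
Qed.

Section Extreme.
Variable l : 'rV[int]_n -> int.
Hypothesis lD : {morph l : i j / i + j}.

(** Take i0 extremal for l among the dominant exponents of q, and s the strictly extremal
dominant exponent of f. Any other way of writing i0 + s as a sum of exponents involves a
non-dominant one, so the coefficient of the product there is as large as possible. This gives
the multiplicativity of the Gauss norm, and, applied to l and - l, controls Weierstrass
division at both ends. *)
Lemma wnorm_mul_extreme q f Mf s : q != 0 -> 0 < Mf ->
  (forall i, wnorm f i <= Mf) -> wnorm f s = Mf ->
  (forall i, wnorm f i = Mf -> i != s -> l i < l s) ->
  exists i0, [/\ 0 < wnorm q i0, forall i, wnorm q i <= wnorm q i0,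
    forall i, wnorm q i = wnorm q i0 -> l i <= l i0 &
    wnorm (q * f) (i0 + s) = wnorm q i0 * Mf].
Proof.
move=> /wnorm_max[i1 [q1 qM]] Mf0 fM fs s_max.
have [S SP] := null_level_finite (wnorm_ge0 q) (wnorm_tends0 q) q1.
have i1S : i1 \in S by rewrite SP.
have [i0 i0S i0max] := seq_max_exists l i1S.
have E : wnorm q i0 = wnorm q i1 by apply/eqP; rewrite -SP.
exists i0; rewrite E; split=> // [i qi|].
  by apply: i0max; rewrite SP; apply/eqP.
apply: wnorm_mul_dominant => // i qi fi.
have [//|ii0] := eqVneq i i0.
have is_ : i0 + s - i != s by rewrite addrAC -subr_eq0 addrK subr_eq0 eq_sym.
have lt := s_max _ fi is_.
have le : l i <= l i0 by apply: i0max; rewrite SP; apply/eqP.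
have := ler_ltD le lt; rewrite -lD [i + _]addrC subrK lD ltxx //.
Qed.
End Extreme.
End SingleRadius.

Section Weight.
Variable n : nat.
Implicit Types (i j k : 'rV[int]_n) (N : nat).

(** The degree in the distinguished variable after the monomial change of coordinates attached
to N; the weights N^j are chosen so that finitely many given exponents get distinct degrees. *)
Definition ell N k : int := \sum_(j < n) k 0 j * (N%:Z ^+ j).

Lemma ellD N : {morph ell N : i j / i + j}.
Proof.
by move=> i j; rewrite /ell -big_split; apply: eq_bigr => l _; rewrite mxE mulrDl.
Qed.

(** The differences of the given exponents are nonzero polynomials evaluated at N, so that
any N outside a finite set of roots works. *)
Lemma ell_injective (S : {fset 'rV[int]_n}) :
  exists N, {in S &, injective (ell N)}.
Proof.
pose P k : {poly int} := \poly_(j < n) (if insub j is Some j' then k 0 j' else 0).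
have PE N k : (P k).[N%:Z] = ell N k.
  rewrite (@horner_coef_wide _ n) ?size_poly //; apply: eq_bigr => j _.
  by rewrite coef_poly ltn_ord valK.
have P0 k : P k = 0 -> k = 0.
  move=> Pk; apply/rowP => j; have := congr1 (fun p : {poly int} => p`_j) Pk.
  by rewrite coef_poly ltn_ord valK coef0 mxE.
pose Q := \prod_(i <- S) \prod_(j <- S | i != j) P (i - j).
have Q0 : Q != 0.
  rewrite /Q; elim/big_ind: _ => [|x y x0 y0|i _]; rewrite ?oner_neq0 ?mulf_neq0 //.
  elim/big_ind: _ => [|x y x0 y0|j ij]; rewrite ?oner_neq0 ?mulf_neq0 //.
  by apply: contra ij => /eqP/P0/eqP; rewrite subr_eq0.
have [N QN] : exists N : nat, ~~ root Q N%:Z.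
  apply: contrapT => /forallNP h.
  have := @max_poly_roots _ Q [seq (N%:Z : int) | N <- iota 0 (size Q)] Q0.
  rewrite size_map size_iota ltnn map_inj_uniq ?iota_uniq; last by move=> x y [].
  have -> : all (root Q) [seq (N%:Z : int) | N <- iota 0 (size Q)]; last by move=> /(_ isT isT).
  by apply/allP => _ /mapP[N _ ->]; apply/negPn/negP/h.
exists N => i j iS jS E; apply/eqP; apply: contraR QN => ij.
rewrite rootE /Q (big_fsetD1 i) //= hornerM mulf_eq0; apply/orP; left.
rewrite big_mkcond (big_fsetD1 j) //= ij hornerM mulf_eq0 PE; apply/orP; left.
have : ell N i = ell N (i - j) + ell N j by rewrite -ellD subrK.
by move/eqP; rewrite E -subr_eq subrr eq_sym.
Qed.

End Weight.

Section GaussDomain.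
Variables (R : realType) (K : completeNonarchFieldType R) (n : nat).
Variables (rho : 'rV[R]_n) (rho0 : ltv 0 rho).

(** The ring K_{[rho,rho],n}, named separately so as to carry its domain structure. *)
Definition gauss : Type := laurent K rho0 (levxx rho).
HB.instance Definition _ := GRing.ComNzRing.on gauss.
Implicit Types (f g q : gauss).

Lemma gauss_mul_neq0 q f : q != 0 -> f != 0 -> q * f != 0.
Proof.
move=> q0 /wnorm_max[s1 [f1 fM]].
have [S SP] := null_level_finite (wnorm_ge0 f) (wnorm_tends0 f) f1.
have [N Ninj] := ell_injective S.
have s1S : s1 \in S by rewrite SP.
have [s sS smax] := seq_max_exists (ell N) s1S.
have fs : wnorm f s = wnorm f s1 by apply/eqP; rewrite -SP.
have [|i0 [qi0 _ _ E]] := @wnorm_mul_extreme _ _ _ _ rho0 _ (@ellD n N) q f _ s q0 f1 fM fs.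
  move=> i fi is_; have iS : i \in S by rewrite SP fi.
  rewrite lt_neqAle smax // andbT; apply: contra is_ => /eqP E; apply/eqP; exact: Ninj.
apply: contraTneq (mulr_gt0 qi0 f1) => qf.
by rewrite -E (_ : wnorm _ _ = 0) ?ltxx // qf /wnorm laurent0_coef nnorm0 mul0r.
Qed.

Definition gauss_unit f : bool := `[< exists y, y * f = 1 >].
Definition gauss_inv f : gauss :=
  if pselect (exists y, y * f = 1) is left ex then projT1 (cid ex) else f.

Lemma gauss_mulVr : {in gauss_unit, left_inverse 1 gauss_inv *%R}.
Proof.
move=> f /asboolP fu; rewrite /gauss_inv; case: pselect => // ex.
by case: cid.
Qed.

Lemma gauss_unitP f g : g * f = 1 -> gauss_unit f.
Proof. by move=> gf; apply/asboolP; exists g. Qed.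

Lemma gauss_invr_out : {in [predC gauss_unit], gauss_inv =1 id}.
Proof.
by move=> f /asboolP fu; rewrite /gauss_inv; case: pselect.
Qed.

HB.instance Definition _ := GRing.ComNzRing_hasMulInverse.Build gauss
  gauss_mulVr gauss_unitP gauss_invr_out.

Lemma gauss_integral f g : f * g = 0 -> (f == 0) || (g == 0).
Proof.
move=> fg; rewrite -[_ || _]negbK negb_or; apply/negP => /andP[f0 g0].
by have := gauss_mul_neq0 f0 g0; rewrite fg eqxx.
Qed.

HB.instance Definition _ := GRing.ComUnitRing_isIntegral.Build gauss gauss_integral.

End GaussDomain.

(** * Weierstrass division *)
Section WeierstrassDivision.
Variables (R : realType) (K : completeNonarchFieldType R) (n : nat).
Variables (rho : 'rV[R]_n) (rho0 : ltv 0 rho).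
Local Notation L := (laurent K rho0 (levxx rho)).
Implicit Types (f g q r : L) (c : R) (i j k s : 'rV[int]_n).
Variable l : 'rV[int]_n -> int.
Hypothesis lD : {morph l : i j / i + j}.
Variable top : 'rV[int]_n.

(** The normal form of a series for Weierstrass division with respect to l on an annulus, where
negative degrees occur too: Gauss norm 1, and among the dominant exponents a unique one of lowest
degree, namely 0, and a unique one of highest degree, namely top. *)
Record distinguished f : Prop := Distinguished {
  dist_le1 : forall i, wnorm f i <= 1;
  dist_0 : wnorm f 0 = 1;
  dist_top : wnorm f top = 1;
  dist_min : forall i, wnorm f i = 1 -> i != 0 -> 0 < l i;
  dist_max : forall i, wnorm f i = 1 -> i != top -> l i < l top }.

(** The exponents that may occur in a remainder. *)
Definition below_top k : Prop := 0 <= l k < l top.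

Let l0 : l 0 = 0.
Proof. by apply: (addrI (l 0)); rewrite -lD !addr0. Qed.
Let lN k : l (- k) = - l k.
Proof. by apply/eqP; rewrite -addr_eq0 -lD addNr l0. Qed.

(** The product q f attains the norm of q both at the top and at the bottom of its
degrees. If the highest dominant degree of q is nonnegative, the top one lies above all
remainders; otherwise the bottom one lies below them. So r cannot cancel it. *)
Lemma division_isometry f q r c : distinguished f -> supported below_top r ->
  0 <= c -> bnd (q * f + r) c -> bnd q c.
Proof.
move=> [f1 f0 ftop fmin fmax] rD c0 qfr; have [->|q0] := eqVneq q 0; first exact: bnd0.
have [imax [qmax0 qmax imaxP Emax]] := wnorm_mul_extreme lD q0 ltr01 f1 ftop fmax.
have lND : {morph (fun k => - l k) : i j / i + j} by move=> i j; rewrite lD opprD.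
have [|imin [qmin0 qmin iminP Emin]] := wnorm_mul_extreme lND q0 ltr01 f1 f0.
  by move=> i fi i0; rewrite l0 oppr0 oppr_lt0; apply: fmin.
have key k i0 : wnorm (q * f) k = wnorm q i0 * 1 -> ~ below_top k ->
    (forall i, wnorm q i <= wnorm q i0) -> bnd q c.
  move=> E kD iM; apply/bndP => i; apply: le_trans (iM i) _.
  rewrite -[wnorm q i0]mulr1 -E; move/bndP: qfr => /(_ k).
  by rewrite /wnorm laurentD_coef (rD k kD) addr0.
have [l_ge0|l_lt0] := leP 0 (l imax).
  by apply: key Emax _ qmax => /andP[_]; rewrite lD ltNge lerDr l_ge0.
apply: (key _ _ Emin _ qmin); rewrite /below_top addr0 => /andP[lmin _].
have E : wnorm q imin = wnorm q imax by apply/le_anti; rewrite qmin qmax.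
by have := imaxP _ E; rewrite leNgt => /negP; apply; apply: lt_le_trans lmin.
Qed.

(** For the dominant part F of f, a finite sum, monomials are divided one at a time: degrees at
least l top are lowered with the leading monomial of F, negative degrees are raised with its
lowest monomial 1, until they fall in the range of remainders. *)
Lemma division_trunc_finite f (S G : {fset 'rV[int]_n}) g :
  (forall i, (i \in S) = (wnorm f i == 1)) -> distinguished f ->
  exists q r, supported below_top r /\ trunc g G = q * trunc f S + r.
Proof.
move=> SP [f1 f0 ftop fmin fmax]; set F := trunc f S.
pose good g := exists q r, supported below_top r /\ g = q * F + r.
have goodD g1 g2 : good g1 -> good g2 -> good (g1 + g2).
  move=> [q [r [rD ->]]] [q' [r' [r'D ->]]]; exists (q + q'), (r + r').
  by split; [apply: supportedD|ring].
have goodN g1 : good g1 -> good (- g1).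
  move=> [q [r [rD ->]]]; exists (- q), (- r).
  by split; [apply: supportedN|ring].
have goodF q : good (q * F) by exists q, 0; split; [apply: supported0|rewrite addr0].
have good0 : good 0 by rewrite -(mul0r F); apply: goodF.
have goodm (c : K) k : below_top k -> good (mono rho0 (levxx rho) c k).
  by move=> kD; exists 0, (mono rho0 (levxx rho) c k); split; [apply: mono_supported|rewrite mul0r add0r].
have topS : top \in S by rewrite SP ftop.
have zS : 0 \in S by rewrite SP f0.
have fz i : i \in S -> f i != 0.
  rewrite SP; apply: contraTneq => fi.
  by rewrite /wnorm fi nnorm0 mul0r eq_sym oner_eq0.
have FE s : s \in S -> F = mono rho0 (levxx rho) (f s) s +
    \sum_(i <- (S `\ s)%fset) mono rho0 (levxx rho) (f i) i.
  by move=> sS; rewrite /F truncE (big_fsetD1 s).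
have reduce s (c : K) k : s \in S ->
    (forall i (c' : K), i \in S -> i != s -> good (mono rho0 (levxx rho) c' (k - s + i))) ->
    good (mono rho0 (levxx rho) c k).
  move=> sS h.
  have -> : mono rho0 (levxx rho) c k = mono rho0 (levxx rho) (c / f s) (k - s) * F -
      \sum_(i <- (S `\ s)%fset) mono rho0 (levxx rho) (c / f s) (k - s) * mono rho0 (levxx rho) (f i) i.
    by rewrite (FE s sS) mulrDr mulr_sumr addrK monoM divfK ?fz // subrK.
  apply: (goodD); first exact: goodF.
  apply: (goodN); rewrite big_seq; elim/big_ind: _ => [|x y|i]; [exact: good0|exact: goodD|].
  by rewrite !inE => /andP[is_ iS]; rewrite monoM; apply: h.
have good_up N (c : K) k : l top <= l k -> l k < l top + N%:Z -> good (mono rho0 (levxx rho) c k).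
  elim: N c k => [|N IH] c k lk; first by rewrite addr0 ltNge lk.
  move=> kN; apply: (reduce top) => // i c' iS itop.
  have [lik|lik] := leP (l top) (l (k - top + i)).
    apply: IH => //; rewrite !lD lN.
    have : l i < l top by apply: fmax => //; apply/eqP; rewrite -SP.
    by move: kN; lia.
  apply: goodm; rewrite /below_top lik andbT !lD lN.
  have : 0 <= l i.
    by have [->|i0] := eqVneq i 0; [rewrite l0|apply/ltW/fmin => //; apply/eqP; rewrite -SP].
  by move: lk; lia.
have good_down N (c : K) k : l k < 0 -> - N%:Z <= l k -> good (mono rho0 (levxx rho) c k).
  elim: N c k => [|N IH] c k lk; first by rewrite leNgt oppr0 lk.
  move=> kN; apply: (reduce 0) => // i c' iS i0; rewrite subr0.
  have li : 0 < l i by apply: fmin => //; apply/eqP; rewrite -SP.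
  have [lik|lik] := ltP (l (k + i)) 0.
    by apply: IH => //; rewrite lD; move: li kN; lia.
  apply: goodm; rewrite /below_top lik /= lD.
  have : l i <= l top.
    by have [->|i1] := eqVneq i top; [|apply/ltW/fmax => //; apply/eqP; rewrite -SP].
  by move: lk; lia.
have goodM (c : K) k : good (mono rho0 (levxx rho) c k).
  have [kt|kt] := leP (l top) (l k).
    by apply: (good_up (`|l k - l top|%N.+1)) => //; lia.
  have [k0|k0] := ltP (l k) 0; first by apply: (good_down `|l k|%N) => //; lia.
  by apply: goodm; rewrite /below_top k0.
by rewrite truncE; elim/big_ind: _ => [|x y|i _]; [exact: good0|exact: goodD|exact: goodM].
Qed.

(** Up to a relatively small error, g is a finite sum and f is its dominant part F; for these
[division_trunc_finite] divides, and [division_isometry] bounds quotient and remainder.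
The error is removed by [approx_division]. *)
Lemma weierstrass_division f : distinguished f -> forall g c, 0 <= c -> bnd g c ->
  exists q r, [/\ supported below_top r, bnd q c & g = q * f + r].
Proof.
move=> df; have [f1 f0 ftop fmin fmax] := df.
have [S SP] := null_level_finite (wnorm_ge0 f) (wnorm_tends0 f) ltr01.
pose F := trunc f S.
have FE i : wnorm F i = if i \in S then wnorm f i else 0.
  by rewrite /wnorm /=; case: ifP => // _; rewrite nnorm0 mul0r.
have F1 i : wnorm F i = 1 -> wnorm f i = 1.
  by rewrite FE; case: ifP => // _ /esym/eqP; rewrite oner_eq0.
have dF : distinguished F.
  split=> [i|||i /F1|i /F1]; rewrite ?FE ?SP ?f0 ?ftop ?eqxx //; [|exact: fmin|exact: fmax].
  by case: ifP.
have [e [e0 e1 eP]] : exists e, [/\ 0 <= e, e < 1 & forall i, i \notin S -> wnorm f i <= e].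
  apply: (null_strict_sup (wnorm_ge0 f) (wnorm_tends0 f) ltr01) => i.
  by rewrite SP lt_neqAle f1 andbT.
have fF : bnd (f - F) e.
  apply/bndP => i; rewrite /wnorm laurentB_coef /=; case: ifP => [_|/negbT /eP].
    by rewrite subrr nnorm0 mul0r.
  by rewrite subr0.
(* e bounds f - F; the maximum only makes the factor positive, as the truncation of g requires *)
pose eps := Num.max e 2^-1.
have eps_gt0 : 0 < eps by rewrite lt_max invr_gt0 ltr0n orbT.
have eps1 : eps < 1 by rewrite gt_max e1 invf_lt1 ?ltr0n // ltr1n.
have fb1 : bnd f 1 by apply/bndP.
apply: (approx_division (ltW eps_gt0) eps1 ler01 fb1) => g c c0 gc.
have [c_0|c_n0] := eqVneq c 0.
  have -> : g = 0 by apply: bnd_eq0 => e' e'0; apply: bnd_le (ltW e'0) _; rewrite -c_0.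
  exists 0, 0; rewrite mul0r addr0 subr0 c_0 mulr0.
  by split; [apply: supported0|apply: bnd0|apply: bnd0|apply: bnd0].
have c_gt0 : 0 < c by rewrite lt_def c_n0.
have [G GP] := wnorm_tends0 g (mulr_gt0 eps_gt0 c_gt0).
have [q [r [rD E]]] := @division_trunc_finite f S G g SP df.
have tc : bnd (trunc g G) c.
  apply/bndP => i; rewrite /wnorm /=; case: ifP => _; first by move/bndP: gc; apply.
  by rewrite nnorm0 mul0r.
have qc : bnd q c by apply: division_isometry dF rD c0 _; rewrite -E.
have Fb1 : bnd F 1 by apply/bndP; case: dF.
exists q, r; split=> //.
  rewrite (_ : r = trunc g G - q * F); last by rewrite E addrAC subrr add0r.
  by apply: bndB => //; rewrite -[c]mulr1; apply: bndM.
rewrite (_ : _ - _ = (g - trunc g G) - q * (f - F)); last first.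
  by rewrite E -/F; ring.
apply: bndB.
  apply/bndP => i; rewrite /wnorm laurentB_coef /=; case: ifP => [_|/negbT/GP].
    by rewrite subrr nnorm0 mul0r mulr_ge0 // ltW.
  by rewrite subr0 => /ltW; apply: le_trans; apply: ler_norm.
rewrite mulrC; apply: bndM => //; first exact: ltW.
by apply: bnd_le fF; rewrite /eps le_max lexx.
Qed.

End WeierstrassDivision.

(** * Change of coordinates and Weierstrass preparation *)
Lemma nnormV (R : realType) (K : completeNonarchFieldType R) (x : K) :
  x != 0 -> nnorm x^-1 = (nnorm x)^-1.
Proof.
move=> x0; have nx : nnorm x != 0 by apply: contra_neq x0; apply: nnorm0_eq0.
by apply: (mulIf nx); rewrite -nnormM !mulVf // nnorm1.
Qed.

Lemma has_sum_retract (R : realType) (K : completeNonarchFieldType R)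
    (I J : choiceType) (h : J -> I) (g : I -> J) (u : I -> K) s :
  cancel h g -> (forall i, h (g i) != i -> u i = 0) ->
  has_sum (u \o h) s -> has_sum u s.
Proof.
move=> hg u0 hs e e0; have [F FP] := hs e e0.
exists [fset h j | j in F]%fset => G FG.
pose G' := [fset i in G | h (g i) == i]%fset; pose H := [fset g i | i in G']%fset.
have G'P i : i \in G' -> i \in G /\ h (g i) = i by rewrite !inE /= => /andP[iG /eqP].
have -> : \sum_(i <- G) u i = \sum_(j <- H) (u \o h) j.
  rewrite big_imfset /=; last by move=> i j /G'P[_ Ei] /G'P[_ Ej] E; rewrite -Ei E Ej.
  rewrite (big_fsetID _ (fun i => h (g i) == i)) /= [X in _ + X]big_seq [X in _ + X]big1.
    by rewrite addr0 !big_seq; apply: eq_bigr => i /G'P[_ ->].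
  by move=> i; rewrite !inE /= => /andP[_ /u0].
apply: FP; apply/fsubsetP => j jF.
have hjG : h j \in G by apply: (fsubsetP FG); apply/imfsetP; exists j.
by apply/imfsetP; exists (h j); rewrite ?hg // !inE /= hjG hg eqxx.
Qed.

(** The coordinates s_j = t_j t_0^(- N^j) for j > 0, together with t = t_0. In these coordinates the
exponents of degree 0 for [ell] form a copy of Z^n, so that K_{[rho,rho],1+n} consists of Laurent series
in t over the ring in the s_j, whose radii are [shear_radius]. *)
Section Shear.
Variables (R : realType) (K : completeNonarchFieldType R) (n : nat).
Variables (rho : 'rV[R]_(1 + n)) (rho0 : ltv 0 rho) (N : nat).
Implicit Types (k : 'rV[int]_(1 + n)) (i : 'rV[int]_n) (z : int).

Definition shear_radius : 'rV[R]_n :=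
  \row_j (rho 0 (rshift 1 j) * rho 0 0 ^ (- (N%:Z ^+ j.+1))).

Let rpos j : 0 < rho 0 j. Proof. by have := rho0 j; rewrite mxE. Qed.

Lemma shear_radius_gt0 : ltv 0 shear_radius.
Proof. by move=> j; rewrite !mxE mulr_gt0 // exprz_gt0. Qed.

Definition shift z : 'rV[int]_(1 + n) := row_mx (const_mx z) 0.
Definition embed_index i : 'rV[int]_(1 + n) :=
  row_mx (const_mx (- \sum_j i 0 j * N%:Z ^+ j.+1)) i.

Lemma ell_row_mx z i :
  ell N (row_mx (const_mx z) i : 'rV_(1 + n)) = z + \sum_j i 0 j * N%:Z ^+ j.+1.
Proof.
rewrite /ell big_split_ord /= big_ord1 row_mxEl mxE expr0 mulr1; congr (_ + _).
by apply: eq_bigr => j _; rewrite row_mxEr.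
Qed.

Lemma ell_shift z : ell N (shift z) = z.
Proof. by rewrite ell_row_mx big1 ?addr0 // => j _; rewrite mxE mul0r. Qed.

Lemma ell_embed_index i : ell N (embed_index i) = 0.
Proof. by rewrite ell_row_mx addNr. Qed.

Lemma index_decomp k : embed_index (rsubmx k) + shift (ell N k) = k.
Proof.
rewrite -[in RHS](hsubmxK k) /embed_index /shift add_row_mx addr0; congr row_mx.
rewrite -[in X in _ + X](hsubmxK k) (_ : lsubmx k = const_mx (k 0 0)); last first.
  by apply/rowP => j; rewrite !mxE ord1; congr (k _ _); apply: val_inj.
by rewrite ell_row_mx; apply/rowP => j; rewrite !mxE addrCA addNr addr0.
Qed.

Lemma rsubmx_embed i : rsubmx (embed_index i) = i.
Proof. by rewrite row_mxKr. Qed.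

Lemma rsubmx_shift z : rsubmx (shift z) = 0.
Proof. by rewrite row_mxKr. Qed.

Lemma embed_ker k : ell N k = 0 -> embed_index (rsubmx k) = k.
Proof.
move=> k0; rewrite -[RHS]index_decomp k0 /shift.
by rewrite (_ : const_mx 0 = 0) ?row_mx0 ?addr0.
Qed.

Lemma embed_index0 : embed_index 0 = 0.
Proof.
have l0 : ell N (0 : 'rV[int]_(1 + n)) = 0 by rewrite /ell big1 // => j _; rewrite mxE mul0r.
by rewrite -[RHS](embed_ker l0) linear0.
Qed.

Lemma embed_index_inj : injective embed_index.
Proof. exact: (can_inj rsubmx_embed). Qed.

(** This identity is what determines the radii of the new coordinates. *)
Lemma monom_embed i : monom rho (embed_index i) = monom shear_radius i.
Proof.
rewrite /monom big_split_ord /= big_ord1 row_mxEl mxE.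
have r0 j : rho 0 j != 0 by rewrite gt_eqF.
have r00 : rho 0 (lshift n 0) != 0 by [].
under [RHS]eq_bigr => j _ do rewrite mxE exprzMl ?unitfE // ?expfz_eq0 ?(negPf (r0 _)) ?andbF //.
rewrite [RHS]big_split /= mulrC; congr (_ * _).

  by apply: eq_bigr => j _; rewrite row_mxEr.
rewrite -sumrN (big_morph (fun z => rho 0 (lshift n 0) ^ z) (fun x y => expfzDr x y r00) (expr0z _)).
have -> : lshift n 0 = 0 :> 'I_(1 + n) by apply: val_inj.
by apply: eq_bigr => j _; rewrite exprz_exp; congr (_ ^ _); ring.
Qed.

Local Notation sigma0 := shear_radius_gt0.
Local Notation L := (gauss K rho0).
Local Notation M := (gauss K sigma0).

Lemma convergent_embed (x : M) :
  convergent_on rho rho (fun k => if ell N k == 0 then x (rsubmx k) else 0).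
Proof.
apply/(convergent_onP _ _ rho0) => s rs sr e e0.
have -> : s = rho by apply/rowP => j; apply/le_anti; rewrite rs sr.
have [F FP] := wnorm_tends0 x e0.
exists [fset embed_index i | i in F]%fset => k kF; case: eqP => [k0|_]; last first.
  by rewrite nnorm0 mul0r normr0.
rewrite -[in monom _ _](embed_ker k0) monom_embed; apply: FP; apply: contra kF => kF.
by apply/imfsetP; exists (rsubmx k) => //; rewrite embed_ker.
Qed.

Definition embed (x : M) : L := Laurent rho0 (levxx rho) (convergent_embed x).

Lemma embed_is_zmod_morphism : zmod_morphism embed.
Proof.
by move=> x y; apply: laurentP => k /=; case: ifP; rewrite ?subrr.
Qed.

Lemma embed_is_monoid_morphism : monoid_morphism embed.
Proof.
split; first apply: laurentP => k /=.
  have [k0|k0] := eqVneq (ell N k) 0.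
    rewrite -(inj_eq embed_index_inj) embed_ker //; congr (if _ == _ then _ else _).
    exact: embed_index0.
  by case: eqP => // k00; rewrite k00 /ell big1 ?eqxx // in k0 => j _; rewrite mxE mul0r.
move=> x y; apply: laurentP => k /=; rewrite /conv.
have hN (z : 'rV[int]_(1 + n)) i : ell N (embed_index i + z) = ell N z by rewrite ellD ell_embed_index add0r.
have [k0|k0] := eqVneq (ell N k) 0.
  apply/esym/has_sum_isum.
  apply: (has_sum_retract rsubmx_embed) => [i|].
    by have [/embed_ker ->|_] := eqVneq (ell N i) 0; rewrite ?eqxx ?mul0r.
  have := null_has_sum (null_conv sigma0 (levxx _) (rsubmx k) (coefP x) (coefP y)).
  congr has_sum; apply: funext => i /=; rewrite ell_embed_index eqxx rsubmx_embed.
  have -> : ell N (k - embed_index i) = 0.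
    by rewrite -k0 -(hN (k - embed_index i) i) subrKC.
  by rewrite eqxx linearB /= rsubmx_embed.
apply/esym/has_sum_isum.
have : has_sum (fun _ : 'rV[int]_(1 + n) => 0 : K) (0 : K).
  by move=> e e0; exists (fset0 : {fset 'rV[int]_(1 + n)}) => F _; rewrite big1 // subrr nnorm0.
congr has_sum; apply: funext => i; apply/esym; case: eqP => [i0|]; rewrite ?mul0r //.
have -> : ell N (k - i) = ell N k by rewrite -(hN (k - i) (rsubmx i)) embed_ker // subrKC.
by rewrite (negPf k0) mulr0.
Qed.

HB.instance Definition _ := GRing.isZmodMorphism.Build M L embed embed_is_zmod_morphism.
HB.instance Definition _ := GRing.isMonoidMorphism.Build M L embed embed_is_monoid_morphism.

Lemma shiftD z z' : shift (z + z') = shift z + shift z'.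
Proof. by rewrite /shift add_row_mx addr0; congr row_mx; apply/rowP => j; rewrite !mxE. Qed.

Lemma convergent_slice z (r : L) :
  convergent_on shear_radius shear_radius (fun i => r (embed_index i + shift z)).
Proof.
apply/(convergent_onP _ _ sigma0) => s rs sr.
have -> : s = shear_radius by apply/rowP => j; apply/le_anti; rewrite rs sr.
have inj : injective (fun i => embed_index i + shift z).
  by move=> i j /addIr/embed_index_inj.
have mz : monom rho (shift z) != 0 by rewrite gt_eqF ?monom_gt0.
have := tends0_mulb (b := fun=> (monom rho (shift z))^-1) (fun i => lexx _)
  (tends0_inj inj (wnorm_tends0 r)).
congr tends0; apply: funext => i; rewrite /= /wnorm monomD // monom_embed.
by rewrite mulrA mulfK.
Qed.

(** The coefficient of t^z, as a series in the coordinates s_j. *)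
Definition slice z (r : L) : M := Laurent sigma0 (levxx _) (convergent_slice z r).

Definition shear_var : L := mono rho0 (levxx rho) 1 (shift 1).

Lemma shear_varX d : shear_var ^+ d = mono rho0 (levxx rho) 1 (shift d%:Z).
Proof.
elim: d => [|d IH].
  rewrite expr0 -[LHS]mono1; congr mono; rewrite /shift.
  by rewrite (_ : const_mx _ = 0) ?row_mx0.
by rewrite exprS IH [LHS]monoM mulr1 -shiftD.
Qed.

Lemma poly_at_coef (p : {poly M}) k :
  (poly_at embed shear_var p : L) k =
  if 0 <= ell N k then (p`_(`|ell N k|%N) : M) (rsubmx k) else 0.
Proof.
rewrite (@poly_at_sum _ _ _ _ (size p)) // laurent_sum_coef.
have E (i : nat) : (shear_var ^+ i * embed p`_i) k = if ell N k == i%:Z then (p`_i : M) (rsubmx k) else 0.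
  rewrite shear_varX [LHS]mono_mul_coef mul1r /=.
  have -> : ell N (k - shift i) = ell N k - i%:Z.
    by rewrite -[in RHS](subrK (shift i) k) [in RHS]ellD ell_shift addrK.
  by rewrite subr_eq0 linearB /= rsubmx_shift subr0.
under eq_bigr do rewrite E; case: (ell N k) => m /=; last by rewrite big1.
have [mp|pm] := ltnP m (size p); last first.
  rewrite nth_default // laurent0_coef big1 // => i _; case: eqP => // -[im].
  by have := ltn_ord i; rewrite -im ltnNge pm.
rewrite (bigD1 (Ordinal mp)) //= eqxx big1 ?addr0 // => i ij.
have [[mi]|//] := eqVneq (Posz m) i; case/eqP: ij; exact: val_inj.
Qed.

Lemma poly_at_inj (p : {poly M}) : poly_at embed shear_var p = 0 -> p = 0.
Proof.
move=> p0; apply/polyP => d; rewrite coef0; apply: laurentP => i.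
have := congr1 (fun x : L => x (embed_index i + shift d)) p0.
rewrite poly_at_coef ellD ell_embed_index ell_shift add0r /= linearD /=.
by rewrite rsubmx_embed rsubmx_shift addr0 if_same => ->; rewrite if_same.
Qed.

Lemma supported_poly_at (d : nat) (r : L) : (forall k, ~ (0 <= ell N k < d%:Z) -> r k = 0) ->
  exists2 p : {poly M}, (size p <= d)%N & poly_at embed shear_var p = r.
Proof.
move=> rD; exists (\poly_(l < d) slice l r); first exact: size_poly.
apply: laurentP => k; rewrite poly_at_coef; case: leP => [k0|k0]; last first.
  by rewrite rD // => /andP[]; rewrite leNgt k0.
rewrite coef_poly; case: ltnP => kd /=.
  by rewrite gez0_abs // index_decomp.
rewrite if_same rD // => /andP[_]; rewrite ltNge => /negP[].
by move: k0 kd; lia.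
Qed.

End Shear.

Section Preparation.
Variables (R : realType) (K : completeNonarchFieldType R) (n : nat).
Variables (rho : 'rV[R]_(1 + n)) (rho0 : ltv 0 rho).
Local Notation L := (gauss K rho0).
Local Notation mon c k := (mono rho0 (levxx rho) c k : L).

Lemma mono_unit (c : K) k : c != 0 -> mon c k \is a GRing.unit.
Proof.
move=> c0; apply/unitrP; exists (mon c^-1 (- k)).
split; first by rewrite [LHS]monoM mulVf // addNr mono1.
by rewrite [LHS]monoM mulfV // subrr mono1.
Qed.

Lemma normalize_distinguished (f : L) (smin smax s1 : 'rV[int]_(1 + n)) (l : 'rV[int]_(1 + n) -> int) :
  {morph l : i j / i + j} -> 0 < wnorm f s1 -> (forall i, wnorm f i <= wnorm f s1) ->
  wnorm f smin = wnorm f s1 -> wnorm f smax = wnorm f s1 ->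
  (forall i, wnorm f i = wnorm f s1 -> i != smin -> l smin < l i) ->
  (forall i, wnorm f i = wnorm f s1 -> i != smax -> l i < l smax) ->
  exists2 u : L, u \is a GRing.unit & distinguished l (smax - smin) (u * f).
Proof.
move=> lD M0 fM fmin fmax lmin lmax.
have fs0 : f smin != 0.
  by apply: contraTneq M0 => f0; rewrite -fmin /wnorm f0 nnorm0 mul0r ltxx.
have nfs0 : nnorm (f smin) != 0 by apply: contra_neq fs0; apply: nnorm0_eq0.
have ms0 : monom rho smin != 0 by rewrite gt_eqF ?monom_gt0.
exists (mon (f smin)^-1 (- smin)); first by rewrite mono_unit ?invr_eq0.
have E i : wnorm (mon (f smin)^-1 (- smin) * f) i = wnorm f (i + smin) / wnorm f s1.
  rewrite -fmin /wnorm [X in nnorm X]mono_mul_coef opprK nnormM nnormV // monomD //.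
  by field; rewrite nfs0 ms0.
have M0' := lt0r_neq0 M0.
have E1 i : wnorm (mon (f smin)^-1 (- smin) * f) i = 1 -> wnorm f (i + smin) = wnorm f s1.
  by rewrite E => /divr1_eq.
split=> [i|||i /E1 fi i0|i /E1 fi itop]; rewrite ?E.
- by rewrite ler_pdivrMr // mul1r.
- by rewrite add0r fmin divff.
- by rewrite subrK fmax divff.
- have := lmin _ fi; rewrite -subr_eq0 addrK i0 lD => /(_ isT).
  by rewrite ltrDr.
- have ne : i + smin != smax by apply: contra_neq itop => <-; rewrite addrK.
  have := lmax _ fi ne; rewrite lD.
  have -> : l smax = l (smax - smin) + l smin by rewrite -lD subrK.
  by rewrite ltrD2r.
Qed.

(** Divide the small series f - F, where F is the dominant part of f, by f: the quotient q is small.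
Since F is its leading monomial mt plus a remainder, mt = (1 - q) f - w for some
remainder w, and 1 - q is a unit. Dividing by the unit coefficient of mt turns mt into t^d and
w into a polynomial of degree less than d. *)
Lemma weierstrass_preparation N (f : L) top (d : nat) :
  distinguished (ell N) top f -> ell N top = d%:Z ->
  exists (F : {poly gauss K (shear_radius_gt0 rho0 N)}) (u : L),
  [/\ F \is monic, size F = d.+1, u \is a GRing.unit &
      poly_at (@embed _ K _ _ rho0 N) (shear_var K rho0) F = u * f].
Proof.
move=> df ltop; have [f1 f0 ftop fmin fmax] := df.
have lD := @ellD (1 + n) N.
pose D (k : 'rV[int]_(1 + n)) : Prop := 0 <= ell N k < d%:Z.
have [S SP] := null_level_finite (wnorm_ge0 f) (wnorm_tends0 f) ltr01.
pose F := trunc f S : L.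
have [e [e0 e1 eP]] : exists e, [/\ 0 <= e, e < 1 & forall i, i \notin S -> wnorm f i <= e].
  apply: (null_strict_sup (wnorm_ge0 f) (wnorm_tends0 f) ltr01) => i.
  by rewrite SP lt_neqAle f1 andbT.
have fF : bnd (f - F : L) e.
  apply/bndP => i; rewrite /wnorm laurentB_coef /=; case: ifP => [_|/negbT /eP].
    by rewrite subrr nnorm0 mul0r.
  by rewrite subr0.
have [q [r [rD qe E]]] := weierstrass_division lD df e0 fF.
have topS : top \in S by rewrite SP ftop.
have c0 : f top != 0.
  by apply/eqP => ft; move: ftop; rewrite /wnorm ft nnorm0 mul0r => /esym/eqP; rewrite oner_eq0.
pose mt := mon (f top) top.
have FtD k : ~ D k -> (F - mt : L) k = 0.
  move=> kD; rewrite laurentB_coef /=; case: eqP => [->|ktop].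
    by rewrite topS subrr.
  rewrite subr0; case: ifP => // kS; case: kD; rewrite /D -ltop.
  have fk : wnorm f k = 1 by apply/eqP; rewrite -SP.
  rewrite fmax //; last exact/eqP.
  rewrite andbT; have [->|k0] := eqVneq k 0; first by rewrite /ell big1 // => j _; rewrite mxE mul0r.
  by apply/ltW/fmin.
pose v := 1 - q : L; pose w := r + (F - mt) : L.
have mtE : mt = v * f - w.
  have -> : v * f - w = f - (q * f + r) - (F - mt) by rewrite /v /w; ring.
  by rewrite -E opprB subrKC; ring.
have vu : v \is a GRing.unit.
  have [y yv] := unit_near1 e0 e1 (bndN qe).
  by apply/unitrP; exists y; split=> //; rewrite mulrC.
pose m0 := mon (f top)^-1 (shift n d%:Z - top).
have lm0 : ell N (shift n d%:Z - top) = 0.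
  by apply: (addIr (ell N top)); rewrite -lD subrK ell_shift add0r.
have m0mt : m0 * mt = shear_var K rho0 ^+ d.
  by rewrite [LHS]monoM mulVf // subrK shear_varX.
have m0wD k : ~ (0 <= ell N k < d%:Z) -> (m0 * w) k = 0.
  move=> kD; rewrite [LHS]mono_mul_coef.
  have {}kD : ~ D (k - (shift n d%:Z - top)).
    rewrite /D (_ : ell N _ = ell N k) //.
    by rewrite -[in RHS](subrK (shift n d%:Z - top) k) [RHS]lD lm0 addr0.
  rewrite laurentD_coef FtD // (rD _ _) ?addr0 ?mulr0 //.
  by rewrite /below_top ltop.
have [p sp pE] := supported_poly_at m0wD.
exists ('X^d + p), (m0 * v); split.
- rewrite monicE lead_coefDl ?lead_coefXn // size_polyXn ltnS //.
- by rewrite size_polyDl size_polyXn // ltnS.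
- by rewrite unitrM vu mono_unit ?invr_eq0.
by rewrite rmorphD rmorphXn /= poly_atX pE -m0mt mtE; ring.
Qed.

(** A large N separates the degrees of the finitely many dominant exponents of f; after
multiplication by a monomial f becomes distinguished. *)
Lemma gauss_has_division (f : L) :
  (forall sigma (sigma0 : ltv 0 sigma), proj_free (gauss K (n := n) sigma0)) ->
  f != 0 -> has_division f.
Proof.
move=> IH /wnorm_max[s1 [f1 fM]].
have [S SP] := null_level_finite (wnorm_ge0 f) (wnorm_tends0 f) f1.
have [N Ninj] := ell_injective S.
have s1S : s1 \in S by rewrite SP.
have [smax smaxS smaxP] := seq_max_exists (ell N) s1S.
have [smin sminS sminP] := seq_max_exists (fun k => - ell N k) s1S.
have inS i : wnorm f i = wnorm f s1 -> i \in S by rewrite SP => ->.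
have fS i : i \in S -> wnorm f i = wnorm f s1 by rewrite SP => /eqP.
have strict i j : i \in S -> j \in S -> i != j -> ell N i <= ell N j -> ell N i < ell N j.
  by move=> iS jS ij le; rewrite lt_neqAle le andbT; apply: contra_neq ij; apply: Ninj.
have [||u uu df] := @normalize_distinguished f smin smax s1 (ell N) (@ellD _ N) f1 fM (fS _ sminS) (fS _ smaxS).
- move=> i /inS iS im; apply: strict => //; first by rewrite eq_sym.
  by rewrite -lerN2; apply: sminP.
- by move=> i /inS iS im; apply: strict => //; apply: smaxP.
set top := smax - smin in df.
have [d dE] : exists d : nat, ell N top = d%:Z.
  have : 0 <= ell N top.
    have [->|t0] := eqVneq top 0; first by rewrite /ell big1 // => j _; rewrite mxE mul0r.
    by apply/ltW/(dist_min df) => //; apply: dist_top df.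
  by case: (ell N top) => // d _; exists d.
have [F [v [Fmon sF vu FE]]] := weierstrass_preparation df dE.
exists (gauss K (shear_radius_gt0 rho0 N)), (@embed _ K _ _ rho0 N), (shear_var K rho0), F.
have lD := @ellD (1 + n) N.
split; first exact: IH; last by exists (v * u); rewrite ?unitrM ?vu ?uu // FE mulrA.
split=> // [g|q r].
  have [c c0 gc] := wnorm_bnd g.
  have [q [r [rD _ ->]]] := weierstrass_division lD df c0 gc.
  have [p sp <-] : exists2 p : {poly _}, (size p <= d)%N & poly_at (@embed _ K _ _ rho0 N) (shear_var K rho0) p = r.
    by apply: supported_poly_at => k kD; apply: rD; rewrite /below_top dE.
  exists (q / v), p; rewrite sF ltnS sp; split=> //.
  by congr (_ + _); rewrite FE [RHS]mulrA divrK.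
rewrite sF ltnS => sr E; apply: poly_at_inj.
have q0 : q * v = 0.
  apply: bnd_eq0 => e /ltW e0.
  apply: (division_isometry lD df (r := poly_at (@embed _ K _ _ rho0 N) (shear_var K rho0) r)) => //.
    move=> k; rewrite /below_top dE => kD; rewrite poly_at_coef; case: ifP => // k0.
    rewrite nth_default ?laurent0_coef // (leq_trans sr) // leqNgt; apply/negP => kd.
    by apply: kD; rewrite k0 /=; move: k0 kd; lia.
  rewrite (_ : _ + _ = 0); first exact: bnd0.
  by rewrite -E FE; congr (_ + _); rewrite -[LHS]mulrA.
by move: E; rewrite FE [X in X + _]mulrA q0 mul0r add0r.
Qed.

End Preparation.

Section Base.
Variables (R : realType) (K : completeNonarchFieldType R).
Variables (rho : 'rV[R]_0) (rho0 : ltv 0 rho).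

Definition gauss_const : K -> gauss K rho0 := laurent_const rho0 (levxx rho).

Lemma gauss_const_is_zmod_morphism : zmod_morphism gauss_const.
Proof. by move=> x y; apply: laurentP => k /=; case: ifP; rewrite ?subrr. Qed.

Lemma gauss_const_is_monoid_morphism : monoid_morphism gauss_const.
Proof.
split; first exact: laurentP.
move=> x y; apply: laurentP => k; rewrite [RHS](mono_mul_coef x 0) /= subr0.
by case: ifP; rewrite ?mulr0.
Qed.

HB.instance Definition _ := GRing.isZmodMorphism.Build K (gauss K rho0) gauss_const
  gauss_const_is_zmod_morphism.
HB.instance Definition _ := GRing.isMonoidMorphism.Build K (gauss K rho0) gauss_const
  gauss_const_is_monoid_morphism.

(** With no variables the ring is the field K, and division by a unit has zero remainder. *)
Lemma gauss0_has_division (f : gauss K rho0) : f != 0 -> has_division f.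
Proof.
have k0 (k : 'rV[int]_0) : k = 0 by apply/rowP => -[].
have fE : f = gauss_const (f 0) by apply: laurentP => k; rewrite (k0 k) /= eqxx.
move=> f0; have fu : f \is a GRing.unit.
  rewrite fE; apply: rmorph_unit; rewrite unitfE; apply: contra_neq f0 => f0.
  by rewrite fE f0 rmorph0.
exists K, gauss_const, 0, 1; split; first exact: field_proj_free.
  split=> [|g|q r]; first exact: monic1.
    by exists g, 0; rewrite size_poly0 size_poly1 rmorph0 rmorph1 mulr1 addr0.
  by rewrite size_poly1 ltnS leqn0 size_poly_eq0 => /eqP.
by exists f^-1; rewrite ?unitrV // rmorph1 mulVr.
Qed.
End Base.

(** Induction on the number of variables, each step eliminating the distinguished one. *)
Theorem gauss_proj_free (R : realType) (K : completeNonarchFieldType R) n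
  (rho : 'rV[R]_n) (rho0 : ltv 0 rho) : proj_free (gauss K rho0).
Proof.
elim: n rho rho0 => [|n IH] rho rho0; apply: division_proj_free => f f0.
  exact: gauss0_has_division.
exact: (@gauss_has_division R K n rho rho0 f).
Qed.

(** * Spreading a splitting from one radius to a neighbourhood *)
Section Neighbourhood.
Variables (R : realType) (n : nat).
Implicit Types (s rho a b : 'rV[R]_n) (i : 'rV[int]_n).

Lemma monom_le_vertex a b s i : ltv 0 a -> lev a s -> lev s b ->
  monom s i <= monom (\row_j (if 0 <= i 0 j then b 0 j else a 0 j)) i.
Proof.
move=> a0 as_ sb; apply: ler_prod => j _; rewrite mxE.
have aj : 0 < a 0 j by have := a0 j; rewrite mxE.
have sj : 0 < s 0 j by apply: lt_le_trans aj (as_ j).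
rewrite exprz_ge0 ?(ltW sj) //=; case: (i 0 j) => m /=.
  by rewrite lerXn2r ?nnegrE ?(ltW sj) // (le_trans (ltW sj)).
rewrite NegzE -!exprnN ler_pV2 ?inE ?unitfE ?expf_neq0 ?gt_eqF ?exprn_gt0 //.
by rewrite lerXn2r ?nnegrE ?(ltW aj) ?(ltW sj) //; apply: as_.
Qed.

Lemma monom_le_scale rho s (mu : R) i : ltv 0 rho -> 0 < mu -> mu <= 1 ->
  (forall j, rho 0 j * mu <= s 0 j) -> (forall j, s 0 j <= rho 0 j / mu) ->
  monom s i <= monom rho i * (mu ^+ mabs i)^-1.
Proof.
move=> rho0 mu0 mu1 rs sr.
have rpos j : 0 < rho 0 j by have := rho0 j; rewrite mxE.
have spos j : 0 < s 0 j by apply: lt_le_trans (rs j); rewrite mulr_gt0.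
rewrite /mabs -prodrXr -prodfV -big_split /=; apply: ler_prod => j _.
rewrite exprz_ge0 ?(ltW (spos j)) //=; case: (i 0 j) => m /=.
  rewrite -exprVn -exprMn lerXn2r ?nnegrE ?(ltW (spos j)) //.
  by rewrite divr_ge0 // ltW.
rewrite NegzE -!exprnN -invfM -exprMn ler_pV2 ?inE ?unitfE ?expf_neq0 ?gt_eqF ?exprn_gt0 ?mulr_gt0 //.
by rewrite lerXn2r ?nnegrE ?(ltW (spos j)) // mulr_ge0 // ltW.
Qed.

Lemma shrink_factor (M : nat) : exists mu : R,
  [/\ 0 < mu, mu < 1 & forall m, (m <= M)%N -> (mu ^+ m)^-1 <= 3 / 2].
Proof.
pose x : R := (3 * M.+1%:R)^-1; pose mu := 1 - x.
have M0 : 0 < M.+1%:R :> R by rewrite ltr0n.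
have x0 : 0 < x by rewrite invr_gt0 mulr_gt0 // ltr0n.
have xM : M.+1%:R * x = 3^-1 by rewrite /x invfM mulrCA mulfV ?mulr1 // gt_eqF.
have x1 : x <= 3^-1.
  by rewrite -[leLHS]mul1r -xM ler_wpM2r ?(ltW x0) // ler1n.
have h3 : (3^-1 : R) < 1 by rewrite invf_lt1 ?ltr0n // ltr1n.
have mu0 : 0 < mu by rewrite subr_gt0 (le_lt_trans x1).
have mu1 : mu < 1 by rewrite gtrBl.
exists mu; split=> // m mM.
have bern l : 1 - l%:R * x <= mu ^+ l.
  elim: l => [|l IH]; first by rewrite mul0r subr0 expr0.
  rewrite exprS; apply: le_trans (_ : mu * (1 - l%:R * x) <= _); last by rewrite ler_wpM2l // ltW.
  rewrite -subr_ge0 /mu -natr1 (_ : _ - _ = l%:R * (x * x)); last by ring.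
  by rewrite mulr_ge0 // mulr_ge0 // ltW.
have le : 2 / 3 <= mu ^+ m.
  apply: le_trans (bern m); rewrite lerBrDr -lerBrDl.
  have -> : 1 - 2 / 3 = 3^-1 :> R by field.
  by rewrite -xM ler_wpM2r ?(ltW x0) // ler_nat ltnW.
have -> : 3 / 2 = (2 / 3)^-1 :> R by rewrite invfM invrK mulrC.
by rewrite ler_pV2 ?inE ?unitfE ?gt_eqF ?exprn_gt0 ?divr_gt0 ?ltr0n.
Qed.

Lemma shrink_box a b rho (mu : R) : ltv 0 rho -> ltv a rho -> ltv rho b -> 0 < mu -> mu < 1 ->
  exists a' b', [/\ ltv a a', ltv a' rho, ltv rho b', ltv b' b &
    forall j, rho 0 j * mu <= a' 0 j /\ b' 0 j <= rho 0 j / mu].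
Proof.
move=> rho0 arho rhob mu0 mu1.
have rpos j : 0 < rho 0 j by have := rho0 j; rewrite mxE.
exists (\row_j Num.max ((a 0 j + rho 0 j) / 2) (rho 0 j * mu)),
  (\row_j Num.min ((rho 0 j + b 0 j) / 2) (rho 0 j / mu)).
split=> j; rewrite ?mxE.
- by rewrite lt_max midf_lt.
- by rewrite gt_max midf_lt //= gtr_pMr.
- by rewrite lt_min midf_lt //= ltr_pdivlMr // gtr_pMr.
- by rewrite gt_min midf_lt.
- by rewrite le_max ge_min !lexx !orbT.
Qed.
End Neighbourhood.

Section Spreading.
Variables (R : realType) (K : completeNonarchFieldType R) (n : nat).
Variables (a b rho : 'rV[R]_n) (a0 : ltv 0 a) (ab : ltv a b).
Hypotheses (arho : ltv a rho) (rhob : ltv rho b).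
Local Notation A := (laurent K a0 (ltvW ab)).

Let rho0 : ltv 0 rho. Proof. exact: ltv_trans a0 arho. Qed.

(** Outside a finite set of exponents the bound c holds on all of [a, b], since it holds at its
vertices, which dominate; on the finite set, monomials vary by a factor at most 3/2 close to
rho. *)
Lemma small_near (h : A) c : 0 < c -> (forall i, nnorm (h i) * monom rho i <= c) ->
  exists a' b', [/\ ltv a a', ltv a' rho, ltv rho b', ltv b' b &
    forall s, lev a' s -> lev s b' -> forall i, nnorm (h i) * monom s i <= c * (3 / 2)].
Proof.
move=> c0 hc.
pose v (th : {ffun 'I_n -> bool}) : 'rV[R]_n := \row_j (if th j then b 0 j else a 0 j).
have /choice[F FP] th : exists F : {fset 'rV[int]_n}, forall i, i \notin F ->
    nnorm (h i) * monom (v th) i < c.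
  have av : lev a (v th) by move=> j; rewrite mxE; case: ifP => // _; apply: ltvW ab j.
  have vb : lev (v th) b by move=> j; rewrite mxE; case: ifP => // _; apply: ltvW ab j.
  have [F FP] := tends0_coef a0 (coefP h) av vb c0.
  by exists F => i /FP; apply: le_lt_trans; apply: ler_norm.
pose G := (\bigcup_(th <- enum {ffun 'I_n -> bool}) F th)%fset.
pose M := (\sum_(i <- G) mabs i)%N.
have [mu [mu0 mu1 muP]] := @shrink_factor R M.
have [a' [b' [aa' a'rho rhob' b'b box]]] := shrink_box rho0 arho rhob mu0 mu1.
exists a', b'; split=> // s a's sb' i.
have c32 : c <= c * (3 / 2) by rewrite ler_pMr // ler_pdivlMr ?ltr0n // mul1r ler_nat.
have [iG|iG] := boolP (i \in G).
  have iM : (mabs i <= M)%N by rewrite /M (big_fsetD1 i) //= leq_addr.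
  apply: le_trans (_ : nnorm (h i) * (monom rho i * (mu ^+ mabs i)^-1) <= _).
    rewrite ler_wpM2l ?nnorm_ge0 // monom_le_scale ?(ltW mu1) //.
      by move=> j; apply: le_trans (a's j); case: (box j).
    by move=> j; apply: le_trans (sb' j) _; case: (box j).
  rewrite mulrA ler_pM ?invr_ge0 ?exprn_ge0 ?mulr_ge0 ?nnorm_ge0 ?(ltW mu0) ?muP //.
  by rewrite ltW // monom_gt0.
pose th := [ffun j => 0 <= i 0 j].
have : i \notin F th.
  by apply: contra iG => iF; apply/bigfcupP; exists th => //; rewrite mem_enum.
move=> /FP/ltW h1; apply: le_trans c32; apply: le_trans h1.
rewrite ler_wpM2l ?nnorm_ge0 //.
have -> : v th = \row_j (if 0 <= i 0 j then b 0 j else a 0 j).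
  by apply/rowP => j; rewrite !mxE ffunE.
apply: monom_le_vertex => // j.
  exact: le_trans (ltvW aa' j) (a's j).
exact: le_trans (sb' j) (ltvW b'b j).
Qed.

End Spreading.

Section DetNear1.
Variables (R : realType) (K : completeNonarchFieldType R) (n : nat).
Variables (a b : 'rV[R]_n) (a0 : ltv 0 a) (ab : lev a b).
Local Notation L := (laurent K a0 ab).

Lemma bnd_nat (m : bool) : bnd (m%:R : L) 1.
Proof.
case: m; last exact: bnd0.
move=> s as_ sb i /=; case: eqP => [->|_]; last by rewrite nnorm0 mul0r ler01.
by rewrite nnorm1 monom0 mulr1.
Qed.

(** A product of entries of 1 + N differs from that of the entries of 1 by a sum of
products, each containing an entry of N and factors of norm at most 1. *)
Lemma bnd_det_near1 r (N : 'M[L]_r) e : 0 <= e -> e <= 1 ->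
  (forall i j, bnd (N i j) e) -> bnd (\det (1%:M + N) - 1) e.
Proof.
move=> e0 e1 Ne; rewrite -[X in _ - X](det1 L r) /determinant -sumrB.
apply: bnd_sum => // s _; rewrite -mulrBr.
have key : bnd (\prod_(i < r) (1%:M + N) i (s i)) 1 /\
   bnd (\prod_(i < r) (1%:M : 'M[L]_r) i (s i)) 1 /\
   bnd (\prod_(i < r) (1%:M + N) i (s i) - \prod_(i < r) (1%:M : 'M[L]_r) i (s i)) e.
  elim/big_rec2: _ => [|i y x _ [y1 [x1 xy]]].
    by rewrite subrr; split; [exact: (bnd_nat true)|split; [exact: (bnd_nat true)|apply: bnd0]].
  have n1 : bnd (N i (s i)) 1 by apply: bnd_le (Ne _ _).
  have d1 : bnd ((1%:M : 'M[L]_r) i (s i)) 1 by rewrite mxE; apply: bnd_nat.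
  rewrite [X in X * _]mxE; split; last split.
  - by rewrite -[X in bnd _ X]mulr1; apply: bndM => //; apply: bndD.
  - by rewrite -[X in bnd _ X]mulr1; apply: bndM.
  rewrite (_ : _ - _ = N i (s i) * x + (1%:M : 'M[L]_r) i (s i) * (x - y)); last by ring.
  by apply: bndD; [rewrite -[e]mulr1; apply: bndM|rewrite -[e]mul1r; apply: bndM].
case: key => _ [_ key]; case: (odd_perm s); rewrite ?expr1 ?expr0 ?mulN1r ?mul1r //.
exact: bndN.
Qed.
End DetNear1.

Section Descent.
Variables (R : realType) (K : completeNonarchFieldType R) (n : nat).
Variables (a b rho : 'rV[R]_n) (a0 : ltv 0 a) (ab : ltv a b).
Hypotheses (arho : ltv a rho) (rhob : ltv rho b).
Local Notation A := (laurent K a0 (ltvW ab)).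

Let rho0 : ltv 0 rho. Proof. exact: ltv_trans a0 arho. Qed.
Local Notation G := (gauss K rho0).

Let at_rho : {rmorphism A -> G} :=
  laurent_restr (a0 := a0) (ab := ltvW ab) rho0 (levxx rho) (ltvW arho) (ltvW rhob).

Lemma mx_approx m r (X : 'M[G]_(m, r)) c : 0 < c ->
  exists X0 : 'M[A]_(m, r), forall i j, bnd (map_mx at_rho X0 i j - X i j) c.
Proof.
move=> c0.
have approx (x : G) : exists y : A, bnd (at_rho y - x) c.
  have [F FP] := wnorm_tends0 x c0.
  have yP : convergent_on a b (fun i => if i \in F then x i else 0).
    by apply: (@convergent_finsupp _ _ _ _ _ F) => i /negPf ->.
  exists (Laurent a0 (ltvW ab) yP); apply/bndP => i; rewrite /wnorm laurentB_coef /=.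
  case: ifP => [_|/negbT/FP/ltW]; first by rewrite subrr nnorm0 mul0r ltW.
  by rewrite sub0r nnormN; apply: le_trans; apply: ler_norm.
have /choice[y yP] := approx.
by exists (map_mx y X) => i j; rewrite !mxE.
Qed.

Lemma mx_bounded m r (X : 'M[G]_(m, r)) :
  exists2 C, 0 < C & forall i j, bnd (X i j) C.
Proof.
have /choice[c cP] (ij : 'I_m * 'I_r) : exists c, 0 <= c /\ bnd (X ij.1 ij.2) c.
  by have [c c0 h] := wnorm_bnd (X ij.1 ij.2); exists c.
have c_ge0 ij : 0 <= c ij by case: (cP ij).
exists (1 + \sum_ij c ij); first by rewrite ltr_pwDl ?ltr01 // sumr_ge0.
move=> i j; apply: bnd_le (proj2 (cP (i, j))).
by rewrite (bigD1 (i, j)) //= addrCA lerDl addr_ge0 ?ler01 // sumr_ge0.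
Qed.

Lemma bnd_mulmx m r k (X : 'M[G]_(m, r)) (Y : 'M[G]_(r, k)) c d : 0 <= c -> 0 <= d ->
  (forall i j, bnd (X i j) c) -> (forall i j, bnd (Y i j) d) ->
  forall i j, bnd ((X *m Y) i j) (c * d).
Proof.
move=> c0 d0 Xc Yd i j; rewrite mxE; apply: bnd_sum; first exact: mulr_ge0.
by move=> l _; apply: bndM.
Qed.

(** The splitting X, Y at radius rho is approximated by matrices X0, Y0 of Laurent polynomials, which
are defined on all of [a, b]. As Y X0 and Y0 X are close to Y X = 1, the determinant of
Y0 e X0 = (Y0 X) (Y X0) is close to 1. *)
Lemma approx_splitting m (e : 'M[A]_m) : e *m e = e ->
  exists r (X : 'M[G]_(m, r)) (Y : 'M[G]_(r, m)) (X0 : 'M[A]_(m, r)) (Y0 : 'M[A]_(r, m)),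
  [/\ X *m Y = map_mx at_rho e, Y *m X = 1%:M &
      bnd (at_rho (\det (Y0 *m e *m X0)) - 1) 2^-1].
Proof.
move=> ee.
have [|r [X [Y [XY YX]]]] := @gauss_proj_free _ K _ _ rho0 _ (map_mx at_rho e : 'M[G]_m).
  by rewrite -map_mxM ee.
have [C C0 XC] := mx_bounded X; have [D D0 YD] := mx_bounded Y.
have two : 0 < 2^-1 :> R by rewrite invr_gt0 ltr0n.
have two1 : 2^-1 <= 1 :> R by rewrite invf_le1 ?ltr0n // ler1n.
have [X0 X0P] := mx_approx X (divr_gt0 two D0).
have [Y0 Y0P] := mx_approx Y (divr_gt0 two C0).
exists r, X, Y, X0, Y0; split=> //.
pose X0' := map_mx at_rho X0; pose Y0' := map_mx at_rho Y0.
have E1 : Y *m X0' = 1%:M + Y *m (X0' - X) by rewrite mulmxBr YX subrKC.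
have E2 : Y0' *m X = 1%:M + (Y0' - Y) *m X by rewrite mulmxBl YX subrKC.
have two0 := ltW two.
have b1 : bnd (\det (Y *m X0') - 1) 2^-1.
  rewrite E1; apply: bnd_det_near1 => // i j.
  have := bnd_mulmx (ltW D0) (ltW (divr_gt0 two D0)) YD (Y := X0' - X).
  rewrite mulrCA divff ?gt_eqF // mulr1; apply => {}i {}j.
  by rewrite mxE [X in _ + X]mxE; apply: X0P.
have b2 : bnd (\det (Y0' *m X) - 1) 2^-1.
  rewrite E2; apply: bnd_det_near1 => // i j.
  have := bnd_mulmx (ltW (divr_gt0 two C0)) (ltW C0) (X := Y0' - Y) _ XC.
  rewrite divfK ?gt_eqF //; apply => {}i {}j.
  by rewrite mxE [X in _ + X]mxE; apply: Y0P.
rewrite -det_map_mx !map_mxM -XY mulmxA -(mulmxA (_ *m X)) det_mulmx.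
set u := \det _ in b2 *; set v := \det _ in b1 *.
rewrite (_ : u * v - 1 = (u - 1) + (v - 1) + (u - 1) * (v - 1)); last by ring.
apply: bndD; first exact: bndD.
by apply: bnd_le (bndM two0 two0 b2 b1); rewrite ler_piMr.
Qed.

(** Near rho, M = Y0 e X0 is invertible by [small_near], and e X0 and M^-1 Y0 e split the idempotent
e X0 M^-1 Y0 e. It equals e: restriction to radius rho is injective, and there this idempotent is
X (Y X0) M^-1 (Y0 X) Y = X Y. *)
Lemma splitting_spreads m (e : 'M[A]_m) : e *m e = e ->
  exists (a' b' : 'rV[R]_n) (a'0 : ltv 0 a') (b'0 : ltv 0 b') (aa' : ltv a a') (a'rho : ltv a' rho)
    (rhob' : ltv rho b') (b'b : ltv b' b),
  splits (map_mx (laurent_restr (K := K) (a0 := a0) (ab := ltvW ab) a'0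
     (ltvW (ltv_trans a'rho rhob')) (ltvW aa') (ltvW b'b)) e).
Proof.
move=> ee; have [r [X [Y [X0 [Y0 [XY YX dP]]]]]] := approx_splitting ee.
pose M := Y0 *m e *m X0; pose h := \det M - 1.
have two : 0 < 2^-1 :> R by rewrite invr_gt0 ltr0n.
have hP i : nnorm (h i) * monom rho i <= 2^-1.
  by move/bndP: dP => /(_ i).
have [a' [b' [aa' a'rho rhob' b'b hs]]] := small_near arho rhob two hP.
have a'0 := ltv_trans a0 aa'.
have b'0 := ltv_trans rho0 rhob'.
exists a', b', a'0, b'0, aa', a'rho, rhob', b'b.
set A' := laurent K a'0 (ltvW (ltv_trans a'rho rhob')).
pose res : {rmorphism A -> A'} :=
  laurent_restr (a0 := a0) (ab := ltvW ab) a'0 (ltvW (ltv_trans a'rho rhob')) (ltvW aa') (ltvW b'b).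
have [y yP] : exists y : A', y * (1 + res h) = 1.
  apply: (@unit_near1 _ _ _ _ _ _ _ _ (2^-1 * (3 / 2))).
  - by rewrite mulr_ge0 ?divr_ge0 ?invr_ge0 ?ler0n.
  - rewrite mulrCA -invfM -natrM ltr_pdivrMr ?ltr0n // mul1r ltr_nat //.
  - by move=> s as_ sb i; apply: hs.
have ydet : y * \det (map_mx res M) = 1.
  by rewrite det_map_mx -yP /h rmorphB rmorph1 subrKC.
pose W := y *: \adj (map_mx res M).
have MW : map_mx res M *m W = 1%:M.
  by rewrite -scalemxAr mul_mx_adj scale_scalar_mx ydet.
have WM : W *m map_mx res M = 1%:M by rewrite -scalemxAl mul_adj_mx scale_scalar_mx ydet.
pose e' := map_mx res e.
have ee' : e' *m e' = e' by rewrite -map_mxM ee.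
exists r, (e' *m map_mx res X0), (W *m map_mx res Y0 *m e'); split; last first.
  by rewrite mulmxA -(mulmxA _ e' e') ee' -WM !map_mxM !mulmxA.
pose res' : {rmorphism A' -> G} :=
  laurent_restr (a0 := a'0) (ab := ltvW (ltv_trans a'rho rhob')) rho0 (levxx rho) (ltvW a'rho) (ltvW rhob').
have res'_inj x x' : res' x = res' x' -> x = x'.
  by move=> /(congr1 (@coef _ _ _ _ _ _ _)) E; apply: laurentP => i; apply: (congr1 (fun f => f i) E).
have res'E k l (N : 'M[A]_(k, l)) : map_mx res' (map_mx res N) = map_mx at_rho N.
  by apply/matrixP => i j; rewrite !mxE; apply: laurentP.
apply/matrixP => i j; apply: res'_inj.
suff : map_mx res' (e' *m map_mx res X0 *m (W *m map_mx res Y0 *m e')) = map_mx res' e'.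
  by move/matrixP => /(_ i j); rewrite [LHS]mxE [RHS]mxE.
rewrite !map_mxM /= !res'E -XY.
set W' := map_mx res' W; set P := map_mx at_rho X0; set Q := map_mx at_rho Y0.
have QPW : (Q *m X) *m (Y *m P *m W') = 1%:M.
  have := congr1 (map_mx res') MW; rewrite map_mxM res'E map_mx1 !map_mxM -XY => <-.
  by rewrite !mulmxA.
have PWQ := mulmx1C QPW.
transitivity (X *m (Y *m P *m W' *m (Q *m X)) *m Y); first by rewrite !mulmxA.
by rewrite PWQ mulmx1.
Qed.
End Descent.

(** * Projective modules and idempotent matrices *)
Section ModuleMatrix.
Variables (A : comNzRingType) (P : lmodType A).

Lemma projective_idempotent : finitely_generated P -> projective P ->
  exists m (g : 'I_m -> P) (h : {linear P -> 'rV[A]_m}) (e : 'M[A]_m),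
  [/\ e *m e = e, forall i, h (g i) = row i e,
      forall x, x = \sum_i h x 0 i *: g i & forall i, g i = \sum_j e i j *: g j].
Proof.
move=> [m [g gP]] proj.
pose q (c : 'rV[A]_m) : P := \sum_i c 0 i *: g i.
have qlin : linear q.
  move=> c x y; rewrite /q scaler_sumr -big_split /=; apply: eq_bigr => i _.
  by rewrite !mxE scalerDl scalerA.
pose qL : {linear 'rV[A]_m -> P} := HB.pack q (GRing.isLinear.Build A 'rV[A]_m P *:%R q qlin).
have [|h hP] := proj _ _ qL idfun.
  move=> x; have [c ->] := gP x; exists (\row_i c i).
  by apply: eq_bigr => i _; rewrite mxE.
have hq x : x = \sum_i h x 0 i *: g i by rewrite -[LHS](hP x).
exists m, g, h, (\matrix_i h (g i)); split=> // [|i|i].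
- apply/row_matrixP => i; rewrite row_mul rowK {2}(hq (g i)) linear_sum /= mulmx_sum_row.
  by apply: eq_bigr => j _; rewrite rowK linearZ.
- by rewrite rowK.
- by rewrite [LHS]hq; apply: eq_bigr => j _; rewrite mxE.
Qed.
End ModuleMatrix.

(** If e splits as X Y after base change, the rows of Y, as combinations of the images of the
generators, form a basis; coordinates are given by the base change of the section h of the
presentation. *)
Lemma fg_projective_idempotent (A : comNzRingType) (P : lmodType A) :
  finitely_generated P -> projective P ->
  exists m (e : 'M[A]_m), e *m e = e /\
    forall (B : comNzRingType) (phi : {rmorphism A -> B}),
    splits (map_mx phi e) -> is_free (base_change phi P).
Proof.
move=> Pfg Pproj; have [m [g [h [e [ee hg hx ge]]]]] := projective_idempotent Pfg Pproj.
exists m, e; split=> // B phi [r [X [Y [XY YX]]]].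
pose u (c : 'rV[B]_m) : base_change phi P := \sum_i c 0 i *: tens phi 1 (g i).
have uD c d : u (c + d) = u c + u d.
  by rewrite /u -big_split; apply: eq_bigr => i _; rewrite mxE scalerDl.
have uZ (b : B) c : u (b *: c) = b *: u c.
  by rewrite /u scaler_sumr; apply: eq_bigr => i _; rewrite mxE scalerA.
have u0 : u 0 = 0 by rewrite /u big1 // => i _; rewrite mxE scale0r.
have u_sum (I : Type) (s : seq I) (F : I -> 'rV[B]_m) : u (\sum_(i <- s) F i) = \sum_(i <- s) u (F i).
  exact: (big_morph u uD u0).
have tens0 : tens phi 1 (0 : P) = 0.
  by apply: (addrI (tens phi 1 0)); rewrite -tensDr !addr0.
have u_phi (v : 'rV[A]_m) : u (map_mx phi v) = tens phi 1 (\sum_i v 0 i *: g i).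
  rewrite (big_morph (tens phi 1) (tensDr phi 1) tens0); apply: eq_bigr => i _.
  by rewrite mxE -tens_bal tensZ mulr1 mul1r.
pose e' := map_mx phi e.
have u_e c : u (c *m e') = u c.
  rewrite mulmx_sum_row u_sum; apply: eq_bigr => i _; rewrite uZ -map_row u_phi.
  by rewrite [in RHS]ge; congr (_ *: tens _ _ _); apply: eq_bigr => j _; rewrite mxE.
have [H HP] : exists H : {linear base_change phi P -> 'rV[B]_m},
    forall b x, H (tens phi b x) = b *: map_mx phi (h x).
  apply: base_change_lift => [x y|c x]; first by rewrite linearD map_mxD.
  by rewrite linearZ map_mxZ.
have Hu c : H (u c) = c *m e'.
  rewrite /u linear_sum mulmx_sum_row; apply: eq_bigr => i _.
  by rewrite linearZ /= HP scale1r hg map_row.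
have YE : Y *m e' = Y by rewrite /e' -XY mulmxA YX mul1mx.
exists 'I_r, (fun j => u (row j Y)); split=> [z|s c sc0 i is_].
  have [s ->] := tens_span z.
  pose d := \sum_(y <- s) y.1 *: map_mx phi (h y.2).
  exists [fset j | j in 'I_r]%fset, (fun j => (d *m X) 0 j).
  rewrite (big_uniq _ (fset_uniq _)).
  transitivity (u d).
    rewrite /d u_sum; apply: eq_bigr => -[b x] _ /=.
    by rewrite uZ u_phi -hx tensZ mulr1.
  rewrite -u_e /e' -XY mulmxA mulmx_sum_row u_sum [RHS]big_mkcond /=; apply: eq_bigr => j _.
  by rewrite uZ inE.
pose d := \row_j (if j \in s then c j else 0).
have dY : d *m Y = 0.
  have := congr1 H sc0; rewrite linear0 => <-.
  rewrite linear_sum mulmx_sum_row (big_uniq _ (fset_uniq _)) [RHS]big_mkcond.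
  apply: eq_bigr => j _; rewrite mxE; case: ifP => _; last by rewrite scale0r.
  by rewrite linearZ /= Hu -row_mul YE.
have : d = 0 by rewrite -[d]mulmx1 -YX mulmxA dY mul0mx.
by move/rowP => /(_ i); rewrite !mxE is_.
Qed.

Theorem theorem1p18 (R : realType) (p : nat) (p_prime : prime p)
    (K : completeNonarchFieldType R) (charK : [pchar K] =i pred0)
    (norm_p : nnorm (p%:R : K) = (p%:R : R)^-1)
    (n : nat) (n_gt0 : (0 < n)%N)
    (alpha beta : 'rV[R]_n) (alpha_gt0 : ltv 0 alpha) (beta_gt0 : ltv 0 beta)
    (alpha_beta : ltv alpha beta)
    (P : lmodType (laurent K alpha_gt0 (ltvW alpha_beta)))
    (P_fg : finitely_generated P) (P_proj : projective P)
    (rho : 'rV[R]_n) (alpha_rho : ltv alpha rho) (rho_beta : ltv rho beta) :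
  exists (alpha' beta' : 'rV[R]_n)
    (alpha'_gt0 : ltv 0 alpha') (beta'_gt0 : ltv 0 beta')
    (alpha_alpha' : ltv alpha alpha') (alpha'_rho : ltv alpha' rho)
    (rho_beta' : ltv rho beta') (beta'_beta : ltv beta' beta),
    is_free (module_restr alpha'_gt0 (ltvW (ltv_trans alpha'_rho rho_beta'))
               (ltvW alpha_alpha') (ltvW beta'_beta) P).
Proof.
have [m [e [ee free_of_split]]] := fg_projective_idempotent P_fg P_proj.
have [a' [b' [a'0 [b'0 [aa' [a'rho [rhob' [b'b split_e]]]]]]]] :=
  splitting_spreads alpha_rho rho_beta ee.
exists a', b', a'0, b'0, aa', a'rho, rhob', b'b; exact: free_of_split split_e.
Qed.
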